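(* Consider a stationary memoryless classical-quantum channel with input alphabet $\mathcal{X}=\{0,1,\dots,N\}$ such that for all $x\in\mathcal{X}$, $\operatorname{supp}(\sigma_x)\subseteq\operatorname{supp}(\sigma_0)$ and $\operatorname{supp}(\rho_x)\subseteq\operatorname{supp}(\rho_0)$, and such that $\rho_0$ is not a mixture of $\{\rho_x\}_{x\in\mathcal{X}\setminus\{0\}}$. Let $\tilde p$ be a probability distribution on $\mathcal{X}\setminus\{0\}$, let $\gamma_n=o(1)\cap\omega(\log n/\sqrt{n})$ and $\alpha_n=\gamma_n/\sqrt n$. Then for every $\varsigma\in(0,1)$ there exist constants $\varsigma_1,\varsigma_2,\varsigma_3>0$ such that for all sufficiently large $n$ there exists a coding scheme with $$\log M=(1-\varsigma)\gamma_n\sqrt n\sum_{x\ne0}\tilde p(x)D(\sigma_x\|\sigma_0),$$ $$\log K=\gamma_n\sqrt n\Big[\sum_{x\ne0}\tilde p(x)\big((1+\varsigma)D(\rho_x\|\rho_0)-(1-\varsigma)D(\sigma_x\|\sigma_0)\big)\Big]^+,$$ and $$\mathbb{P}_{\rm e}^B\le e^{-\varsigma_1\gamma_n\sqrt n},\quad \big|D(\bar\rho^n\|\rho_0^{\otimes n})-D(\rho_{\alpha_n}^{\otimes n}\|\rho_0^{\otimes n})\big|\le e^{-\varsigma_2\gamma_n\sqrt n},\quad D(\rho_{\alpha_n}^{\otimes n}\|\rho_0^{\otimes n})\le\varsigma_3\gamma_n^2.$$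
   Context: A stationary memoryless classical-quantum (cq) channel maps each input symbol $x$ of a finite alphabet $\mathcal{X}$ to density operators $\sigma_x$ at Bob and $\rho_x$ at Willie (finite-dimensional); symbol $0$ is the innocent symbol. An input sequence $\mathbf{x}$ produces $\sigma^n(\mathbf{x})=\sigma_{x_1}\otimes\cdots\otimes\sigma_{x_n}$ at Bob and $\rho^n(\mathbf{x})=\rho_{x_1}\otimes\cdots\otimes\rho_{x_n}$ at Willie. A coding scheme of blocklength $n$: codewords $\mathbf{x}(m,k)\in\mathcal{X}^n$, $m\in\{1,\dots,M\}$ (message), $k\in\{1,\dots,K\}$ (pre-shared secret), both uniform; for each $k$ Bob uses a decoding POVM $\{\Lambda_{m,k}\}_m$ and $\mathbb{P}_{\rm e}^B=\frac1M\sum_m(1-\operatorname{Tr}\{\Lambda_{m,k}\sigma^n(\mathbf{x}(m,k))\})$. Willie's average state is $\bar\rho^n=\frac{1}{MK}\sum_{m,k}\rho^n(\mathbf{x}(m,k))$. ''$\rho_0$ is not a mixture of $\{\rho_x\}_{x\ne0}$'' means there is no probability distribution $\pi$ on $\mathcal{X}\setminus\{0\}$ with $\rho_0=\sum_{x\ne0}\pi(x)\rho_x$. $\tilde\rho=\sum_{x\ne0}\tilde p(x)\rho_x$ and $\rho_{\alpha}=(1-\alpha)\rho_0+\alpha\tilde\rho$. $D(\rho\|\sigma)=\operatorname{Tr}\{\rho(\log\rho-\log\sigma)\}$; $[c]^+=\max\{c,0\}$. $\gamma_n=o(1)\cap\omega(\log n/\sqrt n)$ means $\gamma_n\to0$ and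 $\sqrt n\gamma_n/\log n\to\infty$.
   Formalization: Since M and K are integers, the equalities for log M and log K cannot hold literally in general; M is taken as the exponential of the stated value rounded down, and K as the exponential of the stated value rounded up. *)

(* Defs.v *)
From HB Require Import structures.
From mathcomp Require Import all_boot all_order all_algebra.
From mathcomp Require Import all_classical all_reals.
From mathcomp Require Import exp sequences normedtype topology.
From mathcomp Require Import complex.
Set Implicit Arguments. Unset Strict Implicit. Unset Printing Implicit Defensive.
Import Order.TTheory GRing.Theory Num.Theory.
Local Open Scope classical_set_scope.
Local Open Scope ring_scope.
Local Open Scope complex_scope.

Section QuantumDefs.
Variable R : realType.
Local Notation C := (R[i]).

Definition adjmx m n (A : 'M[C]_(m, n)) : 'M[C]_(n, m) := (map_mx conjc A)^T.

(* positive semidefinite: <v, A v> >= 0 for every vector v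
   (in the partial order of C this means real and nonnegative;
    this forces A to be Hermitian) *)
Definition psd d (A : 'M[C]_d) : Prop :=
  forall v : 'cV[C]_d, 0 <= (adjmx v *m A *m v) ord0 ord0.

Definition density d (A : 'M[C]_d) : Prop := psd A /\ \tr A = 1.

(* supp(A) (column space / range) included in supp(B) *)
Definition supp_sub d (A B : 'M[C]_d) : Prop := (A^T <= B^T)%MS.

Definition spec d (A : 'M[C]_d) : set C := [set z | root (char_poly A) z].

Definition interp_poly (f : C -> C) (S : set C) : {poly C} :=
  \big[+%R/0]_(l \in S)
     (f l *: \big[*%R/1]_(m \in S `\ l) ((l - m)^-1 *: ('X - m%:P))).

Definition mpow d (A : 'M[C]_d) (i : nat) : 'M[C]_d := iter i (mulmx A) 1%:M.
Definition peval_mx d (p : {poly C}) (A : 'M[C]_d) : 'M[C]_d :=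
  \sum_(i < size p) p`_i *: mpow A i.

(* functional calculus for Hermitian (diagonalizable) matrices:
   f(A) = sum over eigenvalues l of f(l) * (spectral projector on l) *)
Definition mfun d (f : C -> C) (A : 'M[C]_d) : 'M[C]_d :=
  peval_mx (interp_poly f (spec A)) A.

(* matrix (natural) logarithm; on the kernel it is set to 0 (ln 0 = 0),
   i.e. log is taken on the support, the standard convention *)
Definition mlog d (A : 'M[C]_d) : 'M[C]_d :=
  mfun (fun z => (ln (complex.Re z))%:C) A.

Definition relent d (rho sigma : 'M[C]_d) : R :=
  complex.Re (\tr (rho *m (mlog rho - mlog sigma))).

(* n-fold tensor product A_0 (x) ... (x) A_{n-1} of d x d matrices, on the
   space with computational basis indexed by {ffun 'I_n -> 'I_d}
   (Kronecker product up to a fixed reordering of the basis) *)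
Definition tdim (n d : nat) : nat := #|{ffun 'I_n -> 'I_d}|.
Definition tensor n d (A : 'I_n -> 'M[C]_d) : 'M[C]_(tdim n d) :=
  \matrix_(i, j) \prod_(k < n)
     A k ((enum_val i : {ffun 'I_n -> 'I_d}) k) ((enum_val j : {ffun 'I_n -> 'I_d}) k).

Definition povm D M (L : 'I_M -> 'M[C]_D) : Prop :=
  (forall m, psd (L m)) /\ \sum_(m < M) L m = 1%:M.

Definition distr_nz N (p : 'I_N.+1 -> R) : Prop :=
  p ord0 = 0 /\ (forall x, 0 <= p x) /\ \sum_(x < N.+1) p x = 1.

Definition mixture N d (p : 'I_N.+1 -> R) (A : 'I_N.+1 -> 'M[C]_d) : 'M[C]_d :=
  \sum_(x < N.+1) (p x)%:C *: A x.

Definition not_mixture N d (rho : 'I_N.+1 -> 'M[C]_d) : Prop :=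
  ~ exists pi : 'I_N.+1 -> R, distr_nz pi /\ rho ord0 = mixture pi rho.

Definition rho_alpha N d (p : 'I_N.+1 -> R) (rho : 'I_N.+1 -> 'M[C]_d) (a : R)
  : 'M[C]_d := (1 - a)%:C *: rho ord0 + a%:C *: mixture p rho.

Definition err_B n N dB M K (sigma : 'I_N.+1 -> 'M[C]_dB)
  (cw : 'I_M -> 'I_K -> 'I_n -> 'I_N.+1)
  (L : 'I_K -> 'I_M -> 'M[C]_(tdim n dB)) (k : 'I_K) : R :=
  M%:R^-1 * \sum_(m < M)
    (1 - complex.Re (\tr (L k m *m tensor (fun t => sigma (cw m k t))))).

Definition willie_avg n N dW M K (rho : 'I_N.+1 -> 'M[C]_dW)
  (cw : 'I_M -> 'I_K -> 'I_n -> 'I_N.+1) : 'M[C]_(tdim n dW) :=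
  (M * K)%:R^-1%:C *: \sum_(m < M) \sum_(k < K) tensor (fun t => rho (cw m k t)).

End QuantumDefs.

(* Main.v *)
(* Random coding over i.i.d. words in which each letter is non-innocent with
   probability alpha.

   Reliability: to a word one attaches the test Q P Q built from spectral
   projections of its own output state and of the innocent state, whose error
   probabilities are controlled by scalar Chernoff bounds with exponent of order
   n alpha; applying the tests of all codewords sequentially gives the POVM.

   Resolvability: after truncating the output states of Willie, the squared
   chi-square type distance between the empirical mean over the MK codewords and
   the true mean is the variance of an i.i.d. average, hence at most the second
   moment divided by MK, and Cauchy-Schwarz turns it into a trace-norm bound.
   Trace norms enter in the dual form, by testing against self-adjoint
   contractions.

   Divergence: exponentially small trace distance gives exponentially small
   difference of relative entropies to the innocent state by Klein's inequality,
   and D(rho_alpha || rho_0) is at most a chi-square distance of order alpha^2.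
   Since rho_0 is not a mixture of the other states, the divergence on Willie's
   side is positive, which makes the resolvability exponent positive. *)
Require Import Defs.
From HB Require Import structures.
From mathcomp Require Import all_boot all_order all_algebra.
From mathcomp Require Import finmap all_classical all_reals.
From mathcomp Require Import exp sequences normedtype topology.
From mathcomp Require Import complex.
From mathcomp Require Import ring lra spectral sesquilinear.
Import Order.TTheory GRing.Theory Num.Theory numFieldNormedType.Exports.
Local Open Scope classical_set_scope.
Local Open Scope ring_scope.
Set Implicit Arguments. Unset Strict Implicit. Unset Printing Implicit Defensive.

(** * Complex matrices and spectral form *)

Local Notation "A ^†" := (adjmx A) (at level 8, format "A ^†").
Local Notation "x %:C" := (real_complex _ x) (format "x %:C").

(** Outputs of different letters need not commute, so there is no joint likelihood ratio to
    threshold. The two halves of the relative entropy are tested separately: one in the eigenbasis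
    of the word itself, one in that of the innocent state. Each becomes a sum of independent real
    variables. Innocent positions contribute log-weight 0; otherwise they would add fluctuations of
    order sqrt n, above the available scale n alpha = gamma sqrt n.

    A wrong codeword meets the tensor power of the mean state, which need not commute with either
    test. It is replaced by a majorant costing 1 + c alpha per non-innocent position, on average at
    most exp(c n alpha^2) = exp(c gamma^2), a bounded factor.

    Cauchy-Schwarz is kept as AM-GM with a free parameter [eta], so that the bounds stay linear in
    the random quantities and can be averaged directly.

    Continuity of relative entropy loses a factor linear in n, since the log-dimension and the
    logarithms of the innocent eigenvalues grow like n. The growth of gamma sqrt n beyond log n
    absorbs it. *)

Section MatrixBasics.
Context {R : realType}.
Local Notation C := (R[i]).

Lemma addmxE m n (A B : 'M[C]_(m, n)) i j : (A + B) i j = A i j + B i j.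
Proof. by rewrite mxE. Qed.

Lemma oppmxE m n (A : 'M[C]_(m, n)) i j : (- A) i j = - A i j.
Proof. by rewrite mxE. Qed.

Lemma scalemxE m n a (A : 'M[C]_(m, n)) i j : (a *: A) i j = a * A i j.
Proof. by rewrite mxE. Qed.

Lemma rowCE n (f : 'I_n -> R) i : (\row_j (f j)%:C : 'rV[C]_n) 0 i = (f i)%:C.
Proof. by rewrite mxE. Qed.

Lemma diag_mulE m n (d : 'rV[C]_m) (A : 'M[C]_(m, n)) i j :
  (diag_mx d *m A) i j = d 0 i * A i j.
Proof. by rewrite mul_diag_mx mxE. Qed.

Definition trR n (A : 'M[C]_n) : R := complex.Re (\tr A).

Lemma ReD (z w : C) : complex.Re (z + w) = complex.Re z + complex.Re w.
Proof. by case: z => a b; case: w. Qed.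

Lemma ReN (z : C) : complex.Re (- z) = - complex.Re z.
Proof. by case: z. Qed.

Lemma Re_sum I (r : seq I) (P : pred I) (F : I -> C) :
  complex.Re (\sum_(i <- r | P i) F i) = \sum_(i <- r | P i) complex.Re (F i).
Proof. by apply: (big_morph _ ReD). Qed.

Lemma ReZ (a : R) (z : C) : complex.Re (a%:C * z) = a * complex.Re z.
Proof. by case: z => x y /=; rewrite mul0r subr0. Qed.

Lemma adjmxE m n (A : 'M[C]_(m, n)) i j : A^† i j = conjc (A j i).
Proof. by rewrite !mxE. Qed.

Lemma adjmxK m n (A : 'M[C]_(m, n)) : (A^†)^† = A.
Proof. by apply/matrixP => i j; rewrite !adjmxE conjcK. Qed.

Lemma adjmxD m n (A B : 'M[C]_(m, n)) : (A + B)^† = A^† + B^†.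
Proof. by apply/matrixP => i j; rewrite !mxE rmorphD. Qed.

Lemma adjmxN m n (A : 'M[C]_(m, n)) : (- A)^† = - A^†.
Proof. by apply/matrixP => i j; rewrite !mxE rmorphN. Qed.

Lemma adjmxB m n (A B : 'M[C]_(m, n)) : (A - B)^† = A^† - B^†.
Proof. by rewrite adjmxD adjmxN. Qed.

Lemma adjmxZ m n (a : C) (A : 'M[C]_(m, n)) : (a *: A)^† = conjc a *: A^†.
Proof. by apply/matrixP => i j; rewrite !mxE rmorphM. Qed.

Lemma adjmxZr m n (a : R) (A : 'M[C]_(m, n)) : (a%:C *: A)^† = a%:C *: A^†.
Proof. by rewrite adjmxZ conjc_real. Qed.

Lemma adjmx0 m n : (0 : 'M[C]_(m, n))^† = 0.
Proof. by apply/matrixP => i j; rewrite !mxE conjc0. Qed.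

Lemma adjmx_sum m n I (r : seq I) (P : pred I) (F : I -> 'M[C]_(m, n)) :
  (\sum_(i <- r | P i) F i)^† = \sum_(i <- r | P i) (F i)^†.
Proof.
elim/big_rec2: _ => [|i A B _ <-]; first exact: adjmx0.
exact: adjmxD.
Qed.

Lemma adjmxM m n p (A : 'M[C]_(m, n)) (B : 'M[C]_(n, p)) :
  (A *m B)^† = B^† *m A^†.
Proof. by rewrite /adjmx map_mxM trmx_mul. Qed.

Lemma trRD n (A B : 'M[C]_n) : trR (A + B) = trR A + trR B.
Proof. by rewrite /trR mxtraceD ReD. Qed.

Lemma trRN n (A : 'M[C]_n) : trR (- A) = - trR A.
Proof. by rewrite /trR raddfN ReN. Qed.

Lemma trRB n (A B : 'M[C]_n) : trR (A - B) = trR A - trR B.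
Proof. by rewrite trRD trRN. Qed.

Lemma trRZ n (a : R) (A : 'M[C]_n) : trR (a%:C *: A) = a * trR A.
Proof. by rewrite /trR mxtraceZ ReZ. Qed.

Lemma trR0 n : trR (0 : 'M[C]_n) = 0.
Proof. by rewrite /trR mxtrace0. Qed.

Lemma trR_sum n I (r : seq I) (P : pred I) (F : I -> 'M[C]_n) :
  trR (\sum_(i <- r | P i) F i) = \sum_(i <- r | P i) trR (F i).
Proof.
elim/big_rec2: _ => [|i A B _ <-]; first exact: trR0.
exact: trRD.
Qed.

Lemma trRC m n (A : 'M[C]_(m, n)) (B : 'M[C]_(n, m)) :
  trR (A *m B) = trR (B *m A).
Proof. by rewrite /trR mxtrace_mulC. Qed.

Lemma trR_adj n (A : 'M[C]_n) : trR A^† = trR A.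
Proof.
rewrite /trR /mxtrace 2!Re_sum.
by apply: eq_bigr => i _; rewrite adjmxE; case: (A i i).
Qed.

Lemma psdD n (A B : 'M[C]_n) : psd A -> psd B -> psd (A + B).
Proof. by move=> hA hB v; rewrite mulmxDr mulmxDl mxE addr_ge0. Qed.

Lemma psd0 n : psd (0 : 'M[C]_n).
Proof. by move=> v; rewrite mulmx0 mul0mx mxE. Qed.

Lemma psd_sum n I (r : seq I) (P : pred I) (F : I -> 'M[C]_n) :
  (forall i, P i -> psd (F i)) -> psd (\sum_(i <- r | P i) F i).
Proof. by move=> h; elim/big_ind: _; [exact: psd0 | exact: psdD | exact: h]. Qed.

Lemma psdZ n (a : R) (A : 'M[C]_n) : 0 <= a -> psd A -> psd (a%:C *: A).
Proof.
by move=> a0 hA v; rewrite -scalemxAr -scalemxAl mxE mulr_ge0 // ler0c.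
Qed.

Lemma psd_conj m n (A : 'M[C]_n) (X : 'M[C]_(n, m)) :
  psd A -> psd (X^† *m A *m X).
Proof. by move=> hA v; have := hA (X *m v); rewrite adjmxM !mulmxA. Qed.

Lemma psd1 n : psd (1%:M : 'M[C]_n).
Proof.
move=> v; rewrite mulmx1 mxE sumr_ge0 // => i _.
by rewrite adjmxE mulrC mulcJ_ge0.
Qed.

Lemma psd_adjM m n (X : 'M[C]_(m, n)) : psd (X^† *m X).
Proof. by have := psd_conj X (@psd1 m); rewrite mulmx1. Qed.

Lemma psd_conjl m n (A : 'M[C]_n) (X : 'M[C]_(m, n)) :
  psd A -> psd (X *m A *m X^†).
Proof. by move=> /(psd_conj X^†); rewrite adjmxK. Qed.

Lemma psd_diag n (A : 'M[C]_n) i : psd A -> 0 <= A i i.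
Proof.
move=> /(_ (delta_mx i ord0)); rewrite -mulmxA -colE mxE (bigD1 i) //=.
rewrite adjmxE !mxE !eqxx conjc1 mul1r big1 ?addr0 // => j ji.
by rewrite adjmxE !mxE (negbTE ji) conjc0 mul0r.
Qed.

Lemma psd_diagR n (A : 'M[C]_n) i : psd A -> 0 <= complex.Re (A i i).
Proof. by move=> /psd_diag => /(_ i); rewrite lecE /= => /andP[]. Qed.

Lemma psd_trR n (A : 'M[C]_n) : psd A -> 0 <= trR A.
Proof.
move=> hA; rewrite /trR /mxtrace Re_sum sumr_ge0 // => i _.
exact: psd_diagR.
Qed.

Lemma add_conj_eq0 (z w : C) :
  z + w = 0 -> 'i%C * z + conjc 'i%C * w = 0 -> z = 0.
Proof.
move=> /eqP; rewrite addrC addr_eq0 => /eqP ->.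
have -> : conjc ('i%C : C) = - 'i%C by apply/eqP; rewrite eq_complex /= oppr0 !eqxx.
rewrite mulrNN -mulr2n => /eqP; rewrite mulrn_eq0 /= mulf_eq0 => /orP[|/eqP //].
by rewrite eq_complex /= oner_eq0 andbF.
Qed.

Lemma add_mid_eq0 (a b c d : C) : a = 0 -> d = 0 -> a + b + (c + d) = 0 -> b + c = 0.
Proof. by move=> -> ->; rewrite add0r addr0. Qed.

(** Polarization: expanding the form at [u + v] and then replacing [v] by ['i *: v] gives two linear
    relations between the cross terms, which [add_conj_eq0] solves. *)
Lemma herm_form0 n (D : 'M[C]_n) :
  (forall v : 'cV_n, (v^† *m D *m v) ord0 ord0 = 0) -> D = 0.
Proof.
move=> q.
have q2 (u v : 'cV_n) :
    (u^† *m D *m v) ord0 ord0 + (v^† *m D *m u) ord0 ord0 = 0.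
  have := q (u + v); rewrite adjmxD 2!mulmxDl 2!mulmxDr 3!addmxE.
  exact: add_mid_eq0 (q u) (q v).
have b (u v : 'cV_n) : (u^† *m D *m v) ord0 ord0 = 0.
  have := q2 u ('i%C *: v); rewrite adjmxZ -!scalemxAl -scalemxAr !scalemxE.
  exact: add_conj_eq0 (q2 u v).
apply/matrixP => i j; have := b (delta_mx i ord0) (delta_mx j ord0).
rewrite -mulmxA -colE mxE (bigD1 i) //= adjmxE !mxE !eqxx conjc1 mul1r.
rewrite big1 ?addr0 // => k ki.
by rewrite adjmxE !mxE (negbTE ki) conjc0 mul0r.
Qed.

(** [psd] assumes no symmetry. A real quadratic form equals its conjugate, so the form of the
    difference of [A] and its adjoint vanishes identically. *)
Lemma psd_herm n (A : 'M[C]_n) : psd A -> A^† = A.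
Proof.
move=> hA; apply/eqP; rewrite -subr_eq0; apply/eqP; apply: herm_form0 => v.
rewrite mulmxBr mulmxBl addmxE oppmxE.
have -> : v^† *m A^† *m v = (v^† *m A *m v)^† by rewrite !adjmxM adjmxK mulmxA.
rewrite adjmxE; have := hA v; case: ((v^† *m A *m v) ord0 ord0) => x y.
by rewrite lecE /= => /andP[/eqP -> _]; rewrite oppr0 subrr.
Qed.

(* Spectral form of Hermitian matrices: [dg U f] has eigenvalue [f i] on column
   [i] of [U]. *)
Definition dg n (U : 'M[C]_n) (f : 'I_n -> R) : 'M[C]_n :=
  U *m diag_mx (\row_i (f i)%:C) *m U^†.

Definition unitary n (U : 'M[C]_n) := U^† *m U = 1%:M.

Lemma unitaryC n (U : 'M[C]_n) : unitary U -> U *m U^† = 1%:M.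
Proof. exact: mulmx1C. Qed.

Lemma eq_dg n (U : 'M[C]_n) f g : f =1 g -> dg U f = dg U g.
Proof. by move=> h; congr (_ *m diag_mx _ *m _); apply/rowP => i; rewrite !mxE h. Qed.

Lemma dgM n (U : 'M[C]_n) f g : unitary U ->
  dg U f *m dg U g = dg U (fun i => f i * g i).
Proof.
move=> hU; rewrite /dg -!mulmxA (mulmxA U^†) hU mul1mx (mulmxA (diag_mx _)).
rewrite mulmx_diag; congr (_ *m (diag_mx _ *m _)).
by apply/rowP => i; rewrite !mxE rmorphM.
Qed.

Lemma dgD n (U : 'M[C]_n) f g : dg U (fun i => f i + g i) = dg U f + dg U g.
Proof.
rewrite /dg -mulmxDl -mulmxDr -raddfD /=; congr (_ *m diag_mx _ *m _).
by apply/rowP => i; rewrite !mxE rmorphD.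
Qed.

Lemma dgZ n (U : 'M[C]_n) a f : dg U (fun i => a * f i) = a%:C *: dg U f.
Proof.
rewrite /dg scalemxAl scalemxAr -linearZ /=; congr (_ *m diag_mx _ *m _).
by apply/rowP => i; rewrite !mxE rmorphM.
Qed.

Lemma dgB n (U : 'M[C]_n) f g : dg U (fun i => f i - g i) = dg U f - dg U g.
Proof.
rewrite -[in RHS](scaleN1r (dg U g)) -[-1](rmorphN1 (@real_complex_def R (Phant R))).
by rewrite -dgZ -dgD; apply: eq_dg => i; rewrite mulN1r.
Qed.

Lemma dg_const n (U : 'M[C]_n) a : unitary U -> dg U (fun=> a) = (a%:C)%:M.
Proof.
move=> hU; rewrite /dg.
have -> : diag_mx (\row__ a%:C) = (a%:C)%:M :> 'M[C]_n.
  by rewrite -diag_const_mx; congr diag_mx; apply/rowP => i; rewrite !mxE.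
by rewrite mul_mx_scalar -scalemxAl unitaryC // scalemx1.
Qed.

Lemma dg1 n (U : 'M[C]_n) : unitary U -> dg U (fun=> 1) = 1%:M.
Proof. by move=> hU; rewrite dg_const // rmorph1. Qed.

Lemma dg_adj n (U : 'M[C]_n) f : (dg U f)^† = dg U f.
Proof.
rewrite /dg !adjmxM adjmxK mulmxA; congr (_ *m _ *m _).
apply/matrixP => i j; rewrite !mxE.
by case: eqVneq => [->|]; rewrite ?eqxx ?mulr0n ?conjc0 ?mulr1n ?conjc_real // eq_sym => /negbTE ->;
  rewrite mulr0n conjc0.
Qed.

Lemma psd_dg n (U : 'M[C]_n) f : (forall i, 0 <= f i) -> psd (dg U f).
Proof.
move=> hf; apply: psd_conjl => v; rewrite mul_mx_diag mxE sumr_ge0 // => i _.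
by rewrite !mxE mulrAC -[conjc _ * _]mulrC mulr_ge0 ?mulcJ_ge0 // ler0c.
Qed.

Lemma trR_dgM n (U : 'M[C]_n) f A :
  trR (dg U f *m A) = \sum_i f i * complex.Re ((U^† *m A *m U) i i).
Proof.
rewrite /dg -mulmxA -mulmxA trRC -mulmxA /trR /mxtrace Re_sum.
apply: eq_bigr => i _; rewrite diag_mulE.
by rewrite rowCE ReZ.
Qed.

Lemma trR_dg n (U : 'M[C]_n) f : unitary U -> trR (dg U f) = \sum_i f i.
Proof.
move=> hU; rewrite -[dg U f]mulmx1 trR_dgM mulmx1 hU.
by apply: eq_bigr => i _; rewrite mxE eqxx mulr1.
Qed.

Lemma psd_spectral n (A : 'M[C]_n) : psd A ->
  exists U f, [/\ unitary U, forall i, 0 <= f i & A = dg U f].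
Proof.
move=> hA.
have hn : A \is normalmx.
  have e : map_mx Num.conj A^T = A.
    by rewrite -[RHS](psd_herm hA) /adjmx map_trmx.
  by apply/normalmxP; rewrite e.
have /orthomx_spectralP e := hn.
have hP := spectral_unitarymx A.
rewrite invmx_unitary // in e.
set P := spectralmx A in e hP; set d := spectral_diag A in e.
have eP : map_mx Num.conj P^T = P^† by rewrite -map_trmx.
rewrite eP in e.
have PU : P *m P^† = 1%:M by move/unitarymxP: hP; rewrite eP.
have dE : diag_mx d = P *m A *m P^†.
  by rewrite e !mulmxA PU mul1mx -mulmxA PU mulmx1.
(* The spectral theorem for normal matrices gives complex eigenvalues; being diagonal entries of a
   psd matrix, they are nonnegative reals. *)
have hd i : 0 <= d 0 i.
  have := @psd_diag n (P *m A *m P^†) i (psd_conjl P hA).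
  by rewrite -dE mxE eqxx mulr1n.
exists P^†, (fun i => complex.Re (d 0 i)); split.
- by rewrite /unitary adjmxK.
- by move=> i; have := hd i; rewrite lecE /= => /andP[].
- rewrite /dg adjmxK [LHS]e; congr (_ *m diag_mx _ *m _).
  apply/rowP => i; rewrite mxE; have := hd i.
  by case: (d 0 i) => x y; rewrite lecE /= => /andP[/eqP -> _].
Qed.

Lemma trR_psdM n (A B : 'M[C]_n) : psd A -> psd B -> 0 <= trR (A *m B).
Proof.
move=> /psd_spectral[U [f [hU hf ->]]] hB; rewrite trR_dgM sumr_ge0 // => i _.
by rewrite mulr_ge0 // psd_diagR //; exact: psd_conj.
Qed.

Lemma le_trR_psdMl n (A B D : 'M[C]_n) : psd D -> psd (B - A) ->
  trR (A *m D) <= trR (B *m D).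
Proof. by move=> hD hAB; rewrite -subr_ge0 -trRB -mulmxBl trR_psdM. Qed.

Lemma le_trR_psdMr n (A B D : 'M[C]_n) : psd D -> psd (B - A) ->
  trR (D *m A) <= trR (D *m B).
Proof. by move=> hD hAB; rewrite ![trR (D *m _)]trRC le_trR_psdMl. Qed.

End MatrixBasics.

(** * Functional calculus and overlaps of eigenbases *)

Section FunctionalCalculus.
Context {R : realType}.
Local Notation C := (R[i]).

Lemma interp_polyE (f : C -> C) (S : set C) x : finite_set S -> S x ->
  (interp_poly f S).[x] = f x.
Proof.
move=> fS Sx; rewrite /interp_poly fsbig_finite //= horner_sum.
have fSl l : finite_set (S `\ l) by apply: sub_finite_set fS => y [].
have hl l : (\big[*%R/1]_(m \in S `\ l) ((l - m)^-1 *: ('X - m%:P))).[x] =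
    (l == x)%:R.
  rewrite fsbig_finite //= horner_prod; case: eqVneq => [->|lx].
    rewrite big_seq big1 // => m.
    rewrite in_fset_set // inE /= => -[_ /eqP mx].
    by rewrite hornerZ hornerXsubC mulVf // subr_eq0 eq_sym.
  have xl : x \in fset_set (S `\ l).
    by rewrite in_fset_set // inE /=; split => // /eqP; rewrite eq_sym (negbTE lx).
  rewrite (bigD1_seq x xl (fset_uniq _)) /=.
  by rewrite hornerZ hornerXsubC subrr mulr0 mul0r.
have xS : x \in fset_set S by rewrite in_fset_set // inE.
rewrite (bigD1_seq x xS (fset_uniq _)) /=.
rewrite hornerZ hl eqxx mulr1 big1 ?addr0 // => l lx.
by rewrite hornerZ hl (negbTE lx) mulr0.
Qed.

Lemma mpow_dg n (U : 'M[C]_n) f k : unitary U ->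
  mpow (dg U f) k = dg U (fun i => f i ^+ k).
Proof.
move=> hU; elim: k => [|k IH]; first by rewrite /mpow /= -(dg1 hU).
have -> : mpow (dg U f) k.+1 = dg U f *m mpow (dg U f) k by [].
rewrite IH (dgM _ _ hU).
by apply: eq_dg => i; rewrite exprS.
Qed.

Lemma peval_dg n (U : 'M[C]_n) f (g : 'I_n -> R) p : unitary U ->
  (forall i, p.[(f i)%:C] = (g i)%:C) -> peval_mx p (dg U f) = dg U g.
Proof.
move=> hU hp; rewrite /peval_mx.
have -> : dg U g = U *m diag_mx (\row_i p.[(f i)%:C]) *m U^†.
  by congr (_ *m diag_mx _ *m _); apply/rowP => i; rewrite !mxE.
have -> : \row_i p.[(f i)%:C] =
   \sum_(k < size p) p`_k *: (\row_i (f i ^+ k)%:C) :> 'rV[C]_n.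
  apply/rowP => i; rewrite mxE summxE horner_coef.
  by apply: eq_bigr => k _; rewrite !mxE rmorphXn.
have dZ (a : C) (d : 'rV[C]_n) : diag_mx (a *: d) = a *: diag_mx d by rewrite linearZ.
rewrite raddf_sum mulmx_sumr mulmx_suml; apply: eq_bigr => k _.
by rewrite mpow_dg // /dg scalemxAl scalemxAr -dZ.
Qed.

Lemma dg_mulU n (U : 'M[C]_n) f : unitary U ->
  dg U f *m U = U *m diag_mx (\row_i (f i)%:C).
Proof. by move=> hU; rewrite /dg -mulmxA hU mulmx1. Qed.

Lemma spec_dg n (U : 'M[C]_n) f : unitary U ->
  spec (dg U f) = [set (f i)%:C | i in [set: 'I_n]].
Proof.
move=> hU; apply/seteqP; split => z; rewrite /spec /= -eigenvalue_root_char.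
  move=> /eigenvalueP[v ev v0].
  have : v *m U != 0.
    by apply: contra v0 => /eqP h; rewrite -(mulmx1 v) -(unitaryC hU) mulmxA h mul0mx.
  have : v *m U *m diag_mx (\row_i (f i)%:C) = z *: (v *m U).
    by rewrite -mulmxA -dg_mulU // mulmxA ev scalemxAl.
  move: (v *m U) => w ew /rV0Pn[i wi]; exists i => //.
  move/rowP: ew => /(_ i); rewrite mul_mx_diag !mxE mulrC => /mulIf; exact.
move=> [i _ <-]; apply/eigenvalueP; exists (row i U^†).
  rewrite -row_mul /dg !mulmxA hU mul1mx row_mul row_diag_mx !mxE.
  by rewrite -scalemxAl -rowE.
apply/eqP => h; have := congr1 (fun M : 'rV_n => (M *m U) 0 i) h.
rewrite -row_mul hU mul0mx !mxE eqxx => /eqP; by rewrite oner_eq0.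
Qed.

(** [mlog] interpolates on the set of eigenvalues, which all spectral forms of a matrix share, so
    any diagonalization may be used to compute it. *)
Lemma mlog_dg n (U : 'M[C]_n) f : unitary U ->
  mlog (dg U f) = dg U (fun i => ln (f i)).
Proof.
move=> hU; apply: peval_dg => // i; rewrite interp_polyE //.
  by rewrite spec_dg //; exact: finite_image.
by rewrite spec_dg //; exists i.
Qed.

(** Squared modulus of the inner product of column [i] of [U] with column [j] of [V]. For unitary
    [U] and [V] this is a doubly stochastic matrix, which turns traces of two noncommuting spectral
    forms into classical double sums. *)
Definition ov n (U V : 'M[C]_n) (i j : 'I_n) : R :=
  complex.Re ((U^† *m V) i j) ^+ 2 + complex.Im ((U^† *m V) i j) ^+ 2.

Lemma ov_ge0 n (U V : 'M[C]_n) i j : 0 <= ov U V i j.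
Proof. by rewrite addr_ge0 // sqr_ge0. Qed.

Lemma diag_dg n (U V : 'M[C]_n) g i :
  complex.Re ((U^† *m dg V g *m U) i i) = \sum_j g j * ov U V i j.
Proof.
have -> : U^† *m dg V g *m U =
    U^† *m V *m diag_mx (\row_i (g i)%:C) *m (U^† *m V)^†.
  by rewrite /dg adjmxM adjmxK !mulmxA.
rewrite mxE Re_sum; apply: eq_bigr => j _; rewrite mul_mx_diag mxE rowCE adjmxE.
rewrite /ov; case: ((U^† *m V) i j) => x y /=; ring.
Qed.

Lemma trR_dg_dg n (U V : 'M[C]_n) f g :
  trR (dg U f *m dg V g) = \sum_i \sum_j f i * g j * ov U V i j.
Proof.
rewrite trR_dgM; apply: eq_bigr => i _; rewrite diag_dg mulr_sumr.
by apply: eq_bigr => j _; rewrite mulrA.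
Qed.

Lemma ov_sumr n (U V : 'M[C]_n) i : unitary U -> unitary V ->
  \sum_j ov U V i j = 1.
Proof.
move=> hU hV; have := diag_dg U V (fun=> 1) i.
rewrite dg1 // mulmx1 hU mxE eqxx /= => ->.
by apply: eq_bigr => j _; rewrite mul1r.
Qed.

Lemma ovC n (U V : 'M[C]_n) i j : ov U V i j = ov V U j i.
Proof.
rewrite /ov; have -> : (V^† *m U) j i = conjc ((U^† *m V) i j).
  by rewrite -adjmxE adjmxM adjmxK.
by case: ((U^† *m V) i j) => x y /=; rewrite sqrrN.
Qed.

Lemma ov_suml n (U V : 'M[C]_n) j : unitary U -> unitary V ->
  \sum_i ov U V i j = 1.
Proof.
by move=> hU hV; rewrite -(ov_sumr j hV hU); apply: eq_bigr => i _; exact: ovC.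
Qed.

Lemma relentE n (rho sigma : 'M[C]_n) :
  relent rho sigma = trR (rho *m mlog rho) - trR (rho *m mlog sigma).
Proof. by rewrite /relent -/(trR _) mulmxBr trRB. Qed.

(* Both Klein-type bounds and the upper chi-square bound are sums over the
   overlaps of a scalar inequality in a pair of eigenvalues. *)
Lemma relent_ov n (U V : 'M[C]_n) f g : unitary U -> unitary V ->
  relent (dg U f) (dg V g) =
  \sum_i \sum_j (f i * ln (f i) - f i * ln (g j)) * ov U V i j.
Proof.
move=> hU hV; rewrite relentE !mlog_dg // dgM // trR_dg // trR_dg_dg -sumrB.
apply: eq_bigr => i _; under [RHS]eq_bigr do rewrite mulrBl.
by rewrite sumrB -mulr_sumr ov_sumr // mulr1.
Qed.

Lemma trR_sqrB n (A B : 'M[C]_n) : trR ((A - B) *m (A - B)) =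
  trR (A *m A) - 2%:R * trR (A *m B) + trR (B *m B).
Proof.
rewrite mulmxBl (mulmxBr A) (mulmxBr B) 3!trRB (trRC B A); ring.
Qed.

Lemma trR_sqrB_ov n (U V : 'M[C]_n) f g : unitary U -> unitary V ->
  trR ((dg U f - dg V g) *m (dg U f - dg V g)) =
  \sum_i \sum_j (f i - g j) ^+ 2 * ov U V i j.
Proof.
move=> hU hV; rewrite trR_sqrB (trR_dg_dg U V) (dgM _ _ hU) (dgM _ _ hV).
rewrite (trR_dg _ hU) (trR_dg _ hV).
have -> : \sum_i f i * f i = \sum_i \sum_j f i * f i * ov U V i j.
  by apply: eq_bigr => i _; rewrite -mulr_sumr ov_sumr // mulr1.
have -> : \sum_i g i * g i = \sum_i \sum_j g j * g j * ov U V i j.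
  by rewrite exchange_big; apply: eq_bigr => j _; rewrite -mulr_sumr ov_suml // mulr1.
rewrite mulr_natl -sumrMnl -sumrB -big_split; apply: eq_bigr => i _ /=.
rewrite -sumrMnl -sumrB -big_split; apply: eq_bigr => j _ /=.
ring.
Qed.

Lemma ge0_sum_ov n (U V : 'M[C]_n) f g : unitary U -> unitary V ->
  (forall i j, ov U V i j != 0 -> 0 <= f i j - g i j) ->
  \sum_i \sum_j g i j * ov U V i j <= \sum_i \sum_j f i j * ov U V i j.
Proof.
move=> hU hV h; apply: ler_sum => i _; apply: ler_sum => j _.
have [->|o0] := eqVneq (ov U V i j) 0; first by rewrite !mulr0.
by rewrite ler_wpM2r ?ov_ge0 // -subr_ge0 h.
Qed.

Lemma sum_ov_trace n (U V : 'M[C]_n) f g : unitary U -> unitary V ->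
  \sum_i \sum_j (f i - g j) * ov U V i j = \sum_i f i - \sum_j g j.
Proof.
move=> hU hV.
have -> : \sum_i f i = \sum_i \sum_j f i * ov U V i j.
  by apply: eq_bigr => i _; rewrite -mulr_sumr ov_sumr // mulr1.
have -> : \sum_i g i = \sum_i \sum_j g j * ov U V i j.
  by rewrite exchange_big; apply: eq_bigr => j _; rewrite -mulr_sumr ov_suml // mulr1.
rewrite -sumrB; apply: eq_bigr => i _; rewrite -sumrB; apply: eq_bigr => j _.
by rewrite mulrBl.
Qed.

End FunctionalCalculus.

(** * Tensor powers *)

Section Tensor.
Context {R : realType}.
Local Notation C := (R[i]).

Definition word n d (i : 'I_(tdim n d)) : {ffun 'I_n -> 'I_d} := enum_val i.

Lemma big_word n d (V : zmodType) (F : {ffun 'I_n -> 'I_d} -> V) :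
  \sum_(i < tdim n d) F (word i) = \sum_a F a.
Proof. by rewrite [RHS](reindex _ (onW_bij _ (@enum_val_bij {ffun 'I_n -> 'I_d}))). Qed.

Lemma sum_word_prod n d (f : 'I_n -> 'I_d -> R) :
  \sum_(i < tdim n d) \prod_t f t (word i t) = \prod_t \sum_a f t a.
Proof.
by rewrite (big_word (fun a : {ffun 'I_n -> 'I_d} => \prod_t f t (a t))) bigA_distr_bigA.
Qed.

Lemma tensorE n d (A : 'I_n -> 'M[C]_d) i j :
  tensor A i j = \prod_(k < n) A k (word i k) (word j k).
Proof. by rewrite mxE. Qed.

Lemma eq_tensor n d (A B : 'I_n -> 'M[C]_d) : A =1 B -> tensor A = tensor B.
Proof.
by move=> h; apply/matrixP => i j; rewrite !tensorE; apply: eq_bigr => k _; rewrite h.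
Qed.

Lemma tensorM n d (A B : 'I_n -> 'M[C]_d) :
  tensor A *m tensor B = tensor (fun k => A k *m B k).
Proof.
apply/matrixP => i j; rewrite mxE tensorE.
under eq_bigr do rewrite !tensorE -big_split /=.
under [RHS]eq_bigr do rewrite mxE.
rewrite (big_word (fun a => \prod_(k < n) (A k (word i k) (a k) * B k (a k) (word j k)))).
by rewrite bigA_distr_bigA.
Qed.

Lemma tr_tensor n d (A : 'I_n -> 'M[C]_d) :
  \tr (tensor A) = \prod_(k < n) \tr (A k).
Proof.
rewrite /mxtrace; under eq_bigr do rewrite tensorE.
by rewrite (big_word (fun a => \prod_(k < n) A k (a k) (a k))) bigA_distr_bigA.
Qed.

Lemma tensor_adj n d (A : 'I_n -> 'M[C]_d) :
  (tensor A)^† = tensor (fun k => (A k)^†).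
Proof.
apply/matrixP => i j; rewrite adjmxE !tensorE rmorph_prod.
by apply: eq_bigr => k _; rewrite adjmxE.
Qed.

Lemma tensor_diag n d (f : 'I_n -> 'I_d -> R) :
  tensor (fun k => diag_mx (\row_a (f k a)%:C)) =
  diag_mx (\row_i (\prod_(k < n) f k (word i k))%:C) :> 'M[C]_(tdim n d).
Proof.
apply/matrixP => i j; rewrite tensorE 2!mxE.
have [<-|ij] := eqVneq i j.
  by rewrite mulr1n rmorph_prod; apply: eq_bigr => k _; rewrite !mxE eqxx.
rewrite mulr0n; have /eqP/ffunP/eqfunP/forallPn[k kE] : word i != word j.
  by apply: contra ij => /eqP/enum_val_inj ->.
by rewrite (bigD1 k) //= !mxE (negbTE kE) mulr0n mul0r.
Qed.

Lemma tensor_dg n d (U : 'I_n -> 'M[C]_d) (f : 'I_n -> 'I_d -> R) :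
  tensor (fun k => dg (U k) (f k)) =
  dg (tensor U) (fun i => \prod_(k < n) f k (word i k)).
Proof. by rewrite /dg tensor_adj -tensor_diag !tensorM. Qed.

Lemma tensor1 n d : tensor (fun=> 1%:M) = 1%:M :> 'M[C]_(tdim n d).
Proof.
have := @tensor_diag n d (fun _ _ => 1).
have e m (g : 'I_m -> R) : (forall i, g i = 1) ->
    diag_mx (\row_i (g i)%:C) = 1%:M :> 'M[C]_m.
  move=> hg; rewrite -[1%:M]diag_const_mx; congr diag_mx.
  by apply/rowP => i; rewrite !mxE hg.
rewrite (e _ (fun i => \prod_(k < n) 1)); last by move=> i; rewrite big1.
by move=> <-; apply: eq_tensor => k; rewrite (e _ (fun=> 1)).
Qed.

Lemma unitary_tensor n d (U : 'I_n -> 'M[C]_d) :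
  (forall k, unitary (U k)) -> unitary (tensor U).
Proof.
move=> hU; rewrite /unitary tensor_adj tensorM -[RHS]tensor1.
exact: eq_tensor.
Qed.

Lemma psd_tensor n d (A : 'I_n -> 'M[C]_d) :
  (forall k, psd (A k)) -> psd (tensor A).
Proof.
move=> hA; have h k : exists Uf : 'M[C]_d * ('I_d -> R),
    (forall i, 0 <= Uf.2 i) /\ A k = dg Uf.1 Uf.2.
  by have [U [f [_ h1 h2]]] := psd_spectral (hA k); exists (U, f).
have [F hF] := choice h.
rewrite (@eq_tensor _ _ A (fun k => dg (F k).1 (F k).2)); last first.
  by move=> k; have [_ {1}->] := hF k.
rewrite tensor_dg; apply: psd_dg => i; apply: prodr_ge0 => k _.
by have [h1 _] := hF k.
Qed.

Lemma tensor_add n d (A B : 'I_n -> 'M[C]_d) :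
  tensor (fun k => A k + B k) =
  \sum_(J : {set 'I_n}) tensor (fun k => if k \in J then A k else B k).
Proof.
apply/matrixP => i j; rewrite tensorE summxE.
under eq_bigr do rewrite mxE.
rewrite bigA_distr; apply: eq_bigr => J _; rewrite tensorE.
by apply: eq_bigr => k _; case: ifP.
Qed.

(** Expanding the tensor product of [A + (B - A)] over subsets of positions gives psd terms only,
    and the full subset is the tensor product of [A]. *)
Lemma tensor_le n d (A B : 'I_n -> 'M[C]_d) :
  (forall k, psd (A k)) -> (forall k, psd (B k - A k)) ->
  psd (tensor B - tensor A).
Proof.
move=> hA hB; rewrite (@eq_tensor _ _ B (fun k => A k + (B k - A k))); last first.
  by move=> k; rewrite addrC subrK.
rewrite tensor_add (bigD1 (finset.setTfor 'I_n)) //=.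
rewrite (@eq_tensor _ _ _ A); last by move=> k; rewrite finset.in_setT.
rewrite addrAC subrr add0r; apply: psd_sum => J _; apply: psd_tensor => k.
by case: ifP.
Qed.

Lemma tensorZ n d (a : 'I_n -> R) (A : 'I_n -> 'M[C]_d) :
  tensor (fun k => (a k)%:C *: A k) = (\prod_(k < n) a k)%:C *: tensor A.
Proof.
apply/matrixP => i j; rewrite scalemxE !tensorE rmorph_prod -big_split.
by apply: eq_bigr => k _; rewrite scalemxE.
Qed.

Lemma tensor_mean n d (X : finType) (p : X -> R) (A : X -> 'M[C]_d) :
  \sum_(x : {ffun 'I_n -> X}) (\prod_(t < n) p (x t))%:C *: tensor (fun t => A (x t)) =
  tensor (fun _ : 'I_n => \sum_x (p x)%:C *: A x).
Proof.
under eq_bigr do rewrite -tensorZ.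
apply/matrixP => i j; rewrite summxE tensorE.
under eq_bigr do rewrite tensorE.
under [RHS]eq_bigr do rewrite summxE.
by rewrite bigA_distr_bigA.
Qed.

Lemma tr_dg n (U : 'M[C]_n) f : unitary U -> \tr (dg U f) = (\sum_i f i)%:C.
Proof.
move=> hU; rewrite /dg mxtrace_mulC mulmxA hU mul1mx mxtrace_diag rmorph_sum.
by apply: eq_bigr => i _; rewrite mxE.
Qed.

Lemma trR_tensor n d (A : 'I_n -> 'M[C]_d) (r : 'I_n -> R) :
  (forall k, \tr (A k) = (r k)%:C) -> trR (tensor A) = \prod_(k < n) r k.
Proof.
move=> h; rewrite /trR tr_tensor.
by under eq_bigr do rewrite h; rewrite -rmorph_prod.
Qed.

Lemma tensor_density n d (A : 'I_n -> 'M[C]_d) :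
  (forall k, density (A k)) -> density (tensor A).
Proof.
move=> h; split; first by apply: psd_tensor => k; case: (h k).
by rewrite tr_tensor big1 // => k _; case: (h k).
Qed.

End Tensor.

(** * Sequential tests and truncation *)

(* Operator arguments are carried out over an abstract ring with involution, trace
   and positive cone, instantiated below by complex matrices; [sc] embeds the real
   scalars. *)
Record starAlg (R : realType) := StarAlg {
  sa_sort :> pzRingType;
  adj : sa_sort -> sa_sort;
  tr : sa_sort -> R;
  pos : sa_sort -> Prop;
  sc : R -> sa_sort;
  adjK : involutive adj;
  adjD : forall a b, adj (a + b) = adj a + adj b;
  adjM : forall a b, adj (a * b) = adj b * adj a;
  adj_sc : forall r, adj (sc r) = sc r;
  scC : forall r a, sc r * a = a * sc r;
  sc1 : sc 1 = 1;
  trD : forall a b, tr (a + b) = tr a + tr b;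
  trC : forall a b, tr (a * b) = tr (b * a);
  tr_sc : forall r a, tr (sc r * a) = r * tr a;
  tr_adj : forall a, tr (adj a) = tr a;
  pos1 : pos 1;
  posD : forall a b, pos a -> pos b -> pos (a + b);
  pos_conj : forall a x, pos a -> pos (adj x * a * x);
  pos_adj : forall a, pos a -> adj a = a;
  tr_posM : forall a b, pos a -> pos b -> 0 <= tr (a * b)
}.

Section StarAlgebra.
Context {R : realType} {A : starAlg R}.
Implicit Types (a b x y h q p t s : A).

Lemma adj1 : adj (1 : A) = 1.
Proof. exact: pos_adj (pos1 A). Qed.

Lemma adj0 : adj (0 : A) = 0.
Proof. by apply: (addIr (adj 0)); rewrite -adjD !addr0 add0r. Qed.

Lemma adjN a : adj (- a) = - adj a.
Proof. by apply: (addIr (adj a)); rewrite -adjD !addNr adj0. Qed.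

Lemma adjB a b : adj (a - b) = adj a - adj b.
Proof. by rewrite adjD adjN. Qed.

Lemma tr0 : tr (0 : A) = 0.
Proof. by apply: (addIr (tr (0 : A))); rewrite -trD !addr0 add0r. Qed.

Lemma trN a : tr (- a) = - tr a.
Proof. by apply: (addIr (tr a)); rewrite -trD !addNr tr0. Qed.

Lemma trB a b : tr (a - b) = tr a - tr b.
Proof. by rewrite trD trN. Qed.

Lemma tr_sum I (r : seq I) (P : pred I) (F : I -> A) :
  tr (\sum_(i <- r | P i) F i) = \sum_(i <- r | P i) tr (F i).
Proof. by apply: (big_morph _ (@trD _ A) tr0). Qed.

Lemma tr_scl r a b : tr (a * (sc A r * b)) = r * tr (a * b).
Proof. by rewrite mulrA -scC -mulrA tr_sc. Qed.

Lemma pos0 : pos (0 : A).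
Proof. by have := pos_conj 0 (pos1 A); rewrite mulr0. Qed.

Lemma pos_adjM x : pos (adj x * x).
Proof. by have := pos_conj x (pos1 A); rewrite mulr1. Qed.

Lemma tr_pos a : pos a -> 0 <= tr a.
Proof. by move=> ha; rewrite -[a]mulr1 tr_posM //; exact: pos1. Qed.

Lemma le_tr_posl a b s : pos s -> pos (b - a) -> tr (a * s) <= tr (b * s).
Proof. by move=> hs hab; rewrite -subr_ge0 -trB -mulrBl tr_posM. Qed.

(** A real semi-inner product for [t] and [s] in the cone. Taking [s] to be a state and [t] an
    effect expresses the probability of [t] after the operation [x]. *)
Definition form t s x y := tr (adj x * t * y * s).

Lemma form_ge0 t s x : pos t -> pos s -> 0 <= form t s x x.
Proof. by move=> ht hs; apply: tr_posM => //; exact: pos_conj. Qed.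

Lemma formC t s x y : pos t -> pos s -> form t s x y = form t s y x.
Proof.
move=> ht hs; rewrite /form -tr_adj !adjM adjK (pos_adj ht) (pos_adj hs).
by rewrite trC !mulrA.
Qed.

Lemma formB t s x y : pos t -> pos s ->
  form t s (x - y) (x - y) = form t s x x - 2 * form t s x y + form t s y y.
Proof.
move=> ht hs.
have -> : form t s (x - y) (x - y) =
    form t s x x - form t s x y - (form t s y x - form t s y y).
  by rewrite /form adjB !(mulrBl, mulrBr) !trB; ring.
by rewrite (formC y x ht hs); ring.
Qed.

Lemma form_scr t s x y r : form t s x (sc A r * y) = r * form t s x y.
Proof. by rewrite /form -(mulrA _ (_ * y)) -(mulrA (sc A r)) tr_scl !mulrA. Qed.

Lemma form_scl t s x y r : form t s (sc A r * x) y = r * form t s x y.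
Proof. by rewrite /form adjM adj_sc -scC -!mulrA tr_sc. Qed.

Lemma formBt t1 t2 s x y : form (t1 - t2) s x y = form t1 s x y - form t2 s x y.
Proof. by rewrite /form mulrBr !mulrBl trB. Qed.

Lemma form11 t s : form t s 1 1 = tr (t * s).
Proof. by rewrite /form adj1 mul1r mulr1. Qed.

Lemma form_AMGM t s x y (eta : R) : pos t -> pos s -> 0 < eta ->
  2 * form t s x y <= eta^-1 * form t s x x + eta * form t s y y.
Proof.
move=> ht hs e0; have := form_ge0 (x - sc A eta * y) ht hs.
rewrite formB // !form_scr form_scl.
set a := form _ _ x x; set b := form _ _ _ _; set c := form _ _ _ _ => h.
by rewrite -(ler_pM2l e0) mulrDr mulVKf ?gt_eqF //; lra.
Qed.

Lemma form_split t s x y : pos t -> pos s ->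
  form t s x x <= 2 * form t s y y + 2 * form t s (x - y) (x - y).
Proof.
(* The right side minus the left side is exactly the form at [x - 2 y]. *)
move=> ht hs; have := form_ge0 (x - sc A 2 * y) ht hs.
rewrite !formB // !form_scr form_scl.
set a := form _ _ x x; set b := form _ _ _ _; set c := form _ _ _ _ => h.
by lra.
Qed.

Definition test t := pos t /\ pos (1 - t).

Lemma test_compl t : test t -> test (1 - t).
Proof. by move=> [h1 h2]; split => //; rewrite opprB addrC subrK. Qed.

Lemma test1 : test 1.
Proof. by split; [exact: pos1 | rewrite subrr; exact: pos0]. Qed.

(** The algebra has no square roots; the identity t - t^2 = t (1 - t) t + (1 - t) t (1 - t) replaces
    them. *)
Lemma test_sqr t : test t -> pos (t - t * t).
Proof.
move=> [h1 h2].
have -> : t - t * t = adj t * (1 - t) * t + adj (1 - t) * t * (1 - t).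
  rewrite (pos_adj h1) (pos_adj h2) !(mulrBl, mulrBr) !(mulr1, mul1r).
  by rewrite [RHS]addrC subrK.
by apply: posD; apply: pos_conj.
Qed.

Fixpoint seq_kraus (t : nat -> A) (k : nat) : A :=
  if k is j.+1 then (1 - t j) * seq_kraus t j else 1.

(* Sequential decoding. Rejection acts by [1 - t] instead of its square root, so
   the effects sum to at most [1]. *)
Definition seq_effect (t : nat -> A) (m : nat) : A :=
  adj (seq_kraus t m) * t m * seq_kraus t m.

Lemma seq_kraus_step (t : nat -> A) k : test (t k) ->
  pos (adj (seq_kraus t k) * seq_kraus t k - seq_effect t k -
       adj (seq_kraus t k.+1) * seq_kraus t k.+1).
Proof.
move=> ht; have ht' := test_compl ht; have [h1 h2] := ht.
have := pos_conj (seq_kraus t k) (test_sqr ht').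
congr pos; rewrite /= adjM (pos_adj h2) !mulrA /seq_effect.
rewrite mulrBr mulrBl !mulrA; congr (_ - _).
by rewrite mulrBr mulr1 mulrBl.
Qed.

Lemma seq_effect_sum (t : nat -> A) k : (forall j, test (t j)) ->
  pos (1 - \sum_(j < k) seq_effect t j - adj (seq_kraus t k) * seq_kraus t k).
Proof.
move=> ht; elim: k => [|k IH].
  by rewrite big_ord0 subr0 /= adj1 mulr1 subrr; exact: pos0.
have := posD IH (seq_kraus_step (ht k)); congr pos.
rewrite big_ord_recr /= opprD !addrA; congr (_ - _).
by rewrite subrK.
Qed.

Lemma pos_seq_effect (t : nat -> A) m : (forall j, test (t j)) ->
  pos (seq_effect t m).
Proof. by move=> ht; apply: pos_conj; case: (ht m). Qed.

(* Gentle sequential measurement: with f_k = tr(S_k s) the decrements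
   f_k - f_(k+1) = tr(t_k S_k s) are split by AM-GM, and the terms
   tr(S_k^* t_k S_k s) telescope because (1 - t)^2 <= 1 - t. *)
Lemma seq_effect_error (t : nat -> A) s m (eta : R) :
  (forall j, test (t j)) -> pos s -> tr s = 1 -> 0 < eta ->
  1 - tr (seq_effect t m * s) <=
  2 * (eta^-1 * \sum_(k < m) tr (t k * s) + eta) + 2 * tr ((1 - t m) * s).
Proof.
move=> ht hs tr1 e0.
pose S := seq_kraus t.
pose f k := tr (S k * s); pose g k := tr (adj (S k) * S k * s).
pose u k := tr (seq_effect t k * s).
have f0 : f 0%N = 1 by rewrite /f /= mul1r.
have g0 : g 0%N = 1 by rewrite /g /= adj1 !mul1r.
have gstep k : u k <= g k - g k.+1.
  have := tr_posM (seq_kraus_step (ht k)) hs.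
  by rewrite !mulrBl !trB -/(g k) -/(u k) -/(g k.+1); lra.
have g_ge0 k : 0 <= g k by apply: tr_posM => //; exact: pos_adjM.
have g_le1 k : g k <= 1.
  elim: k => [|k IH]; first by rewrite g0.
  apply: le_trans IH; have := gstep k.
  have : 0 <= u k by apply: tr_posM => //; exact: pos_seq_effect.
  by lra.
have fstep k : 2 * (f k - f k.+1) <= eta^-1 * tr (t k * s) + eta * u k.
  have := @form_AMGM (t k) s 1 (S k) _ (proj1 (ht k)) hs e0.
  rewrite /form adj1 !mul1r mulr1.
  have -> // : tr (t k * S k * s) = f k - f k.+1.
  rewrite /f /= -trB -mulrBl; congr (tr (_ * _)).
  by rewrite /S /= mulrBl mul1r opprB addrC subrK.
have fm j : 2 * (1 - f j) <= eta^-1 * \sum_(k < j) tr (t k * s) + eta * (1 - g j).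
  elim: j => [|k IH]; first by rewrite f0 g0 big_ord0 !subrr !mulr0 addr0.
  have h1 := fstep k; have h2 := gstep k.
  have h3 : eta * u k <= eta * (g k - g k.+1) by rewrite ler_pM2l.
  rewrite big_ord_recr /= [_^-1 * _]mulrDr; lra.
have hg : eta * (1 - g m) <= eta by have := g_ge0 m; nra.
have um : u m = g m - form (1 - t m) s (S m) (S m).
  by rewrite formBt {1}/form mulr1 /u /seq_effect -/S /g /form; ring.
(* Success is [g m] minus the form of [1 - t m] at [S m]. Comparing [S m] with 1 costs twice
   [g m - 2 f m + 1], so the error is at most 4 (1 - f m) plus twice the miss probability, and [fm]
   bounds 2 (1 - f m). *)
have := @form_split (1 - t m) s (S m) 1 (proj2 (ht m)) hs.
have : form (1 - t m) s (S m - 1) (S m - 1) <= g m - 2 * f m + 1.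
  have := form_ge0 (S m - 1) (proj1 (ht m)) hs.
  have <- : form 1 s (S m - 1) (S m - 1) = g m - 2 * f m + 1.
    rewrite formB //; last exact: pos1.
    rewrite (formC (S m) 1 (pos1 A) hs) /form adj1 !mulr1 !mul1r tr1.
    by [].
  rewrite formBt; lra.
rewrite form11 -/(u m) um; have := g_le1 m; have := fm m; lra.
Qed.

Lemma seq_decoder M (t : 'I_M -> A) : (0 < M)%N -> (forall m, test (t m)) ->
  exists L : 'I_M -> A, [/\ forall m, pos (L m), \sum_m L m = 1 &
  forall (m : 'I_M) s eta, pos s -> tr s = 1 -> 0 < eta ->
    1 - tr (L m * s) <=
    2 * (eta^-1 * \sum_(k < M | k != m) tr (t k * s) + eta)
    + 2 * tr ((1 - t m) * s)].
Proof.
case: M t => // M t _ ht.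
pose t' (k : nat) := if insub k is Some i then t i else 1.
have t'E (i : 'I_M.+1) : t' i = t i by rewrite /t' valK.
have ht' k : test (t' k) by rewrite /t'; case: insubP => // *; exact: test1.
pose rest := 1 - \sum_(j < M.+1) seq_effect t' j.
have hrest : pos rest.
  have := posD (seq_effect_sum M.+1 ht') (pos_adjM (seq_kraus t' M.+1)).
  by rewrite subrK.
exists (fun m : 'I_M.+1 => seq_effect t' m + (if m == ord0 then rest else 0)); split.
- move=> m; apply: posD; first exact: pos_seq_effect.
  by case: ifP => _ //; exact: pos0.
- by rewrite big_split /= -big_mkcond big_pred1_eq /= addrC subrK.
move=> m s eta hs tr1 e0.
have tge0 k : 0 <= tr (t k * s) by apply: tr_posM => //; case: (ht k).
apply: (@le_trans _ _ (1 - tr (seq_effect t' m * s))).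
  rewrite lerD2l lerN2 mulrDl trD lerDl; apply: tr_posM => //.
  by case: ifP => _ //; exact: pos0.
apply: le_trans (seq_effect_error m ht' hs tr1 e0) _.
rewrite t'E lerD2r ler_pM2l // lerD2r ler_pM2l ?invr_gt0 //.
(* Only earlier messages interfere; enlarging the sum to all other messages makes the bound
   symmetric, as needed for averaging over the codebook. *)
have mM : (m <= M.+1)%N by apply: ltnW; exact: ltn_ord.
rewrite (big_ord_widen_cond _ xpredT (fun k => tr (t' k * s)) mM) /=.
rewrite [leLHS]big_mkcond [leRHS]big_mkcond; apply: ler_sum => k _ /=.
rewrite t'E; case: ifP => [km|_]; last by case: ifP.
by rewrite ifT // -val_eqE neq_ltn km.
Qed.

End StarAlgebra.

(** * Projective tests, contractions and truncation errors *)

Section Tests.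
Context {R : realType} {A : starAlg R}.
Implicit Types (a b x y h q p t s r g w z : A).

Definition projector p := adj p = p /\ p * p = p.

Lemma projectorC p : projector p -> projector (1 - p).
Proof.
move=> [h1 h2]; split; first by rewrite adjB adj1 h1.
by rewrite mulrBl mul1r mulrBr mulr1 h2 subrr subr0.
Qed.

Lemma projector_pos p : projector p -> pos p.
Proof. by move=> [h1 h2]; have := pos_adjM p; rewrite h1 h2. Qed.

Lemma test_sandwich p q : projector p -> projector q -> test (q * p * q).
Proof.
move=> hp hq; have [q1 q2] := hq; split.
  by have := pos_conj q (projector_pos hp); rewrite q1.
have -> : 1 - q * p * q = (1 - q) + adj q * (1 - p) * q.
  by rewrite q1 mulrBr mulr1 mulrBl q2 addrA subrK.
apply: posD; first exact/projector_pos/projectorC.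
exact/pos_conj/projector_pos/projectorC.
Qed.

(** 1 - q p q splits as (1 - q) + q (1 - p) q. In the second term [q] is compared with 1 by
    [form_split]: twice the miss of [p] and twice the form of [1 - p] at [q - 1], which the miss of
    [q] dominates. *)
Lemma sandwich_miss p q s : projector p -> projector q -> pos s ->
  tr ((1 - q * p * q) * s) <= 3 * tr ((1 - q) * s) + 2 * tr ((1 - p) * s).
Proof.
move=> hp hq hs; have [q1 q2] := hq.
have -> : tr ((1 - q * p * q) * s) = tr ((1 - q) * s) + form (1 - p) s q q.
  rewrite /form -trD -mulrDl; congr (tr (_ * _)).
  by rewrite q1 mulrBr mulr1 mulrBl q2 addrA subrK.
have := form_split q 1 (projector_pos (projectorC hp)) hs.
rewrite form11.
have -> : form (1 - p) s (q - 1) (q - 1) = tr ((1 - q) * s) - form p s (q - 1) (q - 1).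
  rewrite formBt; congr (_ - _); rewrite /form mulr1 adjB adj1 q1.
  by rewrite -[q - 1]opprB mulrNN (proj2 (projectorC hq)).
have := form_ge0 (q - 1) (projector_pos hp) hs; lra.
Qed.

(** Cyclicity moves both factors [q] onto [y], so that [p] and [q * y * q] can be majorized one
    after the other without any commutation. *)
Lemma sandwich_false p q y w z (a b : R) : adj q = q -> pos y -> pos w -> 0 <= a ->
  pos (sc A a * w - p) -> pos (sc A b * z - q * y * q) ->
  tr (q * p * q * y) <= a * b * tr (w * z).
Proof.
move=> hq hy hw ha hpw hqz.
have hqy : pos (q * y * q) by have := pos_conj q hy; rewrite hq.
have -> : tr (q * p * q * y) = tr (p * (q * y * q)).
  by rewrite -2!mulrA trC !mulrA.
apply: (le_trans (le_tr_posl hqy hpw)).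
rewrite -(mulrA (sc A a)) tr_sc -(mulrA a b) ler_wpM2l // trC.
by apply: (le_trans (le_tr_posl hw hqz)); rewrite -mulrA tr_sc trC.
Qed.

Definition contraction h := adj h = h /\ pos (1 - h * h).

Lemma contractionN h : contraction h -> contraction (- h).
Proof. by move=> [h1 h2]; split; rewrite ?adjN ?h1 // mulrNN. Qed.

Lemma contraction_form h s : contraction h -> pos s -> form 1 s h h <= tr s.
Proof.
move=> [h1 h2] hs; have -> : tr s = tr (1 * s) by rewrite mul1r.
by rewrite /form h1 mulr1 le_tr_posl.
Qed.

Lemma contraction_tr h s : contraction h -> pos s -> tr (h * s) <= tr s.
Proof.
move=> hh hs; have := form_AMGM 1 h (pos1 A) hs ltr01.
have := contraction_form hh hs.
have -> : form 1 s 1 h = tr (h * s) by rewrite /form adj1 !mul1r.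
by rewrite form11 mul1r invr1 !mul1r; lra.
Qed.

(** The truncation by [q] is one sided, so [q * y] need not be self-adjoint. The part (1 - q) y is
    paired with [h] by AM-GM in the form weighted by [y]. *)
Lemma truncation_bound h q y r (eta : R) : contraction h -> projector q ->
  pos y -> pos (r - y) -> 0 < eta ->
  2 * tr (h * (r - q * y)) <=
  2 * tr (r - y) + eta^-1 * tr ((1 - q) * r) + eta * tr r.
Proof.
move=> hh hq hy hry e0; have hq' := projectorC hq.
have -> : tr (h * (r - q * y)) = tr (h * (r - y)) + tr (h * ((1 - q) * y)).
  by rewrite -trD -mulrDr mulrBl mul1r addrA subrK.
have h1 := contraction_tr hh hry.
have := form_AMGM (1 - q) h (pos1 A) hy e0.
rewrite (formC (1 - q) h (pos1 A) hy).
have -> : form 1 y h (1 - q) = tr (h * ((1 - q) * y)).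
  by rewrite /form mulr1 (proj1 hh) mulrA.
have -> : form 1 y (1 - q) (1 - q) = tr ((1 - q) * y).
  by rewrite /form mulr1 (proj1 hq') (proj2 hq').
have h2 : eta * form 1 y h h <= eta * tr r.
  rewrite ler_pM2l //; apply: le_trans (contraction_form hh hy) _.
  by have := tr_pos hry; rewrite trB subr_ge0.
have h3 : eta^-1 * tr ((1 - q) * y) <= eta^-1 * tr ((1 - q) * r).
  rewrite ler_pM2l ?invr_gt0 // ![tr ((1 - q) * _)]trC.
  by apply: le_tr_posl => //; exact: projector_pos.
lra.
Qed.

(** tr(h x) is the inner product of [ginv * x] with [g * h]. With [g] the square root of a reference
    state, the last term is a chi-square quantity; the support condition on [x] lets [ginv] be a
    pseudo-inverse. *)
Lemma covering_AMGM h g ginv x (eta : R) : contraction h -> adj g = g ->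
  adj ginv = ginv -> g * ginv * x = x -> 0 < eta ->
  2 * tr (h * x) <= eta * tr (g * g) + eta^-1 * form (ginv * ginv) 1 x x.
Proof.
move=> hh hg hgi hx e0; have [h1 h2] := hh.
have := form_AMGM (ginv * x) (g * h) (pos1 A) (pos1 A) e0.
have -> : form 1 1 (ginv * x) (g * h) = tr (h * x).
  by rewrite (formC _ _ (pos1 A) (pos1 A)) /form !mulr1 adjM h1 hg -{2}hx !mulrA.
have -> : form 1 1 (ginv * x) (ginv * x) = form (ginv * ginv) 1 x x.
  by rewrite /form !mulr1 adjM hgi !mulrA.
have -> : form 1 1 (g * h) (g * h) = form 1 (g * g) h h.
  by rewrite /form !mulr1 adjM h1 hg -[h * h * _]mulrA [RHS]trC !mulrA.
have hgg : pos (g * g) by have := pos_adjM g; rewrite hg.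
have := contraction_form hh hgg; rewrite -(ler_pM2l e0); lra.
Qed.

Lemma form_cut t q s : adj q = q -> adj s = s ->
  form t 1 (q * s) (q * s) = tr (q * t * q * (s * s)).
Proof.
move=> hq hs; rewrite /form mulr1 adjM hq hs (mulrA _ s s) [RHS]trC.
by rewrite !mulrA.
Qed.

Lemma form_suml I (r : seq I) (P : pred I) (F : I -> A) t s y :
  form t s (\sum_(i <- r | P i) F i) y = \sum_(i <- r | P i) form t s (F i) y.
Proof.
elim/big_rec2: _ => [|i u v _ <-]; first by rewrite /form adj0 !mul0r tr0.
by rewrite /form adjD !mulrDl trD.
Qed.

Lemma form_sumr I (r : seq I) (P : pred I) (F : I -> A) t s x :
  form t s x (\sum_(i <- r | P i) F i) = \sum_(i <- r | P i) form t s x (F i).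
Proof.
elim/big_rec2: _ => [|i u v _ <-]; first by rewrite /form mulr0 mul0r tr0.
by rewrite /form mulrDr mulrDl trD.
Qed.

End Tests.

(** * Complex matrices as an instance of the abstract algebra *)

Section MatrixAlgebra.
Context {R : realType}.
Local Notation C := (R[i]).

Definition mxsc n (r : R) : 'M[C]_n := (r%:C)%:M.

Lemma adjmx_sc n r : (mxsc n r)^† = mxsc n r.
Proof.
apply/matrixP => i j; rewrite !mxE eq_sym.
by case: eqP => _; rewrite ?mulr1n ?mulr0n ?conjc_real ?conjc0.
Qed.

Lemma mxscC n r (A : 'M[C]_n) : mxsc n r *m A = A *m mxsc n r.
Proof. by rewrite mul_scalar_mx mul_mx_scalar. Qed.

Lemma mxsc1 n : mxsc n 1 = 1%:M.
Proof. by rewrite /mxsc rmorph1. Qed.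

Lemma trR_sc n r (A : 'M[C]_n) : trR (mxsc n r *m A) = r * trR A.
Proof. by rewrite mul_scalar_mx trRZ. Qed.

Definition mxAlg n : starAlg R :=
  @StarAlg R 'M[C]_n (@adjmx R n n) (@trR R n) (@psd R n) (@mxsc n)
    (@adjmxK R n n) (@adjmxD R n n) (@adjmxM R n n n) (@adjmx_sc n) (@mxscC n)
    (@mxsc1 n) (@trRD R n) (@trRC R n n) (@trR_sc n) (@trR_adj R n) (@psd1 R n)
    (@psdD R n) (@psd_conj R n n) (@psd_herm R n) (@trR_psdM R n).

End MatrixAlgebra.

(** * Independent sampling *)

Section IID.
Context {R : realType} {I X : finType} (p : X -> R).
Implicit Types (F : {ffun I -> X} -> R) (f : X -> R).

Definition iidE F : R := \sum_(c : {ffun I -> X}) (\prod_i p (c i)) * F c.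

Lemma iidE_prod (G : I -> X -> R) :
  iidE (fun c => \prod_i G i (c i)) = \prod_i \sum_x p x * G i x.
Proof.
by rewrite bigA_distr_bigA; apply: eq_bigr => c _; rewrite -big_split.
Qed.

Lemma eq_iidE F F' : F =1 F' -> iidE F = iidE F'.
Proof. by move=> h; apply: eq_bigr => c _; rewrite h. Qed.

Lemma iidED F F' : iidE (fun c => F c + F' c) = iidE F + iidE F'.
Proof. by rewrite -big_split; apply: eq_bigr => c _; rewrite mulrDr. Qed.

Lemma iidEZ a F : iidE (fun c => a * F c) = a * iidE F.
Proof. by rewrite mulr_sumr; apply: eq_bigr => c _; rewrite mulrCA. Qed.

Lemma iidEB F F' : iidE (fun c => F c - F' c) = iidE F - iidE F'.
Proof.
rewrite -[- iidE F']mulN1r -iidEZ -iidED.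
by apply: eq_iidE => c; rewrite mulN1r.
Qed.

Lemma iidE_sum J (r : seq J) (P : pred J) (F : J -> {ffun I -> X} -> R) :
  iidE (fun c => \sum_(j <- r | P j) F j c) = \sum_(j <- r | P j) iidE (F j).
Proof. by rewrite exchange_big; apply: eq_bigr => c _; rewrite mulr_sumr. Qed.

Hypothesis p1 : \sum_x p x = 1.

Lemma iidE_cst a : iidE (fun=> a) = a.
Proof.
have := iidE_prod (fun _ _ => 1).
rewrite (eq_iidE (F' := fun=> 1)); last by move=> c; rewrite big1.
move=> e; rewrite -[X in iidE (fun=> X)]mulr1 iidEZ e big1 ?mulr1 // => i _.
by rewrite -[RHS]p1; apply: eq_bigr => x _; rewrite mulr1.
Qed.

Lemma sum_p_cst a : \sum_x p x * a = a.
Proof. by rewrite -mulr_suml p1 mul1r. Qed.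

Lemma iidE1 i f : iidE (fun c => f (c i)) = \sum_x p x * f x.
Proof.
have := iidE_prod (fun j x => if j == i then f x else 1).
rewrite (eq_iidE (F' := fun c => f (c i))); last first.
  move=> c; rewrite (bigD1 i) //= eqxx big1 ?mulr1 // => j ji.
  by rewrite (negbTE ji).
move=> ->; rewrite (bigD1 i) //= eqxx [X in _ * X]big1 ?mulr1 // => j ji.
by rewrite (negbTE ji) sum_p_cst.
Qed.

Lemma sum_pred1 u : \sum_x p x * (x == u)%:R = p u.
Proof.
rewrite (bigD1 u) //= eqxx mulr1 big1 ?addr0 // => x xu.
by rewrite (negbTE xu) mulr0.
Qed.

Lemma iidE2 i j (f : X -> X -> R) : i != j ->
  iidE (fun c => f (c i) (c j)) = \sum_x \sum_y p x * p y * f x y.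
Proof.
move=> ij.
(* Expanding [f] in products of indicators makes the expectation factorize by [iidE_prod]. *)
transitivity (iidE (fun c =>
    \sum_x \sum_y f x y * ((c i == x)%:R * (c j == y)%:R))).
  apply: eq_iidE => c; rewrite (bigD1 (c i)) //= (bigD1 (c j)) //= !eqxx.
  rewrite !mulr1 !big1 ?addr0 // => x xc; last first.
    by rewrite eq_sym (negbTE xc) mulr0 mulr0.
  by rewrite big1 // => y _; rewrite eq_sym (negbTE xc) mul0r mulr0.
rewrite iidE_sum; apply: eq_bigr => x _; rewrite iidE_sum; apply: eq_bigr => y _.
rewrite iidEZ mulrC; congr (_ * _).
have := iidE_prod (fun k z => if k == i then (z == x)%:R
                              else if k == j then (z == y)%:R else 1).
rewrite (eq_iidE (F' := fun c => (c i == x)%:R * (c j == y)%:R)); last first.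
  move=> c; rewrite (bigD1 i) //= eqxx (bigD1 j) /= 1?eq_sym //.
  rewrite (eq_sym j i) (negbTE ij) eqxx big1 ?mulr1 // => k /andP[ki kj].
  by rewrite (negbTE ki) (negbTE kj).
move=> ->; rewrite (bigD1 i) //= eqxx (bigD1 j) /= 1?eq_sym //.
rewrite (negbTE ij) eqxx [X in _ * (_ * X)]big1 ?mulr1 ?sum_pred1 // => k /andP[ki kj].
by rewrite (negbTE ki) (negbTE kj) sum_p_cst.
Qed.

Hypothesis p0 : forall x, 0 <= p x.

Lemma le_iidE F F' : (forall c, F c <= F' c) -> iidE F <= iidE F'.
Proof.
by move=> h; apply: ler_sum => c _; rewrite ler_wpM2l // prodr_ge0.
Qed.

Lemma iidE_exists F b : iidE F <= b -> exists c, F c <= b.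
Proof.
move=> h; apply: contrapT => /forallNP hc.
have hlt c : b < F c by rewrite ltNge; apply/negP; exact: hc.
(* A sample of positive weight is what makes the comparison of the two expectations strict. *)
have [c wc] : exists c : {ffun I -> X}, 0 < \prod_i p (c i).
  apply: contrapT => /forallNP hw.
  have := iidE_cst 1; rewrite /iidE big1 => [/esym/eqP|c _].
    by rewrite oner_eq0.
  have /negP := hw c; rewrite lt_neqAle prodr_ge0 ?andbT // negbK => /eqP <-.
  by rewrite mul0r.
have : iidE (fun=> b) < iidE F.
  rewrite /iidE (bigD1 c) //= [ltRHS](bigD1 c) //= ltr_leD //.
    by rewrite ltr_pM2l.
  by apply: ler_sum => c' _; rewrite ler_wpM2l ?prodr_ge0 // ltW.
by rewrite iidE_cst ltNge h.
Qed.

(* When [G] is the Gram kernel of a semi-inner product, the left-hand side is the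
   expected squared distance between the empirical mean and the mean. *)
Lemma iidE_variance (G : X -> X -> R) (L := #|I|%:R : R) : (0 < #|I|)%N ->
  0 <= \sum_x \sum_y p x * p y * G x y ->
  iidE (fun c => L^-1 ^+ 2 * \sum_i \sum_j G (c i) (c j)
     - 2 * (L^-1 * \sum_i \sum_y p y * G (c i) y)
     + \sum_x \sum_y p x * p y * G x y) <= L^-1 * \sum_x p x * G x x.
Proof.
move=> I0; set m := \sum_x \sum_y _ => m0; set v := \sum_x _.
have L0 : 0 < L by rewrite ltr0n.
rewrite iidED iidEB !iidEZ (iidE_cst m) !iidE_sum.
have -> : \sum_i iidE (fun c => \sum_j G (c i) (c j)) = L * v + L * (L - 1) * m.
  transitivity (\sum_(i : I) (v + (L - 1) * m)).
    apply: eq_bigr => i _; rewrite iidE_sum (bigD1 i) //=.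
    rewrite (iidE1 i (fun x => G x x)); congr (_ + _).
    rewrite (eq_bigr (fun=> m)); last by move=> j ji; rewrite iidE2 // eq_sym.
    have : \sum_(j : I) m = m + \sum_(j | j != i) m by rewrite (bigD1 i).
    by rewrite sumr_const -mulr_natl -/L => e; lra.
  by rewrite sumr_const -mulr_natl -/L; ring.
have -> : \sum_i iidE (fun c => \sum_y p y * G (c i) y) = L * m.
  transitivity (\sum_(i : I) m).
    apply: eq_bigr => i _; rewrite (iidE1 i (fun x => \sum_y p y * G x y)).
    by apply: eq_bigr => x _; rewrite mulr_sumr; apply: eq_bigr => y _; rewrite mulrA.
  by rewrite sumr_const -mulr_natl.
have -> : L^-1 ^+ 2 * (L * v + L * (L - 1) * m) - 2 * (L^-1 * (L * m)) + m =
    L^-1 * v - L^-1 * m.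
  by field; rewrite gt_eqF.
by rewrite gerBl mulr_ge0 // invr_ge0 ltW.
Qed.

End IID.

(** * Variance of the empirical mean *)

Section Covering.
Context {R : realType} {A : starAlg R} {I X : finType} (p : X -> R).
Hypothesis p1 : \sum_x p x = 1.

Definition empirical (F : X -> A) (c : {ffun I -> X}) : A :=
  sc A #|I|%:R^-1 * \sum_i F (c i) - \sum_x sc A (p x) * F x.

Lemma covering_variance (F : X -> A) (t : A) : (0 < #|I|)%N -> pos t ->
  iidE p (fun c : {ffun I -> X} => form t 1 (empirical F c) (empirical F c)) <=
  #|I|%:R^-1 * \sum_x p x * form t 1 (F x) (F x).
Proof.
move=> I0 ht; set G := fun x y => form t 1 (F x) (F y).
have mE : \sum_x \sum_y p x * p y * G x y =
    form t 1 (\sum_x sc A (p x) * F x) (\sum_x sc A (p x) * F x).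
  rewrite form_suml; apply: eq_bigr => x _; rewrite form_sumr.
  by apply: eq_bigr => y _; rewrite form_scl form_scr mulrA.
have m0 : 0 <= \sum_x \sum_y p x * p y * G x y.
  by rewrite mE; apply: form_ge0 => //; exact: pos1.
have := iidE_variance p1 I0 m0; apply: le_trans.
rewrite le_eqVlt; apply/orP; left; apply/eqP/eq_iidE => c.
rewrite /empirical formB //; last exact: pos1.
rewrite form_scl !form_scr form_scl mE expr2 -mulrA; congr (_ * (_ * _) - 2 * (_ * _) + _).
  rewrite form_suml; apply: eq_bigr => i _.
  by rewrite form_sumr.
rewrite form_suml; apply: eq_bigr => i _; rewrite form_sumr.
by apply: eq_bigr => y _; rewrite form_scr.
Qed.

End Covering.

(** * Large deviations for sparse words *)

Section LargeDeviations.
Context {R : realType} {N : nat} (pt : 'I_N.+1 -> R) (Hpt : distr_nz pt).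
Local Notation X := 'I_N.+1.

Definition letter_law (alpha : R) (x : X) : R :=
  (1 - alpha) * (x == ord0)%:R + alpha * pt x.

Lemma letter_law_sum alpha (g : X -> R) : g ord0 = 1 ->
  \sum_x letter_law alpha x * g x = 1 + alpha * (\sum_x pt x * g x - 1).
Proof.
move=> g0; have -> : \sum_x letter_law alpha x * g x =
    \sum_x (1 - alpha) * (g x * (x == ord0)%:R) + \sum_x alpha * (pt x * g x).
  by rewrite -big_split; apply: eq_bigr => x _ /=; rewrite /letter_law; ring.
rewrite -!mulr_sumr [X in _ * X + _](bigD1 ord0) //= ?eqxx big1; first by rewrite g0 ?mulr1n; ring.
by move=> x x0; rewrite (negbTE x0) mulr0.
Qed.

Lemma letter_law1 alpha : \sum_x letter_law alpha x = 1.
Proof.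
have := letter_law_sum alpha (erefl ((fun=> 1) ord0)).
under eq_bigr do rewrite mulr1.
under [X in _ * (X - _)]eq_bigr do rewrite mulr1.
by rewrite (proj2 (proj2 Hpt)) subrr mulr0 addr0.
Qed.

Lemma letter_law_ge0 alpha x : 0 <= alpha <= 1 -> 0 <= letter_law alpha x.
Proof.
move=> /andP[a0 a1]; rewrite /letter_law addr_ge0 ?mulr_ge0 ?subr_ge0 ?ler0n //.
by case: Hpt => _ [].
Qed.

(** From exp(-u) >= 1 - u one gets exp(u) (1 - u) <= 1, and the quadratic times 1 - u is 1 + u^2 (1
    - 2 u). *)
Lemma expR_le_quad (u : R) : u <= 2^-1 -> expR u <= 1 + u + 2 * u ^+ 2.
Proof.
move=> hu; have h : expR u * (1 - u) <= 1.
  rewrite -[leRHS](expRxMexpNx_1 u) ler_pM2l ?expR_gt0 //.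
  by have := expR_ge1Dx (- u).
have u1 : 0 < 1 - u by lra.
rewrite -(ler_pM2r u1); apply: le_trans h _.
have -> : (1 + u + 2 * u ^+ 2) * (1 - u) = 1 + u ^+ 2 * (1 - 2 * u) by ring.
by rewrite lerDl mulr_ge0 ?sqr_ge0 //; lra.
Qed.

Lemma iid_exp_le n (alpha : R) (g : X -> R) : 0 <= alpha <= 1 ->
  g ord0 = 1 -> (forall x, 0 <= g x) ->
  iidE (letter_law alpha) (fun x : {ffun 'I_n -> X} => \prod_t g (x t)) <=
  expR (n%:R * alpha * (\sum_x pt x * g x - 1)).
Proof.
move=> a01 g0 gge; rewrite (iidE_prod _ (fun _ => g)) prodr_const card_ord.
rewrite -mulrA expRM_natl; apply: lerXn2r; rewrite ?nnegrE ?expR_ge0 //.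
  by apply: sumr_ge0 => x _; rewrite mulr_ge0 ?letter_law_ge0.
by rewrite letter_law_sum //; exact: expR_ge1Dx.
Qed.

Context {d : nat}.
Implicit Types r : X -> 'I_d -> R.

Definition stochastic r := (forall x a, 0 <= r x a) /\ forall x, \sum_a r x a = 1.

(** Chernoff bound. As [h ord0] vanishes, the exponential moment of one letter is 1 + O(alpha),
    which puts n alpha into the exponent. [c] is fixed before [r], because the laws used later come
    from an eigenbasis of the mean state and move with alpha. *)
Lemma large_deviation (h : X -> 'I_d -> R) (delta : R) : 0 < delta ->
  (forall a, h ord0 a = 0) ->
  exists2 c : R, 0 < c & forall r n (alpha : R), stochastic r -> 0 <= alpha <= 1 ->
  iidE (letter_law alpha) (fun x : {ffun 'I_n -> X} =>
    \sum_(a : {ffun 'I_n -> 'I_d}) (\prod_t r (x t) (a t)) *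
      (n%:R * alpha * (\sum_x pt x * \sum_a r x a * h x a + delta) <=
       \sum_t h (x t) (a t))%R%:R) <= expR (- (c * (n%:R * alpha))).
Proof.
move=> d0 h0; pose H : R := 1 + \sum_x \sum_a `|h x a|.
have hH x a : `|h x a| <= H.
  rewrite /H (bigD1 x) //= (bigD1 a) //= addrCA -addrA lerDl.
  by rewrite !addr_ge0 // ?sumr_ge0 // => *; rewrite sumr_ge0.
have H1 : 1 <= H by rewrite lerDl sumr_ge0 // => x _; rewrite sumr_ge0.
(* With s = k / H^2, the bound 1/2 makes [expR_le_quad] applicable to s h, and delta / 4 makes its
   quadratic term at most s delta / 2, leaving the other half of s delta as exponent. *)
pose k : R := Num.min 2^-1 (delta / 4).
have k0 : 0 < k by rewrite lt_min; apply/andP; split; lra.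
have [k1 k2] : k <= 2^-1 /\ k <= delta / 4 by split; rewrite ge_min lexx ?orbT.
have H2 : 0 < H ^+ 2 by rewrite exprn_gt0 //; lra.
pose s : R := k / H ^+ 2.
have s0 : 0 < s by rewrite divr_gt0.
have sH2 : s * H ^+ 2 = k by rewrite /s divfK // gt_eqF.
exists (s * delta / 2); first by apply: divr_gt0 => //; exact: mulr_gt0.
move=> r n alpha [r0 r1] a01; set m := \sum_x _; set u := n%:R * alpha.
have u0 : 0 <= u by case/andP: a01 => *; rewrite mulr_ge0 ?ler0n.
pose g x := \sum_a r x a * expR (s * h x a).
have g0 : g ord0 = 1.
  by rewrite /g -(r1 ord0); apply: eq_bigr => a _; rewrite h0 mulr0 expR0 mulr1.
have gge x : 0 <= g x by rewrite sumr_ge0 // => a _; rewrite mulr_ge0 // expR_ge0.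
apply: (@le_trans _ _ (expR (- (s * (u * (m + delta)))) *
    iidE (letter_law alpha) (fun x : {ffun 'I_n -> X} => \prod_t g (x t)))).
  rewrite -iidEZ; apply: le_iidE => [x|x]; first exact: letter_law_ge0.
  rewrite bigA_distr_bigA /= mulr_sumr; apply: ler_sum => a _.
  rewrite big_split /= mulrCA ler_wpM2l ?prodr_ge0 //.
  rewrite -expR_sum -expRD -mulr_sumr; case: (leP (u * _)) => [hle|_]; last exact: expR_ge0.
  rewrite -expR0 ler_expR addrC subr_ge0 ler_pM2l //.
apply: (@le_trans _ _ (expR (- (s * (u * (m + delta)))) *
    expR (u * (\sum_x pt x * g x - 1)))).
  by rewrite ler_pM2l ?expR_gt0 //; exact: iid_exp_le.
rewrite -expRD ler_expR.
have gle x : g x <= 1 + s * (\sum_a r x a * h x a) + s * (delta / 2).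
  have -> : 1 + s * (\sum_a r x a * h x a) + s * (delta / 2) =
      \sum_a r x a * (1 + s * h x a + s * (delta / 2)).
    under [RHS]eq_bigr do rewrite 2!mulrDr mulr1.
    rewrite 2!big_split /= -mulr_suml r1 mul1r mulr_sumr; congr (_ + _ + _).
    by apply: eq_bigr => a _; rewrite mulrCA.
  apply: ler_sum => a _; rewrite ler_wpM2l //.
  have ha : s * `|h x a| * H <= k.
    rewrite -sH2 expr2 mulrA ler_wpM2r //; first by lra.
    by rewrite ler_pM2l.
  have ha1 : s * `|h x a| <= k.
    by apply: le_trans ha; rewrite ler_peMr // mulr_ge0 // ltW.
  have ha2 : s * h x a <= s * `|h x a| by rewrite ler_pM2l // ler_norm.
  apply: le_trans (expR_le_quad _) _; first by lra.
  rewrite lerD2l.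
  have -> : (s * h x a) ^+ 2 = s * (s * `|h x a| * `|h x a|).
    by rewrite -mulrA -normrM ger0_norm -?expr2 ?sqr_ge0 //; ring.
  rewrite mulrCA ler_pM2l //.
  have : s * `|h x a| * `|h x a| <= s * `|h x a| * H.
    by rewrite ler_wpM2l // mulr_ge0 // ltW.
  lra.
have gsum : \sum_x pt x * g x - 1 <= s * m + s * (delta / 2).
  have -> : s * m + s * (delta / 2) = \sum_x pt x *
      (1 + s * (\sum_a r x a * h x a) + s * (delta / 2)) - 1.
    have pt1 : \sum_x pt x = 1 by case: Hpt => _ [].
    have -> : s * m = \sum_x pt x * (s * \sum_a r x a * h x a).
      by rewrite mulr_sumr; apply: eq_bigr => x _; rewrite mulrCA.
    have e : \sum_x pt x * (s * (delta / 2)) = s * (delta / 2).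
      by rewrite -mulr_suml pt1 mul1r.
    rewrite -[X in _ + X = _]e.
    rewrite -[X in _ - X]pt1 -sumrB -big_split; apply: eq_bigr => x _ /=.
    by ring.
  rewrite lerD2r; apply: ler_sum => x _; rewrite ler_wpM2l //.
  by case: Hpt => _ [].
have := ler_wpM2l u0 gsum; lra.
Qed.

Variable (l : X -> 'I_d -> R).
Hypotheses (l0 : forall x a, 0 <= l x a) (l_ord0 : forall a, l ord0 a = 1).
(** Absolute continuity. With [ln 0 = 0], a word with a vanishing weight has a misleading
    log-weight; domination gives such words probability zero. *)
Definition dominated r := forall x a, l x a = 0 -> r x a = 0.

Lemma ln_prod (I : finType) (f : I -> R) : (forall i, 0 < f i) ->
  ln (\prod_i f i) = \sum_i ln (f i).
Proof.
move=> hf; suff [] : ln (\prod_i f i) = \sum_i ln (f i) /\ 0 < \prod_i f i by [].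
elim/big_rec2: _ => [|i y1 y2 _ [<- y0]]; first by rewrite ln1.
by rewrite lnM ?posrE // mulr_gt0.
Qed.

Lemma prod_law_gt0 r n (x : {ffun 'I_n -> X}) (a : {ffun 'I_n -> 'I_d}) t :
  dominated r -> \prod_t r (x t) (a t) != 0 -> 0 < l (x t) (a t).
Proof.
move=> rl hr; rewrite lt_neqAle l0 andbT eq_sym; apply: contra hr => /eqP/rl h.
by rewrite (bigD1 t) //= h mul0r.
Qed.

Definition mean_ln r : R := \sum_x pt x * \sum_a r x a * ln (l x a).

Lemma large_deviation_upper (delta : R) : 0 < delta ->
  exists2 c : R, 0 < c & forall r n (alpha : R), stochastic r -> dominated r ->
  0 <= alpha <= 1 ->
  iidE (letter_law alpha) (fun x : {ffun 'I_n -> X} =>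
    \sum_(a : {ffun 'I_n -> 'I_d}) (\prod_t r (x t) (a t)) *
      (expR (n%:R * alpha * (mean_ln r + delta)) < \prod_t l (x t) (a t))%R%:R) <=
  expR (- (c * (n%:R * alpha))).
Proof.
move=> d0; have [|c c0 hc] := @large_deviation (fun x a => ln (l x a)) delta d0.
  by move=> a; rewrite l_ord0 ln1.
exists c => // r n alpha hsr rl a01; apply: le_trans (hc r n alpha hsr a01).
have [r0 r1] := hsr.
apply: le_iidE => [x|x]; first exact: letter_law_ge0.
(* Words of probability zero are removed first; on the others all weights are positive and the
   logarithm of the product is the sum of the logarithms. *)
apply: ler_sum => a _; have [->|hr] := eqVneq (\prod_t r (x t) (a t)) 0.
  by rewrite !mul0r.
rewrite ler_wpM2l ?prodr_ge0 // -(@ln_prod _ (fun t => l (x t) (a t)));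
  last by move=> t; exact: (prod_law_gt0 t rl hr).
have hl : 0 < \prod_t l (x t) (a t) by apply: prodr_gt0 => t _; exact: (prod_law_gt0 t rl hr).
case: (ltP (expR _)) => // /ltW hle; rewrite ler_nat lt0b.
by rewrite -(expRK (_ * (mean_ln r + delta))) ler_ln ?posrE ?expR_gt0.
Qed.

Lemma large_deviation_lower (delta : R) : 0 < delta ->
  exists2 c : R, 0 < c & forall r n (alpha : R), stochastic r -> dominated r ->
  0 <= alpha <= 1 ->
  iidE (letter_law alpha) (fun x : {ffun 'I_n -> X} =>
    \sum_(a : {ffun 'I_n -> 'I_d}) (\prod_t r (x t) (a t)) *
      (\prod_t l (x t) (a t) < expR (n%:R * alpha * (mean_ln r - delta)))%R%:R) <=
  expR (- (c * (n%:R * alpha))).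
Proof.
move=> d0; have [|c c0 hc] := @large_deviation (fun x a => - ln (l x a)) delta d0.
  by move=> a; rewrite l_ord0 ln1 oppr0.
exists c => // r n alpha hsr rl a01; apply: le_trans (hc r n alpha hsr a01).
have [r0 r1] := hsr.
apply: le_iidE => [x|x]; first exact: letter_law_ge0.
apply: ler_sum => a _; have [->|hr] := eqVneq (\prod_t r (x t) (a t)) 0.
  by rewrite !mul0r.
rewrite ler_wpM2l ?prodr_ge0 // sumrN -(@ln_prod _ (fun t => l (x t) (a t)));
  last by move=> t; exact: (prod_law_gt0 t rl hr).
have hl : 0 < \prod_t l (x t) (a t) by apply: prodr_gt0 => t _; exact: (prod_law_gt0 t rl hr).
case: (ltP (\prod__ _)) => // /ltW hle; rewrite ler_nat lt0b.
have -> : \sum_x pt x * (\sum_a0 r x a0 * - ln (l x a0)) + delta = - (mean_ln r - delta).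
  rewrite opprB [RHS]addrC; congr (_ + _); rewrite /mean_ln -sumrN.
  apply: eq_bigr => y _; rewrite -mulrN -sumrN; congr (_ * _).
  by apply: eq_bigr => b _; rewrite mulrN.
rewrite mulrN lerN2.
by rewrite -(expRK (_ * (mean_ln r - delta))) ler_ln ?posrE ?expR_gt0.
Qed.

End LargeDeviations.

(** * Relative entropy *)

Section RelativeEntropy.
Context {R : realType}.
Local Notation C := (R[i]).

Lemma ln_le_subr1 (z : R) : 0 < z -> ln z <= z - 1.
Proof.
move=> z0; rewrite -[X in ln X](subrK 1) [X in ln X]addrC; apply: le_ln1Dx.
by rewrite ltrBrDr addNr.
Qed.

(** Write x = a^2 and y = b^2. The bound ln z <= z - 1 at z = b / a gives 2 a^2 - 2 a b = (x - y) +
    (a - b)^2, and (a - b)^2 >= (x - y)^2 / 4 because a + b <= 2. *)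
Lemma klein_scalar (x y : R) : 0 <= x <= 1 -> 0 < y <= 1 ->
  (x - y) + 4^-1 * (x - y) ^+ 2 <= x * ln x - x * ln y.
Proof.
move=> /andP[x0 x1] /andP[y0 y1]; have [->|xn0] := eqVneq x 0.
  by rewrite !mul0r subrr sub0r sqrrN; nra.
have {x0 xn0} x0 : 0 < x by rewrite lt_neqAle eq_sym xn0.
have [a [a0 xa]] : exists a : R, 0 < a /\ x = a ^+ 2.
  by exists (Num.sqrt x); rewrite sqrtr_gt0 sqr_sqrtr // ltW.
have [b [b0 yb]] : exists b : R, 0 < b /\ y = b ^+ 2.
  by exists (Num.sqrt y); rewrite sqrtr_gt0 sqr_sqrtr // ltW.
have lx : ln x = 2 * ln a by rewrite xa lnXn // mulr_natl.
have ly : ln y = 2 * ln b by rewrite yb lnXn // mulr_natl.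
have -> : x * ln x - x * ln y = a ^+ 2 * (2 * (ln a - ln b)).
  by rewrite lx ly xa; ring.
have h := ln_le_subr1 (divr_gt0 b0 a0); rewrite ln_div ?posrE // in h.
have le1 (z : R) : z ^+ 2 <= 1 -> z <= 1.
  by move=> z2; rewrite leNgt; apply/negP => z1; nra.
have a1 : a <= 1 by apply: le1; rewrite -xa.
have b1 : b <= 1 by apply: le1; rewrite -yb.
have : a ^+ 2 * (2 * (1 - b / a)) <= a ^+ 2 * (2 * (ln a - ln b)).
  by rewrite ler_pM2l ?exprn_gt0 // ler_pM2l //; lra.
apply: le_trans.
have -> : a ^+ 2 * (2 * (1 - b / a)) = 2 * a ^+ 2 - 2 * a * b.
  by field; rewrite gt_eqF.
have : (a - b) ^+ 2 * (a + b) ^+ 2 <= (a - b) ^+ 2 * 4.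
  by rewrite ler_wpM2l ?sqr_ge0 //; nra.
rewrite xa yb; have -> : (a - b) ^+ 2 * (a + b) ^+ 2 = (a ^+ 2 - b ^+ 2) ^+ 2 by ring.
have -> : (a - b) ^+ 2 = a ^+ 2 - 2 * a * b + b ^+ 2 by ring.
lra.
Qed.

Lemma chi2_scalar (x y : R) : 0 <= x -> 0 < y ->
  x * ln x - x * ln y <= (x - y) + y^-1 * (x - y) ^+ 2.
Proof.
move=> x0 y0; have [->|xn0] := eqVneq x 0.
  rewrite !mul0r subrr sub0r sqrrN expr2 mulrA mulVf ?gt_eqF // mul1r addNr //.
have {x0 xn0} x0 : 0 < x by rewrite lt_neqAle eq_sym xn0.
rewrite -mulrBr -ln_div ?posrE //.
apply: le_trans (ler_wpM2l (ltW x0) (ln_le_subr1 (divr_gt0 x0 y0))) _.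
suff -> : x * (x / y - 1) = x - y + y^-1 * (x - y) ^+ 2 by [].
by field; rewrite gt_eqF.
Qed.

Definition prob n (f : 'I_n -> R) := (forall i, 0 <= f i) /\ \sum_i f i = 1.

Lemma prob_le1 n (f : 'I_n -> R) i : prob f -> f i <= 1.
Proof. by move=> [f0 <-]; rewrite (bigD1 i) //= lerDl sumr_ge0. Qed.

Lemma density_spectral n (A : 'M[C]_n) : density A ->
  exists U f, [/\ unitary U, prob f & A = dg U f].
Proof.
move=> [hA trA]; have [U [f [hU f0 eA]]] := psd_spectral hA.
exists U, f; split => //; split => //.
by move: trA; rewrite eA tr_dg // => /complexI.
Qed.

Lemma density_family_spectral (T : Type) n (A : T -> 'M[C]_n) :
  (forall x, density (A x)) -> exists U lam,
  [/\ forall x, unitary (U x), forall x, prob (lam x) & forall x, A x = dg (U x) (lam x)].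
Proof.
move=> hA; have [U hU] := choice (fun x => density_spectral (hA x)).
have [lam hl] := choice hU.
by exists U, lam; split=> x; case: (hl x).
Qed.

Lemma density_dg n (U : 'M[C]_n) f : unitary U -> prob f -> density (dg U f).
Proof. by move=> hU [f0 f1]; split; [exact: psd_dg | rewrite tr_dg // f1]. Qed.

Lemma sum_ov_quad n (U V : 'M[C]_n) f g (c : R) : unitary U -> unitary V ->
  prob f -> prob g ->
  c * (\sum_i \sum_j (f i - g j) ^+ 2 * ov U V i j) =
  \sum_i \sum_j ((f i - g j) + c * (f i - g j) ^+ 2) * ov U V i j.
Proof.
move=> hU hV [_ f1] [_ g1].
have := sum_ov_trace f g hU hV; rewrite f1 g1 subrr => e.
rewrite -[LHS]add0r -[X in X + _ = _]e mulr_sumr -big_split; apply: eq_bigr => i _ /=.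
by rewrite mulr_sumr -big_split; apply: eq_bigr => j _ /=; ring.
Qed.

(** A Pinsker-type bound with the Hilbert-Schmidt norm. Under [ln 0 = 0] the scalar inequality fails
    when [g j = 0] and [f i] is positive, so such pairs must have no overlap. *)
Lemma relent_ge n (U V : 'M[C]_n) f g : unitary U -> unitary V ->
  prob f -> prob g ->
  (forall i j, g j = 0 -> f i != 0 -> ov U V i j = 0) ->
  4^-1 * trR ((dg U f - dg V g) *m (dg U f - dg V g)) <= relent (dg U f) (dg V g).
Proof.
move=> hU hV hf hg h; have [f0 f1] := hf; have [g0 g1] := hg.
rewrite (relent_ov f g hU hV) (trR_sqrB_ov f g hU hV).
rewrite (sum_ov_quad _ hU hV hf hg).
apply: (ge0_sum_ov hU hV) => i j o0; rewrite subr_ge0.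
have [gj|gj] := eqVneq (g j) 0; last first.
  by apply: klein_scalar; rewrite ?f0 ?prob_le1 // lt_neqAle eq_sym gj g0.
have [->|fi] := eqVneq (f i) 0; first by rewrite gj !mul0r !subrr expr0n mulr0 addr0.
by rewrite (h i j gj fi) eqxx in o0.
Qed.

Lemma relent_le n (U V : 'M[C]_n) f g (mu : R) : unitary U -> unitary V ->
  prob f -> prob g -> 0 < mu -> (forall j, g j != 0 -> mu <= g j) ->
  (forall i j, g j = 0 -> f i != 0 -> ov U V i j = 0) ->
  relent (dg U f) (dg V g) <= mu^-1 * trR ((dg U f - dg V g) *m (dg U f - dg V g)).
Proof.
move=> hU hV hf hg mu0 hmu h; have [f0 f1] := hf; have [g0 g1] := hg.
rewrite (relent_ov f g hU hV) (trR_sqrB_ov f g hU hV).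
rewrite (sum_ov_quad _ hU hV hf hg).
apply: (ge0_sum_ov hU hV) => i j o0; rewrite subr_ge0.
have [gj|gj] := eqVneq (g j) 0; last first.
  have gj0 : 0 < g j by rewrite lt_neqAle eq_sym gj g0.
  apply: le_trans (chi2_scalar (f0 i) gj0) _.
  by rewrite lerD2l ler_wpM2r ?sqr_ge0 // lef_pV2 ?posrE // hmu.
have [->|fi] := eqVneq (f i) 0; first by rewrite gj !mul0r !subrr expr0n mulr0 addr0.
by rewrite (h i j gj fi) eqxx in o0.
Qed.

Lemma supp_diag0 n (V : 'M[C]_n) g (W : 'M[C]_n) j : unitary V -> g j = 0 ->
  (V^† *m (dg V g *m W) *m V) j j = 0.
Proof.
move=> hV gj; have -> : V^† *m (dg V g *m W) *m V =
    diag_mx (\row_i (g i)%:C) *m (V^† *m W *m V).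
  by rewrite /dg !mulmxA hV mul1mx.
by rewrite diag_mulE rowCE gj rmorph0 mul0r.
Qed.

(** The diagonal entry of [dg U f] at column [j] of [V] is a sum of the nonnegative terms
    [f i * ov U V i j]; the factorization through [dg V g] makes it vanish. *)
Lemma supp_ov n (U V : 'M[C]_n) f g W i j : unitary U -> unitary V ->
  (forall i, 0 <= f i) -> dg U f = dg V g *m W ->
  g j = 0 -> f i != 0 -> ov U V i j = 0.
Proof.
move=> hU hV f0 e gj fi; have := diag_dg V U f j.
rewrite e supp_diag0 //= => /esym/eqP; rewrite psumr_eq0; last first.
  by move=> k _; rewrite mulr_ge0 ?ov_ge0.
move=> /allP/(_ i (mem_index_enum i)) /=; rewrite mulf_eq0 (negbTE fi) /=.
by rewrite ovC => /eqP.
Qed.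

Lemma contraction_dg n (U : 'M[C]_n) f : unitary U -> (forall i, `|f i| <= 1) ->
  contraction (dg U f : mxAlg n).
Proof.
move=> hU hf; split; first exact: dg_adj.
suff : psd (1%:M - dg U f *m dg U f) by [].
rewrite (dgM _ _ hU) -(dg1 hU) -dgB; apply: psd_dg => i.
by rewrite subr_ge0 -expr2 -real_normK ?num_real // expr_le1.
Qed.

Definition trace_close n (A B : 'M[C]_n) (eps : R) :=
  forall h : mxAlg n, contraction h -> trR (h *m (A - B)) <= eps.

Lemma trace_closeC n (A B : 'M[C]_n) eps :
  trace_close A B eps -> trace_close B A eps.
Proof.
move=> h k /contractionN/h.
have -> : (- k) *m (A - B) = k *m (B - A) by rewrite mulNmx -mulmxN opprB.
by [].
Qed.

Lemma trace_close_dg n (A B V : 'M[C]_n) (l : 'I_n -> R) (eps Lam : R) : unitary V ->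
  trace_close A B eps -> 0 < Lam -> (forall j, `|l j| <= Lam) ->
  trR (A *m dg V l) - trR (B *m dg V l) <= eps * Lam.
Proof.
move=> hV hAB L0 hl.
have hc : contraction (dg V (fun j => Lam^-1 * l j) : mxAlg n).
  apply: contraction_dg => // j.
  by rewrite normrM gtr0_norm ?invr_gt0 // ler_pdivrMl // mulr1.
have := hAB _ hc; rewrite dgZ -scalemxAl trRZ mulmxBr trRB.
by rewrite [trR (dg V l *m A)]trRC [trR (dg V l *m B)]trRC ler_pdivrMl // mulrC.
Qed.

Lemma le_chain (a b c d e l : R) : c <= a -> b - e <= d -> d - c <= l -> b - a <= e + l.
Proof. by move=> *; lra. Qed.

(* Klein's inequality against the full-rank mixture of the second state with
   the maximally mixed one. *)
Lemma entropy_close n (A B : 'M[C]_n) (eps : R) : density A -> density B ->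
  0 < eps <= 1 -> trace_close A B eps ->
  trR (B *m mlog B) - trR (A *m mlog A) <= eps * (1 + ln (2 * n%:R / eps)).
Proof.
move=> dA dB /andP[e0 e1] hAB.
have [U [f [hU hf eA]]] := density_spectral dA.
have [V [m [hV hm eB]]] := density_spectral dB.
have n0 : (0 < n)%N.
  case: n A B dA dB hAB U f hU hf eA V m hV hm eB => //.
  by move=> ? ? ? ? ? ? ? ? []; rewrite big_ord0 => _ /esym/eqP; rewrite oner_eq0.
have nR : 0 < n%:R :> R by rewrite ltr0n.
have nR1 : 1 <= n%:R :> R by rewrite ler1n.
(* [t] is the spectrum of (B + eps I / n) / (1 + eps). Its eigenvalues are at least eps / (2 n),
   which gives the bound [Lam] on their logarithms. *)
pose k : R := eps / n%:R.
have k0 : 0 < k by apply: divr_gt0.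
pose t j := (m j + k) / (1 + eps).
have t0 j : 0 < t j.
  by apply: divr_gt0; [have := proj1 hm j; lra | lra].
have ht : prob t.
  split=> [j|]; first exact: ltW.
  rewrite -mulr_suml big_split /= (proj2 hm) sumr_const card_ord -mulr_natl.
  by rewrite /k mulrCA divff ?gt_eqF // mulr1 divff // gt_eqF; lra.
have klein : trR (A *m dg V (fun j => ln (t j))) <= trR (A *m mlog A).
  have : 0 <= relent A (dg V t).
    have hs i j : t j = 0 -> f i != 0 -> ov U V i j = 0.
      by move=> tj; have := t0 j; rewrite tj ltxx.
    rewrite eA; apply: le_trans (relent_ge hU hV hf ht hs).
    rewrite trR_sqrB_ov //; apply: mulr_ge0; first by rewrite invr_ge0 ler0n.
    apply: sumr_ge0 => i _; apply: sumr_ge0 => j _.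
    by rewrite mulr_ge0 ?sqr_ge0 ?ov_ge0.
  by rewrite relentE mlog_dg // subr_ge0.
pose Lam := ln (2 * n%:R / eps).
have L0 : 0 < Lam.
  by rewrite ln_gt0 // ltr_pdivlMr //; lra.
have hl j : `|ln (t j)| <= Lam.
  rewrite ler0_norm; last by apply: ln_le0; exact: prob_le1.
  rewrite -lnV ?posrE // ler_ln ?posrE ?invr_gt0 //; last first.
    by apply: divr_gt0 => //; lra.
  rewrite -[2 * _ / _]invrK lef_pV2 ?posrE ?invr_gt0 //; last first.
    by apply: divr_gt0 => //; lra.
  rewrite invf_div /t /k ler_pdivlMr; last by lra.
  apply: (@le_trans _ _ (eps / n%:R)); last by have := proj1 hm j; lra.
  have -> : eps / (2 * n%:R) * (1 + eps) = eps / n%:R * ((1 + eps) / 2).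
    by field; rewrite gt_eqF.
  apply: ler_piMr; first by apply: divr_ge0; exact: ltW.
  by rewrite ler_pdivrMr //; lra.
(* Passing from [m] to [t] only loses the normalization, ln(1 + eps) <= eps. *)
have hB : trR (B *m mlog B) - eps <= trR (B *m dg V (fun j => ln (t j))).
  rewrite {1 2}eB mlog_dg // eB !dgM // !trR_dg //.
  have -> : eps = \sum_j m j * eps by rewrite -mulr_suml (proj2 hm) mul1r.
  rewrite -sumrB; apply: ler_sum => j _; rewrite -mulrBr.
  have [->|mj] := eqVneq (m j) 0; first by rewrite !mul0r.
  have mj0 : 0 < m j by rewrite lt_neqAle eq_sym mj (proj1 hm).
  rewrite ler_pM2l // /t ln_div ?posrE; [|lra|lra].
  have h1 : ln (m j) <= ln (m j + k) by rewrite ler_ln ?posrE //; lra.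
  have h2 : ln (1 + eps) <= eps by apply: le_ln1Dx; lra.
  lra.
have := trace_close_dg hV (trace_closeC hAB) L0 hl.
rewrite mulrDr mulr1; exact: le_chain klein hB.
Qed.

Lemma norm_le_two (a b c d e f : R) : a - b <= e -> b - a <= e ->
  c - d <= f -> d - c <= f -> `|a - c - (b - d)| <= e + f.
Proof. by move=> *; rewrite ler_norml; apply/andP; split; lra. Qed.

Lemma relent_close n (A B V : 'M[C]_n) g (Lam eps : R) : density A -> density B ->
  unitary V -> 0 < Lam -> (forall j, `|ln (g j)| <= Lam) ->
  0 < eps <= 1 -> trace_close A B eps ->
  `|relent A (dg V g) - relent B (dg V g)| <=
  eps * (1 + ln (2 * n%:R / eps) + Lam).
Proof.
move=> dA dB hV L0 hg he hAB; have hBA := trace_closeC hAB.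
have h1 := entropy_close dA dB he hAB.
have h2 := entropy_close dB dA he hBA.
have h3 := trace_close_dg hV hAB L0 hg.
have h4 := trace_close_dg hV hBA L0 hg.
rewrite (relentE A) (relentE B) (mlog_dg _ hV) mulrDr.
exact: norm_le_two h2 h1 h3 h4.
Qed.

Lemma sum_word_ln n d (r l : 'I_d -> R) : \sum_a r a = 1 ->
  (forall a, 0 <= l a) -> (forall a, l a = 0 -> r a = 0) ->
  \sum_(a : {ffun 'I_n -> 'I_d}) (\prod_t r (a t)) * ln (\prod_t l (a t)) =
  n%:R * \sum_a r a * ln (l a).
Proof.
move=> r1 l0 rl.
transitivity (iidE r (fun a : {ffun 'I_n -> 'I_d} => \sum_t ln (l (a t)))).
  apply: eq_bigr => a _; have [->|hr] := eqVneq (\prod_t r (a t)) 0.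
    by rewrite !mul0r.
  rewrite ln_prod // => t; rewrite lt_neqAle l0 andbT eq_sym.
  by apply: contra hr => /eqP/rl h; rewrite (bigD1 t) //= h mul0r.
rewrite iidE_sum mulr_natl -[n in RHS]card_ord -sumr_const.
by apply: eq_bigr => t _; rewrite (iidE1 r1 t (fun a => ln (l a))).
Qed.

Lemma diag_psd_real n (A V : 'M[C]_n) j : psd A ->
  (V^† *m A *m V) j j = (complex.Re ((V^† *m A *m V) j j))%:C.
Proof.
move=> hA; have := psd_diag j (psd_conj V hA).
by case: (_ j j) => x y; rewrite lecE /= => /andP[/eqP -> _].
Qed.

Lemma trR_tensor_dg n d (A V : 'I_n -> 'M[C]_d) (l : 'I_(tdim n d) -> R) :
  (forall t, psd (A t)) ->
  trR (tensor A *m dg (tensor V) l) =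
  \sum_i l i * \prod_t complex.Re (((V t)^† *m A t *m V t) (word i t) (word i t)).
Proof.
move=> hA; rewrite trRC trR_dgM; apply: eq_bigr => i _; congr (_ * _).
rewrite tensor_adj !tensorM tensorE.
rewrite (eq_bigr (fun k =>
  (complex.Re (((V k)^† *m A k *m V k) (word i k) (word i k)))%:C)); last first.
  by move=> k _; exact: diag_psd_real.
by rewrite -rmorph_prod.
Qed.

(** With [ln 0 = 0], the logarithm of a tensor power is the sum of the local logarithms on its
    support only; the factorization of [A] through [dg V g] confines the state to that support. *)
Lemma trR_mlog_tensor n d (A V : 'M[C]_d) (g : 'I_d -> R) W : unitary V -> density A ->
  (forall j, 0 <= g j) -> A = dg V g *m W ->
  trR (tensor (fun _ : 'I_n => A) *m mlog (tensor (fun _ : 'I_n => dg V g))) =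
  n%:R * trR (A *m mlog (dg V g)).
Proof.
move=> hV [hA trA] g0 eA.
have hVn := @unitary_tensor _ n _ (fun=> V) (fun=> hV).
rewrite tensor_dg !mlog_dg // trR_tensor_dg // [trR (A *m _)]trRC trR_dgM.
pose q j := complex.Re ((V^† *m A *m V) j j).
rewrite (big_word (fun a => ln (\prod_t g (a t)) * \prod_t q (a t))).
under eq_bigr do rewrite mulrC.
rewrite sum_word_ln //.
- by congr (_ * _); apply: eq_bigr => j _; rewrite mulrC.
- have : trR (dg V (fun=> 1) *m A) = \sum_j q j.
    by rewrite trR_dgM; apply: eq_bigr => j _; rewrite mul1r.
  by rewrite dg1 // mul1mx /trR trA.
- by move=> j gj; rewrite /q eA supp_diag0.
Qed.

Lemma subr_mul_eq (x y x' y' k : R) : x = k * x' -> y = k * y' -> x - y = k * (x' - y').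
Proof. by move=> -> ->; rewrite mulrBr. Qed.

Lemma relent_tensor n d (A V : 'M[C]_d) (g : 'I_d -> R) W : unitary V -> density A ->
  (forall j, 0 <= g j) -> A = dg V g *m W ->
  relent (tensor (fun _ : 'I_n => A)) (tensor (fun _ : 'I_n => dg V g)) =
  n%:R * relent A (dg V g).
Proof.
move=> hV dA g0 eA; rewrite (relentE A) (relentE (tensor _)).
have [U [f [hU [f0 _] eA']]] := density_spectral dA.
have E : trR (tensor (fun _ : 'I_n => A) *m mlog (tensor (fun _ : 'I_n => A))) =
    n%:R * trR (A *m mlog A).
  rewrite eA'; apply: (trR_mlog_tensor n hU (W := 1%:M)) => //.
    by rewrite -eA'.
  by rewrite mulmx1.
exact: subr_mul_eq E (trR_mlog_tensor n hV dA g0 eA).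
Qed.

End RelativeEntropy.

(** * Spectral projections and diagonal laws *)

Section SpectralTests.
Context {R : realType}.
Local Notation C := (R[i]).

Lemma supp_subP n (A B : 'M[C]_n) : supp_sub A B -> exists W, A = B *m W.
Proof.
move=> /submxP[D e]; exists D^T.
by rewrite -[A]trmxK e trmx_mul trmxK.
Qed.

Lemma dg_le n (U : 'M[C]_n) (f g : 'I_n -> R) : (forall i, f i <= g i) ->
  psd (dg U g - dg U f).
Proof. by move=> h; rewrite -dgB; apply: psd_dg => i; rewrite subr_ge0. Qed.

Lemma projector_dg n (U : 'M[C]_n) (P : pred 'I_n) : unitary U ->
  projector (dg U (fun i => (P i)%:R) : mxAlg n).
Proof.
move=> hU; split; first exact: dg_adj.
rewrite [LHS](dgM _ _ hU); apply: eq_dg => i.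
by case: (P i); rewrite ?mulr1 ?mulr0.
Qed.

Lemma dg_compl n (U : 'M[C]_n) (P : pred 'I_n) : unitary U ->
  1%:M - dg U (fun i => (P i)%:R) = dg U (fun i => (~~ P i)%:R).
Proof.
move=> hU; rewrite -(dg1 hU) -dgB; apply: eq_dg => i.
by case: (P i); rewrite /= ?subrr ?subr0.
Qed.

Definition diagR n (V A : 'M[C]_n) a : R := complex.Re ((V^† *m A *m V) a a).

Lemma diagR_ge0 n (V A : 'M[C]_n) a : psd A -> 0 <= diagR V A a.
Proof. by move=> hA; apply: psd_diagR; exact: psd_conj. Qed.

Lemma trR_dg_diagR n (V A : 'M[C]_n) f :
  trR (A *m dg V f) = \sum_a diagR V A a * f a.
Proof. by rewrite trRC trR_dgM; apply: eq_bigr => a _; rewrite mulrC. Qed.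

Lemma diagR_sum n (V A : 'M[C]_n) : unitary V -> density A ->
  \sum_a diagR V A a = 1.
Proof.
move=> hV [_ trA]; have := trR_dg_diagR V A (fun=> 1).
have e : trR A = 1 by rewrite /trR trA.
rewrite dg1 // mulmx1 e => ->.
by apply: eq_bigr => a _; rewrite mulr1.
Qed.

Lemma diagR_self n (U : 'M[C]_n) f a : unitary U -> diagR U (dg U f) a = f a.
Proof.
move=> hU; rewrite /diagR /dg !mulmxA hU mul1mx -mulmxA hU mulmx1.
by rewrite mxE mxE eqxx mulr1n.
Qed.

Lemma diagR_supp n (V : 'M[C]_n) g A a : unitary V -> supp_sub A (dg V g) ->
  g a = 0 -> diagR V A a = 0.
Proof. by move=> hV /supp_subP[W ->] ga; rewrite /diagR supp_diag0. Qed.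

Lemma trR_tensor_test n d (A V : 'I_n -> 'M[C]_d) (f : 'I_(tdim n d) -> R) :
  (forall t, psd (A t)) ->
  trR (dg (tensor V) f *m tensor A) =
  \sum_i f i * \prod_t diagR (V t) (A t) (word i t).
Proof. by move=> hA; rewrite trRC trR_tensor_dg. Qed.

Lemma trR_mlog_diagR n (V A : 'M[C]_n) g : unitary V ->
  trR (A *m mlog (dg V g)) = \sum_a diagR V A a * ln (g a).
Proof. by move=> hV; rewrite mlog_dg // trR_dg_diagR. Qed.

(** The support projection of [dg V g] lies between: it dominates the density [A], and the sum of
    the inverse nonzero eigenvalues times [dg V g] dominates it. *)
Lemma supp_le n (V A : 'M[C]_n) g : unitary V -> prob g -> density A ->
  supp_sub A (dg V g) ->
  exists2 c : R, 0 <= c & psd (c%:C *: dg V g - A).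
Proof.
move=> hV [g0 g1] dA /supp_subP[W eA].
pose Pi := dg V (fun a => (g a != 0)%:R).
have PA : Pi *m A = A.
  have E : Pi *m dg V g = dg V g.
    rewrite [LHS](dgM _ _ hV); apply: eq_dg => a.
    by case: eqVneq => [->|]; rewrite ?mul0r ?mul1r.
  by rewrite eA mulmxA E.
have AP : A *m Pi = A.
  have hA : A^† = A by apply: psd_herm; case: dA.
  by rewrite -{1}hA -[Pi](dg_adj V) -adjmxM PA hA.
pose c := \sum_a (g a)^-1; exists c.
  by apply: sumr_ge0 => a _; rewrite invr_ge0.
have h1 : psd (c%:C *: dg V g - Pi).
  rewrite -dgZ; apply: dg_le => a; case: eqVneq => [->|ga]; first by rewrite mulr0.
  rewrite -(mulVf ga) ler_wpM2r // /c (bigD1 a) //= lerDl.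
  by apply: sumr_ge0 => b _; rewrite invr_ge0.
have h2 : psd (Pi - A).
  have [U [f [hU hf eA']]] := density_spectral dA.
  have h : psd (1%:M - A).
    by rewrite eA' -(dg1 hU); apply: dg_le => i; exact: prob_le1.
  have := psd_conj Pi h; rewrite dg_adj mulmxBr mulmx1 mulmxBl PA AP.
  suff -> : Pi *m Pi = Pi by [].
  by case: (projector_dg (fun a => g a != 0) hV).
by have := psdD h1 h2; rewrite addrA subrK.
Qed.

End SpectralTests.

(** * Tests for a channel *)

Section Channel.
Context {R : realType} {N d : nat} (pt : 'I_N.+1 -> R) (Hpt : distr_nz pt).
Local Notation C := (R[i]).
Local Notation X := 'I_N.+1.
Context (sigma : X -> 'M[C]_d) (U : X -> 'M[C]_d) (lam : X -> 'I_d -> R).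
Hypotheses (hU : forall x, unitary (U x)) (hlam : forall x, prob (lam x)).
Hypothesis (hsigma : forall x, sigma x = dg (U x) (lam x)).
Hypothesis (hsupp : forall x, supp_sub (sigma x) (sigma ord0)).

Lemma channel_density x : density (sigma x).
Proof. by rewrite hsigma; exact: density_dg. Qed.

Lemma channel_psd x : psd (sigma x).
Proof. by case: (channel_density x). Qed.

(* The innocent letter carries weight 1: the tests below act on the other
   positions only. *)
Definition own_weight (x : X) (a : 'I_d) : R := if x == ord0 then 1 else lam x a.
Definition ref_weight (x : X) (a : 'I_d) : R := if x == ord0 then 1 else lam ord0 a.

Lemma own_weight_ge0 x a : 0 <= own_weight x a.
Proof. by rewrite /own_weight; case: ifP => // _; case: (hlam x). Qed.

Lemma ref_weight_ge0 x a : 0 <= ref_weight x a.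
Proof. by rewrite /ref_weight; case: ifP => // _; case: (hlam ord0). Qed.

Lemma own_weight0 a : own_weight ord0 a = 1.
Proof. by rewrite /own_weight eqxx. Qed.

Lemma ref_weight0 a : ref_weight ord0 a = 1.
Proof. by rewrite /ref_weight eqxx. Qed.

Lemma own_stochastic : stochastic lam.
Proof. by split=> [x a|x]; case: (hlam x). Qed.

Lemma own_dominated : dominated own_weight lam.
Proof.
move=> x a; rewrite /own_weight; case: ifP => // _ /eqP.
by rewrite oner_eq0.
Qed.

(** Outcome law of measuring a letter state in the reference basis. [V0] is left free: Bob takes an
    eigenbasis of the mean state, Willie the innocent one. *)
Definition ref_law (V0 : 'M[C]_d) (x : X) (a : 'I_d) : R :=
  diagR (if x == ord0 then V0 else U ord0) (sigma x) a.

Lemma ref_stochastic V0 : unitary V0 -> stochastic (ref_law V0).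
Proof.
move=> hV; have hV' x : unitary (if x == ord0 :> X then V0 else U ord0) by case: ifP.
split=> [x a|x]; first by apply: diagR_ge0; exact: channel_psd.
by apply: diagR_sum => //; exact: channel_density.
Qed.

Lemma ref_dominated V0 : dominated ref_weight (ref_law V0).
Proof.
move=> x a; rewrite /ref_weight /ref_law; case: ifP => [_ /eqP|_].
  by rewrite oner_eq0.
by apply: diagR_supp => //; rewrite -hsigma.
Qed.

Definition divergence := \sum_x pt x * relent (sigma x) (sigma ord0).

(** The two terms of the relative entropy are mean log-weights in two different bases, so each can
    be controlled by its own spectral test. [V0] drops out because the innocent letter has
    probability zero under [pt]. *)
Lemma divergence_mean V0 : divergence =
  mean_ln pt own_weight lam - mean_ln pt ref_weight (ref_law V0).
Proof.
rewrite /divergence /mean_ln -sumrB; apply: eq_bigr => x _; rewrite -mulrBr.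
have [->|x0] := eqVneq x ord0; first by case: Hpt => -> _; rewrite !mul0r.
congr (_ * _); rewrite relentE; congr (_ - _).
  rewrite {2}hsigma trR_mlog_diagR //; apply: eq_bigr => a _.
  by rewrite hsigma diagR_self // /own_weight (negbTE x0).
rewrite (hsigma ord0) trR_mlog_diagR //; apply: eq_bigr => a _.
by rewrite /ref_law /ref_weight (negbTE x0).
Qed.

Definition word_weight n (f : X -> 'I_d -> R) (x : {ffun 'I_n -> X}) i : R :=
  \prod_t f (x t) (word i t).

Lemma word_weight_ge0 n (f : X -> 'I_d -> R) (x : {ffun 'I_n -> X}) i :
  (forall y a, 0 <= f y a) -> 0 <= word_weight f x i.
Proof. by move=> h; apply: prodr_ge0. Qed.

Lemma word_weightM n (f g : X -> 'I_d -> R) (x : {ffun 'I_n -> X}) i :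
  word_weight (fun y a => f y a * g y a) x i = word_weight f x i * word_weight g x i.
Proof. by rewrite /word_weight big_split. Qed.

Definition channel_word n (x : {ffun 'I_n -> X}) : 'M[C]_(tdim n d) :=
  tensor (fun t => sigma (x t)).

Lemma channel_word_density n (x : {ffun 'I_n -> X}) : density (channel_word x).
Proof. by apply: tensor_density => t; exact: channel_density. Qed.

Definition own_basis n (x : {ffun 'I_n -> X}) := tensor (fun t => U (x t)).

Lemma own_basis_unitary n (x : {ffun 'I_n -> X}) : unitary (own_basis x).
Proof. exact: unitary_tensor. Qed.

Lemma channel_word_dg n (x : {ffun 'I_n -> X}) :
  channel_word x = dg (own_basis x) (word_weight lam x).
Proof.
rewrite /channel_word (@eq_tensor _ _ _ _ (fun t => dg (U (x t)) (lam (x t)))).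
  by rewrite tensor_dg.
by move=> t; rewrite hsigma.
Qed.

Lemma own_test_trace n (x : {ffun 'I_n -> X}) (P : pred R) :
  trR (dg (own_basis x) (fun i => (P (word_weight own_weight x i))%:R) *m
       channel_word x) =
  \sum_(a : {ffun 'I_n -> 'I_d}) (\prod_t lam (x t) (a t)) *
    (P (\prod_t own_weight (x t) (a t)))%:R.
Proof.
rewrite channel_word_dg (dgM _ _ (own_basis_unitary x)) (trR_dg _ (own_basis_unitary x)).
rewrite (big_word (fun a : {ffun 'I_n -> 'I_d} =>
  (P (\prod_t own_weight (x t) (a t)))%:R * \prod_t lam (x t) (a t))).
by apply: eq_bigr => a _; rewrite mulrC.
Qed.

Definition ref_basis n V0 (x : {ffun 'I_n -> X}) :=
  tensor (fun t => if x t == ord0 then V0 else U ord0).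

Lemma ref_basis_unitary n V0 (x : {ffun 'I_n -> X}) : unitary V0 ->
  unitary (ref_basis V0 x).
Proof. by move=> hV; apply: unitary_tensor => t; case: ifP. Qed.

Lemma ref_test_trace n V0 (x : {ffun 'I_n -> X}) (P : pred R) :
  trR (dg (ref_basis V0 x) (fun i => (P (word_weight ref_weight x i))%:R) *m
       channel_word x) =
  \sum_(a : {ffun 'I_n -> 'I_d}) (\prod_t ref_law V0 (x t) (a t)) *
    (P (\prod_t ref_weight (x t) (a t)))%:R.
Proof.
rewrite trR_tensor_test; last by move=> t; exact: channel_psd.
rewrite (big_word (fun a : {ffun 'I_n -> 'I_d} =>
  (P (\prod_t ref_weight (x t) (a t)))%:R * \prod_t ref_law V0 (x t) (a t))).
by apply: eq_bigr => a _; rewrite mulrC.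
Qed.

Definition channel_mean alpha : 'M[C]_d :=
  \sum_x (letter_law pt alpha x)%:C *: sigma x.

Lemma channel_mean_rho_alpha alpha : channel_mean alpha = rho_alpha pt sigma alpha.
Proof.
rewrite /channel_mean /letter_law /rho_alpha /mixture.
under eq_bigr do rewrite rmorphD scalerDl.
rewrite big_split /=; congr (_ + _).
  rewrite (bigD1 ord0) //= ?eqxx mulr1.
  by rewrite big1 ?addr0 // => x x0; rewrite (negbTE x0) mulr0 scale0r.
by rewrite scaler_sumr; apply: eq_bigr => x _; rewrite scalerA -rmorphM.
Qed.

Lemma channel_mean_density (alpha : R) : 0 <= alpha <= 1 ->
  density (channel_mean alpha).
Proof.
move=> a01; split.
  by apply: psd_sum => x _; apply: psdZ; [exact: letter_law_ge0 | exact: channel_psd].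
rewrite /channel_mean raddf_sum /= -[RHS](rmorph1 (@real_complex_def R (Phant R))).
rewrite -(letter_law1 Hpt alpha) rmorph_sum; apply: eq_bigr => x _.
by rewrite mxtraceZ (proj2 (channel_density x)) mulr1.
Qed.

(** The support assumption puts each letter state below a multiple of the innocent one, and
    non-innocent letters have total weight alpha. *)
Lemma channel_mean_le : exists2 c : R, 0 <= c & forall alpha : R, 0 <= alpha <= 1 ->
  psd ((1 + c * alpha)%:C *: sigma ord0 - channel_mean alpha).
Proof.
have h x : exists c : R, 0 <= c /\ psd (c%:C *: sigma ord0 - sigma x).
  have hx : supp_sub (sigma x) (dg (U ord0) (lam ord0)) by rewrite -hsigma.
  have [c c0 hc] := supp_le (hU ord0) (hlam ord0) (channel_density x) hx.
  exists c; split; first exact: c0.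
  by rewrite (hsigma ord0); exact: hc.
have [c hc] := choice h.
exists (\sum_x pt x * c x).
  by apply: sumr_ge0 => x _; rewrite mulr_ge0 ?(proj1 (hc x)) //; case: Hpt => _ [].
move=> alpha /andP[a0 a1].
have -> : (1 + (\sum_x pt x * c x) * alpha)%:C *: sigma ord0 - channel_mean alpha =
    alpha%:C *: sigma ord0 +
    \sum_x (alpha * pt x)%:C *: ((c x)%:C *: sigma ord0 - sigma x).
  have E1 : channel_mean alpha = (1 - alpha)%:C *: sigma ord0 +
      \sum_x (alpha * pt x)%:C *: sigma x.
    rewrite channel_mean_rho_alpha /rho_alpha /mixture scaler_sumr; congr (_ + _).
    by apply: eq_bigr => x _; rewrite scalerA -rmorphM.
  have E2 : \sum_x (alpha * pt x)%:C *: ((c x)%:C *: sigma ord0 - sigma x) =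
      (alpha * \sum_x pt x * c x)%:C *: sigma ord0 -
      \sum_x (alpha * pt x)%:C *: sigma x.
    rewrite mulr_sumr rmorph_sum scaler_suml -sumrB; apply: eq_bigr => x _.
    by rewrite scalerBr scalerA -rmorphM mulrA.
  rewrite E1 E2 opprD !addrA; congr (_ - _).
  rewrite -scalerBl -scalerDl -rmorphB -rmorphD; congr (_%:C *: _).
  by ring.
apply: psdD; first by apply: psdZ => //; exact: channel_psd.
apply: psd_sum => x _; apply: psdZ; last by case: (hc x).
by rewrite mulr_ge0 //; case: Hpt => _ [].
Qed.

Lemma mxsc_dg_le n (B : 'M[C]_n) (f g : 'I_n -> R) a : (forall i, g i <= a * f i) ->
  psd (mxsc n a *m dg B f - dg B g).
Proof. by move=> h; rewrite mul_scalar_mx -dgZ; exact: dg_le. Qed.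

Lemma own_neutral n (x : {ffun 'I_n -> X}) :
  tensor (fun t => if x t == ord0 then 1%:M else sigma (x t)) =
  dg (own_basis x) (word_weight own_weight x).
Proof.
transitivity (tensor (fun t => dg (U (x t)) (own_weight (x t)))).
  apply: eq_tensor => t; rewrite /own_weight.
  by case: eqP => [->|_]; [rewrite dg1 | rewrite hsigma].
exact: tensor_dg.
Qed.

(* The test of a word is [Q P Q], where [P] is spectral for the state of the word and
   [Q] for a commuting majorant of the mean state; conjugating by [Q] turns the
   majorant into a multiple of [Z], whose overlap with the word state factorizes. *)
Section BobTest.
Context (c0 alpha : R) (V0 : 'M[C]_d) (nu : 'I_d -> R) (n : nat).
Hypotheses (c00 : 0 <= c0) (a01 : 0 <= alpha <= 1) (hV0 : unitary V0).
Hypotheses (hnu : prob nu) (eV0 : channel_mean alpha = dg V0 nu).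
Hypothesis hc0 :
  psd ((1 + c0 * alpha)%:C *: sigma ord0 - channel_mean alpha).
Context (tP tQ : R) (tP0 : 0 < tP) (tQ0 : 0 <= tQ) (x : {ffun 'I_n -> X}).

Let k : R := 1 + c0 * alpha.

Lemma scale_ge0 : 0 <= k.
Proof. by case/andP: a01 => a0 _; rewrite addr_ge0 // mulr_ge0. Qed.

Definition own_proj := dg (own_basis x) (fun i => (tP <= word_weight own_weight x i)%R%:R).
Definition ref_proj :=
  dg (ref_basis V0 x) (fun i => (word_weight ref_weight x i <= tQ)%R%:R).

Lemma own_proj_projector : projector (own_proj : mxAlg _).
Proof. exact: (projector_dg (fun i => tP <= word_weight own_weight x i) (own_basis_unitary x)). Qed.

Lemma ref_proj_projector : projector (ref_proj : mxAlg _).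
Proof.
exact: (projector_dg (fun i => word_weight ref_weight x i <= tQ)
  (ref_basis_unitary x hV0)).
Qed.

(** [yw] is [zw] times [ref_weight], and the product of the latter is what [ref_proj] keeps below
    [tQ]. *)
Let yw (y : X) (a : 'I_d) : R := if y == ord0 then nu a else k * lam ord0 a.
Let zw (y : X) (a : 'I_d) : R := if y == ord0 then nu a else k.
Let Y := dg (ref_basis V0 x) (word_weight yw x).
Let Z := dg (ref_basis V0 x) (word_weight zw x).

Lemma yw_ge0 y a : 0 <= yw y a.
Proof.
rewrite /yw; case: ifP => _; first by case: hnu.
by rewrite mulr_ge0 ?scale_ge0 //; case: (hlam ord0).
Qed.

Lemma zw_ge0 y a : 0 <= zw y a.
Proof. by rewrite /zw; case: ifP => _; [case: hnu | exact: scale_ge0]. Qed.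

Lemma majorantE : Y = tensor (fun t => if x t == ord0 then channel_mean alpha
                              else k%:C *: sigma ord0).
Proof.
transitivity (tensor (fun t => dg (if x t == ord0 then V0 else U ord0) (yw (x t)))).
  by symmetry; exact: tensor_dg.
apply: eq_tensor => t; rewrite /yw.
by case: ifP => _; [rewrite eV0 | rewrite dgZ -hsigma].
Qed.

Lemma conj_majorantE : Z = tensor (fun t => if x t == ord0 then channel_mean alpha
                              else k%:C *: 1%:M).
Proof.
transitivity (tensor (fun t => dg (if x t == ord0 then V0 else U ord0) (zw (x t)))).
  by symmetry; exact: tensor_dg.
apply: eq_tensor => t; rewrite /zw.
case: ifP => _; first by rewrite eV0.
by rewrite dg_const // scalemx1.
Qed.

Lemma mean_le_majorant : psd (Y - tensor (fun _ : 'I_n => channel_mean alpha)).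
Proof.
have dm := channel_mean_density a01.
rewrite majorantE; apply: tensor_le => t; first by case: dm.
by case: ifP => _; [rewrite subrr; exact: psd0 | exact: hc0].
Qed.

Lemma trR_own_neutral : trR (dg (own_basis x) (word_weight own_weight x) *m Z) =
  \prod_t (if x t == ord0 then 1 else k).
Proof.
rewrite conj_majorantE -own_neutral tensorM.
apply: trR_tensor => t; case: ifP => _.
  by rewrite mul1mx (proj2 (channel_mean_density a01)).
by rewrite -scalemxAr mulmx1 mxtraceZ (proj2 (channel_density _)) mulr1.
Qed.

(** A likelihood-ratio bound without commutation: the mean power is below [Y], the first projection
    is below [tP^-1] times the neutralized word state, and [ref_proj] brings [Y] below [tQ] times
    [Z]. The remaining trace factorizes over positions. *)
Lemma bob_false_alarm :
  trR (ref_proj *m own_proj *m ref_proj *m tensor (fun _ : 'I_n => channel_mean alpha))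
  <= tP^-1 * tQ * \prod_t (if x t == ord0 then 1 else k).
Proof.
have [hT _] := test_sandwich own_proj_projector ref_proj_projector.
apply: (le_trans (le_trR_psdMr hT mean_le_majorant)).
rewrite -trR_own_neutral.
have hY : psd Y by apply: psd_dg => i; exact: (word_weight_ge0 _ _ yw_ge0).
have hW : psd (dg (own_basis x) (word_weight own_weight x)).
  by apply: psd_dg => i; apply: word_weight_ge0; exact: own_weight_ge0.
have hPW : psd (mxsc _ tP^-1 *m dg (own_basis x) (word_weight own_weight x) - own_proj).
  apply: mxsc_dg_le => i; case: (leP tP _) => h; last first.
    by rewrite mulr_ge0 ?invr_ge0 ?(ltW tP0) // word_weight_ge0 //; exact: own_weight_ge0.
  by rewrite mulrC ler_pdivlMr // mul1r.
have hQZ : psd (mxsc _ tQ *m Z - ref_proj *m Y *m ref_proj).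
  have hB := ref_basis_unitary x hV0.
  have -> : ref_proj *m Y *m ref_proj = dg (ref_basis V0 x) (fun i =>
      (word_weight ref_weight x i <= tQ)%R%:R * word_weight yw x i
      * (word_weight ref_weight x i <= tQ)%R%:R).
    by rewrite (dgM _ _ hB) [LHS](dgM _ _ hB).
  apply: mxsc_dg_le => i.
  have -> : word_weight yw x i = word_weight ref_weight x i * word_weight zw x i.
    rewrite -word_weightM; apply: eq_bigr => t _; rewrite /yw /ref_weight /zw.
    by case: ifP => _; rewrite ?mul1r // mulrC.
  have hz : 0 <= word_weight zw x i by exact: (word_weight_ge0 _ _ zw_ge0).
  case: (leP _ tQ) => h; last by rewrite mulr0 mulr_ge0.
  by rewrite mul1r mulr1 ler_wpM2r.
have tPi : 0 <= tP^-1 by rewrite invr_ge0 ltW.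
exact: (@sandwich_false R (mxAlg _) own_proj ref_proj Y _ Z tP^-1 tQ
  (proj1 ref_proj_projector) hY hW tPi hPW hQZ).
Qed.

End BobTest.

Lemma iidE_lin (I Y : finType) (p : Y -> R) (a b : R) (F G : {ffun I -> Y} -> R) :
  iidE p (fun c => a * F c + b * G c) = a * iidE p F + b * iidE p G.
Proof. by rewrite iidED !iidEZ. Qed.

Lemma le_comb (a b x y z : R) :
  a <= x -> b <= y -> x <= z -> y <= z -> 3 * a + 2 * b <= 5 * z.
Proof. by move=> *; lra. Qed.

Lemma bob_tests (delta : R) : 0 < delta ->
  exists c c0 : R, [/\ 0 < c, 0 <= c0 & forall n (alpha : R), 0 <= alpha <= 1 ->
  exists T : {ffun 'I_n -> X} -> 'M[C]_(tdim n d),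
  [/\ forall x, test (T x : mxAlg _),
      iidE (letter_law pt alpha) (fun x => trR ((1%:M - T x) *m channel_word x)) <=
        5 * expR (- (c * (n%:R * alpha))) &
      iidE (letter_law pt alpha)
        (fun x => trR (T x *m tensor (fun _ : 'I_n => channel_mean alpha))) <=
        expR (- (n%:R * alpha * (divergence - 2 * delta)) +
              c0 * (n%:R * alpha ^+ 2))]].
Proof.
move=> d0.
have [cP cP0 hP] := large_deviation_lower Hpt own_weight_ge0 own_weight0 d0.
have [cQ cQ0 hQ] := large_deviation_upper Hpt ref_weight_ge0 ref_weight0 d0.
have [c0 c00 hc0] := channel_mean_le.
exists (Num.min cP cQ), c0; split => //; first by rewrite lt_min cP0.
move=> n alpha a01.
have [V0 [nu [hV0 hnu eV0]]] := density_spectral (channel_mean_density a01).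
pose u := n%:R * alpha.
pose mP := mean_ln pt own_weight lam.
pose mQ := mean_ln pt ref_weight (ref_law V0).
(* The ratio of the thresholds is exp(- u (divergence - 2 delta)), while each test misses its mean
   by a margin delta. *)
pose tP := expR (u * (mP - delta)); pose tQ := expR (u * (mQ + delta)).
have u0 : 0 <= u by case/andP: a01 => *; rewrite mulr_ge0.
have tP0 : 0 < tP by exact: expR_gt0.
have tQ0 : 0 <= tQ by exact: expR_ge0.
pose P (x : {ffun 'I_n -> X}) := own_proj tP x.
pose Q (x : {ffun 'I_n -> X}) := ref_proj V0 tQ x.
have prP x : projector (P x : mxAlg _) := own_proj_projector tP x.
have prQ x : projector (Q x : mxAlg _) := ref_proj_projector hV0 tQ x.
exists (fun x => Q x *m P x *m Q x); split.
- by move=> x; exact: (test_sandwich (prP x) (prQ x)).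
- have missP : iidE (letter_law pt alpha)
      (fun x => trR ((1%:M - P x) *m channel_word x)) <= expR (- (cP * u)).
    apply: le_trans (hP _ n alpha own_stochastic own_dominated a01).
    rewrite le_eqVlt; apply/orP; left; apply/eqP; apply: eq_iidE => x.
    rewrite -(own_test_trace x (fun w => w < tP)).
    rewrite (dg_compl (fun i => tP <= word_weight own_weight x i) (own_basis_unitary x)).
    apply: (congr1 (fun M => trR (M *m channel_word x))).
    by apply: eq_dg => i; rewrite -ltNge.
  have missQ : iidE (letter_law pt alpha)
      (fun x => trR ((1%:M - Q x) *m channel_word x)) <= expR (- (cQ * u)).
    apply: le_trans (hQ _ n alpha (ref_stochastic hV0) (@ref_dominated V0) a01).
    rewrite le_eqVlt; apply/orP; left; apply/eqP; apply: eq_iidE => x.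
    rewrite -(ref_test_trace V0 x (fun w => tQ < w)).
    rewrite (dg_compl (fun i => word_weight ref_weight x i <= tQ) (ref_basis_unitary x hV0)).
    apply: (congr1 (fun M => trR (M *m channel_word x))).
    by apply: eq_dg => i; rewrite -ltNge.
  pose m1 x := trR ((1%:M - Q x) *m channel_word x).
  pose m2 x := trR ((1%:M - P x) *m channel_word x).
  apply: (@le_trans _ _ (iidE (letter_law pt alpha) (fun x => 3 * m1 x + 2 * m2 x))).
    apply: le_iidE => [y|x]; first exact: letter_law_ge0.
    have [hw _] := channel_word_density x.
    exact: (sandwich_miss (prP x) (prQ x) (hw : pos (channel_word x : mxAlg _))).
  rewrite (iidE_lin _ 3 2 m1 m2) -/u.
  have e1 : expR (- (cP * u)) <= expR (- (Num.min cP cQ * u)).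
    by rewrite ler_expR lerN2 ler_wpM2r // ge_min lexx.
  have e2 : expR (- (cQ * u)) <= expR (- (Num.min cP cQ * u)).
    by rewrite ler_expR lerN2 ler_wpM2r // ge_min lexx orbT.
  exact: le_comb missQ missP e2 e1.
pose k := 1 + c0 * alpha.
apply: (@le_trans _ _ (iidE (letter_law pt alpha) (fun x : {ffun 'I_n -> X} =>
    tP^-1 * tQ * \prod_t (if x t == ord0 then 1 else k)))).
  apply: le_iidE => [y|x]; first exact: letter_law_ge0.
  exact: (bob_false_alarm c00 a01 hV0 hnu eV0 (hc0 _ a01) tP0 tQ0 x).
rewrite iidEZ.
have k0 : 0 <= k by case/andP: a01 => a0 _; rewrite addr_ge0 // mulr_ge0.
have := @iid_exp_le _ _ _ Hpt n alpha (fun y => if y == ord0 then 1 else k) a01.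
have g0 : (if ord0 == ord0 :> X then 1 else k) = 1 by rewrite eqxx.
have gge (y : X) : 0 <= (if y == ord0 then 1 else k) by case: ifP.
move=> /(_ g0 gge) hE.
have t0 : 0 <= tP^-1 * tQ by rewrite mulr_ge0 // invr_ge0 ltW.
apply: (le_trans (ler_wpM2l t0 hE)).
rewrite /tP /tQ -expRN -!expRD ler_expR (divergence_mean V0) -/mP -/mQ -/u.
(* A non-innocent position costs the factor k and has probability alpha, so the majorant adds n
   alpha (k - 1) = c0 n alpha^2 to the exponent. *)
have -> : \sum_y pt y * (if y == ord0 then 1 else k) - 1 = c0 * alpha.
  case: Hpt => p0 [_ p1].
  have -> : \sum_y pt y * (if y == ord0 then 1 else k) = \sum_y pt y * k.
    apply: eq_bigr => y _; case: eqP => [->|] //.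
    by rewrite p0 !mul0r.
  by rewrite -mulr_suml p1 mul1r /k; ring.
by rewrite le_eqVlt; apply/orP; left; apply/eqP; rewrite /u; ring.
Qed.

Lemma mulmx_absorb n (a b c r w v : 'M[C]_n) : a *m b *m c *m r = c *m r ->
  a *m b *m (c *m (r *m w *m v)) = c *m (r *m w *m v).
Proof. by move=> e; rewrite !mulmxA e. Qed.

Lemma ref_basis_const n (x : {ffun 'I_n -> X}) :
  ref_basis (U ord0) x = tensor (fun _ : 'I_n => U ord0).
Proof. by apply: eq_tensor => t; case: ifP. Qed.

Definition ref_word n (i : 'I_(tdim n d)) : R := \prod_(t < n) lam ord0 (word i t).

Lemma ref_word_ge0 n (i : 'I_(tdim n d)) : 0 <= ref_word i.
Proof. by apply: prodr_ge0 => t _; case: (hlam ord0). Qed.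

(* The truncated word state [Q S]: [S] keeps the eigenvalues of the word state below
   a threshold and [Q] the words that are not too unlikely under the innocent state,
   which bounds the chi-square type second moment of the covering argument. *)
Section WillieTruncation.
Context (n : nat) (tP tQ : R) (tP0 : 0 <= tP) (tQ0 : 0 < tQ).
Context (x : {ffun 'I_n -> X}).
Let B := tensor (fun _ : 'I_n => U ord0).

Lemma ref_basis0_unitary : unitary B.
Proof. exact: unitary_tensor. Qed.

Definition cut_state := dg (own_basis x)
  (fun i => (word_weight own_weight x i <= tP)%R%:R * word_weight lam x i).
Definition cut_proj := dg B (fun i => (tQ <= word_weight ref_weight x i)%R%:R).
Definition cut := cut_proj *m cut_state.

Definition sqrt_ref := dg B (fun i => Num.sqrt (ref_word i)).
(** A pseudo-inverse, since [0^-1 = 0]: it inverts [sqrt_ref] on the support of the innocent state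
    and vanishes off it. *)
Definition sqrt_ref_inv := dg B (fun i => (Num.sqrt (ref_word i))^-1).

Lemma cut_proj_projector : projector (cut_proj : mxAlg _).
Proof.
exact: (projector_dg (fun i => tQ <= word_weight ref_weight x i) ref_basis0_unitary).
Qed.

Lemma word_lam_ge0 i : 0 <= word_weight lam x i.
Proof. by apply: word_weight_ge0 => y a; case: (hlam y). Qed.

Lemma cut_state_psd : psd cut_state.
Proof. by apply: psd_dg => i; rewrite mulr_ge0 // word_lam_ge0. Qed.

Lemma cut_state_le : psd (channel_word x - cut_state).
Proof.
rewrite channel_word_dg; apply: dg_le => i; case: (word_weight own_weight x i <= tP)%R.
  by rewrite mul1r.
by rewrite mul0r word_lam_ge0.
Qed.

Let own_loss : R := trR (dg (own_basis x)
  (fun i => (tP < word_weight own_weight x i)%R%:R) *m channel_word x).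
Let ref_loss : R := trR (dg (ref_basis (U ord0) x)
  (fun i => (word_weight ref_weight x i < tQ)%R%:R) *m channel_word x).

Lemma cut_loss (h : mxAlg (tdim n d)) (eta : R) : contraction h -> 0 < eta ->
  2 * trR (h *m (channel_word x - cut)) <= 2 * own_loss + eta^-1 * ref_loss + eta.
Proof.
move=> hh e0.
have := truncation_bound hh cut_proj_projector
  (cut_state_psd : pos (cut_state : mxAlg _))
  (cut_state_le : pos ((channel_word x : mxAlg _) - cut_state)) e0.
have -> : tr ((channel_word x : mxAlg _) - cut_state) = own_loss.
  rewrite /own_loss channel_word_dg (dgM _ _ (own_basis_unitary x)) [LHS]/=.
  rewrite -dgB; congr trR; apply: eq_dg => i.
  by rewrite leNgt; case: (tP < _)%R; rewrite /= ?mul0r ?subr0 ?mul1r ?subrr.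
have -> : tr ((1 - (cut_proj : mxAlg _)) * channel_word x) = ref_loss.
  rewrite /ref_loss ref_basis_const.
  apply: (congr1 (fun M => trR (M *m channel_word x))).
  rewrite [LHS](dg_compl (fun i => tQ <= word_weight ref_weight x i) ref_basis0_unitary).
  by apply: eq_dg => i; rewrite -ltNge.
have -> : tr (channel_word x : mxAlg _) = 1.
  by rewrite [LHS]/= /trR (proj2 (channel_word_density x)).
by rewrite mulr1.
Qed.

Lemma sqrt_ref_sqr : trR (sqrt_ref *m sqrt_ref) = 1.
Proof.
rewrite (dgM _ _ ref_basis0_unitary) (trR_dg _ ref_basis0_unitary).
have -> : \sum_(i < tdim n d) Num.sqrt (ref_word i) * Num.sqrt (ref_word i) =
    \sum_(i < tdim n d) ref_word i.
  by apply: eq_bigr => i _; rewrite -expr2 sqr_sqrtr ?ref_word_ge0.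
rewrite (sum_word_prod (fun _ => lam ord0)).
by rewrite big1 // => t _; case: (hlam ord0).
Qed.

Lemma sqrt_ref_supp : sqrt_ref *m sqrt_ref_inv *m cut = cut.
Proof.
have hB := ref_basis0_unitary.
have [W eW] := choice (fun y => supp_subP (hsupp y)).
have ew : channel_word x = dg B (@ref_word n) *m tensor (fun t => W (x t)).
  transitivity (tensor (fun _ : 'I_n => dg (U ord0) (lam ord0)) *m
      tensor (fun t => W (x t))).
    by rewrite tensorM; apply: eq_tensor => t; rewrite eW (hsigma ord0).
  by apply: (congr1 (fun M => M *m _)); exact: tensor_dg.
have ec : cut_state = channel_word x *m dg (own_basis x)
    (fun i => (word_weight own_weight x i <= tP)%R%:R).
  rewrite channel_word_dg (dgM _ _ (own_basis_unitary x)).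
  by apply: eq_dg => i; rewrite mulrC.
have es : sqrt_ref *m sqrt_ref_inv *m cut_proj *m dg B (@ref_word n) =
    cut_proj *m dg B (@ref_word n).
  rewrite /sqrt_ref /sqrt_ref_inv /cut_proj.
  rewrite (dgM _ _ hB) (dgM _ _ hB) (dgM _ _ hB) (dgM _ _ hB).
  apply: eq_dg => i; have [->|r0] := eqVneq (ref_word i) 0; first by rewrite !mulr0.
  by rewrite mulfV ?mul1r // sqrtr_eq0 -ltNge lt_neqAle eq_sym r0 ref_word_ge0.
by rewrite /cut ec ew; exact: mulmx_absorb es.
Qed.

(** On the range of [cut_proj] the inverse innocent state is at most [tQ^-1] times its part [zi] at
    the innocent positions. That part cancels one factor of the word spectrum there and leaves
    [own_weight], which [cut_state] keeps below [tP]. *)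
Lemma cut_second_moment :
  form ((sqrt_ref_inv : mxAlg _) * sqrt_ref_inv) 1 (cut : mxAlg _) cut <= tQ^-1 * tP.
Proof.
have hB := ref_basis0_unitary.
pose zi (y : X) (a : 'I_d) : R := if y == ord0 then (lam ord0 a)^-1 else 1.
have zi_ge0 y a : 0 <= zi y a.
  by rewrite /zi; case: ifP => // _; rewrite invr_ge0; case: (hlam ord0).
have -> : form ((sqrt_ref_inv : mxAlg _) * sqrt_ref_inv) 1 (cut : mxAlg _) cut =
    trR (dg B (fun i => (tQ <= word_weight ref_weight x i)%R%:R * (ref_word i)^-1) *m
         (cut_state *m cut_state)).
  transitivity (trR (cut_proj *m (sqrt_ref_inv *m sqrt_ref_inv) *m cut_proj *m
      (cut_state *m cut_state))).
    exact: (@form_cut R (mxAlg _) (sqrt_ref_inv *m sqrt_ref_inv) cut_proj cut_state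
      (dg_adj _ _) (dg_adj _ _)).
  apply: (congr1 (fun M => trR (M *m (cut_state *m cut_state)))).
  rewrite /cut_proj /sqrt_ref_inv (dgM _ _ hB) (dgM _ _ hB) (dgM _ _ hB).
  apply: eq_dg => i; rewrite -[in RHS](sqr_sqrtr (ref_word_ge0 i)).
  by case: (tQ <= _)%R; rewrite ?mul0r ?mul1r ?mulr0 ?mulr1 // expr2 invfM.
have hYY : psd (cut_state *m cut_state).
  by have := psd_adjM cut_state; rewrite dg_adj.
have hle : psd (mxsc _ tQ^-1 *m dg B (word_weight zi x) -
    dg B (fun i => (tQ <= word_weight ref_weight x i)%R%:R * (ref_word i)^-1)).
  apply: mxsc_dg_le => i.
  have hz : 0 <= word_weight zi x i by exact: (word_weight_ge0 _ _ zi_ge0).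
  have -> : (ref_word i)^-1 = (word_weight ref_weight x i)^-1 * word_weight zi x i.
    rewrite /ref_word /word_weight -!prodfV -big_split; apply: eq_bigr => t _.
    by rewrite /= /ref_weight /zi; case: ifP => _; rewrite ?invr1 ?mul1r ?mulr1.
  case: (leP tQ _) => h; last by rewrite mul0r mulr_ge0 // invr_ge0 ltW.
  rewrite mul1r ler_wpM2r // lef_pV2 ?posrE //; exact: lt_le_trans h.
apply: (le_trans (le_trR_psdMl hYY hle)).
rewrite -mulmxA trR_sc ler_pM2l ?invr_gt0 //.
(* [zi] is 1 off the innocent positions and the two bases agree on them, so this weight commutes
   with [cut_state]. *)
have -> : dg B (word_weight zi x) = dg (own_basis x) (word_weight zi x).
  transitivity (tensor (fun t => dg (U ord0) (zi (x t)))); first by symmetry; exact: tensor_dg.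
  transitivity (tensor (fun t => dg (U (x t)) (zi (x t)))); last exact: tensor_dg.
  apply: eq_tensor => t; rewrite /zi; case: eqP => [->|] //.
  by rewrite !dg1.
have hO := own_basis_unitary x.
rewrite /cut_state (dgM _ _ hO) (dgM _ _ hO) (trR_dg _ hO).
have -> : tP = \sum_i tP * word_weight lam x i.
  rewrite -mulr_sumr (sum_word_prod (fun t => lam (x t))).
  by rewrite big1 ?mulr1 // => t _; case: (hlam (x t)).
apply: ler_sum => i _.
have -> : \sum_(j < tdim n d) tP * word_weight lam x j = tP.
  rewrite -mulr_sumr (sum_word_prod (fun t => lam (x t))).
  by rewrite big1 ?mulr1 // => t _; case: (hlam (x t)).
have e : word_weight zi x i * (word_weight lam x i * word_weight lam x i) =
    word_weight own_weight x i * word_weight lam x i.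
  rewrite -!word_weightM; apply: eq_bigr => t _; rewrite /zi /own_weight.
  case: eqP => [->|_]; last by rewrite mul1r.
  have [->|l0] := eqVneq (lam ord0 (word i t)) 0; first by rewrite !mulr0.
  by rewrite mulrA mulVf ?mul1r.
case: (leP _ tP) => h; last by rewrite !(mul0r, mulr0) mulr_ge0 // word_lam_ge0.
by rewrite !mul1r e ler_wpM2r // word_lam_ge0.
Qed.

End WillieTruncation.

Lemma willie_truncation (delta : R) : 0 < delta ->
  exists2 c : R, 0 < c & forall n (alpha : R), 0 <= alpha <= 1 ->
  exists (F : {ffun 'I_n -> X} -> 'M[C]_(tdim n d)) (g ginv : 'M[C]_(tdim n d))
         (e1 e2 : {ffun 'I_n -> X} -> R),
  [/\ [/\ g^† = g, ginv^† = ginv, trR (g *m g) = 1 & forall x, g *m ginv *m F x = F x],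
      iidE (letter_law pt alpha) e1 <= expR (- (c * (n%:R * alpha))) /\
      iidE (letter_law pt alpha) e2 <= expR (- (c * (n%:R * alpha))),
      forall x (h : mxAlg (tdim n d)) (eta : R), contraction h -> 0 < eta ->
        2 * trR (h *m (channel_word x - F x)) <= 2 * e1 x + eta^-1 * e2 x + eta &
      forall x, form ((ginv : mxAlg _) * ginv) 1 (F x : mxAlg _) (F x) <=
        expR (n%:R * alpha * (divergence + 2 * delta))].
Proof.
move=> d0.
have [cP cP0 hP] := large_deviation_upper Hpt own_weight_ge0 own_weight0 d0.
have [cQ cQ0 hQ] := large_deviation_lower Hpt ref_weight_ge0 ref_weight0 d0.
exists (Num.min cP cQ); first by rewrite lt_min cP0.
move=> n alpha a01.
pose u := n%:R * alpha.
pose mP := mean_ln pt own_weight lam.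
pose mQ := mean_ln pt ref_weight (ref_law (U ord0)).
(* The margins are opposite to those of [bob_tests]: decoding needs a likelihood ratio bounded
   below, a second moment one bounded above. *)
pose tP := expR (u * (mP + delta)); pose tQ := expR (u * (mQ - delta)).
have u0 : 0 <= u by case/andP: a01 => *; rewrite mulr_ge0.
have tP0 : 0 <= tP by exact: expR_ge0.
have tQ0 : 0 < tQ by exact: expR_gt0.
exists (fun x => cut tP tQ x), (sqrt_ref n), (sqrt_ref_inv n).
exists (fun x => trR (dg (own_basis x)
  (fun i => (tP < word_weight own_weight x i)%R%:R) *m channel_word x)).
exists (fun x => trR (dg (ref_basis (U ord0) x)
  (fun i => (word_weight ref_weight x i < tQ)%R%:R) *m channel_word x)).
split.
- by split; [exact: dg_adj | exact: dg_adj | exact: sqrt_ref_sqr |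
             move=> x; exact: sqrt_ref_supp].
- split.
    apply: (@le_trans _ _ (expR (- (cP * u)))); last first.
      by rewrite ler_expR lerN2 ler_wpM2r // ge_min lexx.
    apply: le_trans (hP _ n alpha own_stochastic own_dominated a01).
    rewrite le_eqVlt; apply/orP; left; apply/eqP; apply: eq_iidE => x.
    exact: (own_test_trace x (fun w => tP < w)).
  apply: (@le_trans _ _ (expR (- (cQ * u)))); last first.
    by rewrite ler_expR lerN2 ler_wpM2r // ge_min lexx orbT.
  apply: le_trans (hQ _ n alpha (ref_stochastic (hU ord0)) (@ref_dominated (U ord0)) a01).
  rewrite le_eqVlt; apply/orP; left; apply/eqP; apply: eq_iidE => x.
  exact: (ref_test_trace (U ord0) x (fun w => w < tQ)).
- by move=> x h eta hh e0; exact: cut_loss.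
move=> x; apply: le_trans (cut_second_moment tP0 tQ0 x) _.
rewrite /tP /tQ -expRN -expRD ler_expR (divergence_mean (U ord0)) -/mP -/mQ -/u.
by rewrite le_eqVlt; apply/orP; left; apply/eqP; ring.
Qed.

End Channel.

(** * Random coding *)

Section RandomCode.
Context {R : realType} {A : starAlg R} {X : finType} (p : X -> R) (M K : nat).
Hypotheses (p0 : forall x, 0 <= p x) (p1 : \sum_x p x = 1).
Hypotheses (M0 : (0 < M)%N) (K0 : (0 < K)%N).
Context (rho F : X -> A) (e1 e2 miss : X -> R) (f : X -> X -> R) (g ginv : A).
Context (eta zeta B : R).
Hypotheses (rho_pos : forall x, pos (rho x)) (rho_tr : forall x, tr (rho x) = 1).
Hypotheses (miss0 : forall x, 0 <= miss x) (f0 : forall x y, 0 <= f x y).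
Hypotheses (g_adj : adj g = g) (ginv_adj : adj ginv = ginv) (g_tr : tr (g * g) = 1).
Hypothesis g_supp : forall x, g * ginv * F x = F x.
Hypotheses (eta0 : 0 < eta) (zeta0 : 0 < zeta) (zeta1 : zeta < 1).
Hypothesis cut_bound : forall x h, contraction h ->
  2 * tr (h * (rho x - F x)) <= 2 * e1 x + eta^-1 * e2 x + eta.
Hypothesis second_moment : forall x, form (ginv * ginv) 1 (F x) (F x) <= B.

Local Notation codebook := {ffun 'I_M * 'I_K -> X}.
Local Notation I := ('I_M * 'I_K)%type.

(** The bound of [seq_decoder] averaged over messages; [f x y] stands for the probability that the
    test of [x] accepts the output of [y]. *)
Definition decoding_cost (cw : 'I_M -> X) : R := M%:R^-1 * \sum_(m < M)
  (2 * (eta^-1 * \sum_(j < M | j != m) f (cw j) (cw m) + eta) + 2 * miss (cw m)).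

Let cut_cost x := 2 * e1 x + eta^-1 * e2 x + eta.

Definition covering_cost (c : codebook) : R :=
  (#|{: I}|%:R^-1 * \sum_i cut_cost (c i) + \sum_x p x * cut_cost x) +
  (eta + eta^-1 * form (ginv * ginv) 1 (empirical p F c) (empirical p F c)).

Definition mean_state := \sum_x sc A (p x) * rho x.

Lemma decoding_cost_ge0 cw : 0 <= decoding_cost cw.
Proof.
rewrite /decoding_cost mulr_ge0 ?invr_ge0 // sumr_ge0 // => m _.
rewrite addr_ge0 ?mulr_ge0 // addr_ge0 ?(ltW eta0) // mulr_ge0 ?invr_ge0 ?(ltW eta0) //.
by rewrite sumr_ge0.
Qed.

Lemma tr_scr (a : R) (x y : A) : tr (x * (sc A a * y)) = a * tr (x * y).
Proof. exact: tr_scl. Qed.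

Lemma sub_telescope (V : zmodType) (a b d e : V) :
  a - e = a - b + (d - e) + (b - d).
Proof. by rewrite addrAC !addrA !subrK. Qed.

(** The deviation splits into the truncation errors of the sample and of the mean, bounded by
    [cut_bound] for [h] and [- h], and the deviation of the truncated sample, the only part compared
    with the reference [g]. *)
Lemma covering_costP (c : codebook) (h : A) : contraction h ->
  2 * tr (h * (sc A #|{: I}|%:R^-1 * \sum_i rho (c i) - mean_state)) <= covering_cost c.
Proof.
move=> hh; set L := #|{: I}|%:R.
have -> : sc A L^-1 * \sum_i rho (c i) - mean_state =
    (sc A L^-1 * \sum_i (rho (c i) - F (c i)) + \sum_x sc A (p x) * (F x - rho x)) +
    empirical p F c.
  have -> : \sum_x sc A (p x) * (F x - rho x) = \sum_x sc A (p x) * F x - mean_state.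
    by rewrite /mean_state -sumrB; apply: eq_bigr => x _; rewrite mulrBr.
  rewrite sumrB mulrBr /empirical -/L.
  exact: sub_telescope.
have split3 (a b d : A) :
    2 * tr (h * (a + b + d)) = 2 * tr (h * a) + 2 * tr (h * b) + 2 * tr (h * d).
  by rewrite !mulrDr !trD !mulrDr.
rewrite split3 lerD //.
  rewrite lerD //.
    rewrite tr_scr mulrCA mulr_sumr tr_sum mulr_sumr ler_wpM2l ?invr_ge0 //.
    by apply: ler_sum => i _; exact: cut_bound.
  rewrite mulr_sumr tr_sum mulr_sumr; apply: ler_sum => x _.
  rewrite tr_scr mulrCA ler_wpM2l //; have := cut_bound x (contractionN hh).
  by rewrite mulNr -mulrN opprB.
have gE : g * ginv * empirical p F c = empirical p F c.
  rewrite /empirical mulrBr; congr (_ - _).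
    rewrite mulrA -scC -mulrA; congr (_ * _); rewrite mulr_sumr.
    by apply: eq_bigr => i _; exact: g_supp.
  rewrite mulr_sumr; apply: eq_bigr => x _.
  by rewrite mulrA -scC -mulrA g_supp.
by have := covering_AMGM hh g_adj ginv_adj gE eta0; rewrite g_tr mulr1.
Qed.

Lemma mean_decoding_cost (k : 'I_K) :
  iidE p (fun c : codebook => decoding_cost (fun m => c (m, k))) =
  2 * (eta^-1 * (M%:R - 1) * (\sum_x \sum_y p x * p y * f x y) + eta) +
  2 * \sum_x p x * miss x.
Proof.
have MR : M%:R != 0 :> R by rewrite pnatr_eq0 -lt0n.
rewrite /decoding_cost iidEZ iidE_sum; set rhs := RHS.
rewrite (eq_bigr (fun=> rhs)); last first.
  move=> m _; rewrite iidED !iidEZ iidED iidEZ (iidE_cst p1) iidE_sum /rhs.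
  rewrite (iidE1 p1 (m, k) miss); congr (2 * (_ + _) + _); rewrite -mulrA; congr (_ * _).
  rewrite (eq_bigr (fun=> \sum_x \sum_y p x * p y * f x y)); last first.
    move=> j jm; apply: (iidE2 p1 f); apply: contra jm => /eqP[->] //.
  set v := \sum_x _.
  have : \sum_(j < M) v = v + \sum_(j < M | j != m) v by rewrite (bigD1 m).
  by rewrite sumr_const card_ord -mulr_natl => e; lra.
by rewrite sumr_const card_ord -[X in _ * X = _]mulr_natl mulrA mulVf // mul1r.
Qed.

Let cost_mean := \sum_x p x * cut_cost x.

Lemma mean_covering_cost :
  iidE p (fun c : codebook => covering_cost c) <=
  2 * cost_mean + (eta + eta^-1 * (#|{: I}|%:R^-1 * B)).
Proof.
have I0 : (0 < #|{: I}|)%N by rewrite card_prod !card_ord muln_gt0 M0.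
have IR : #|{: I}|%:R != 0 :> R by rewrite pnatr_eq0 -lt0n.
rewrite /covering_cost iidED lerD //.
  rewrite iidED iidEZ iidE_sum (iidE_cst p1).
  rewrite (eq_bigr (fun=> cost_mean)); last by move=> i _; exact: (iidE1 p1 i cut_cost).
  by rewrite sumr_const -[cost_mean *+ _]mulr_natl mulrA mulVf // mul1r /cost_mean; lra.
rewrite iidED (iidE_cst p1) iidEZ lerD2l ler_pM2l ?invr_gt0 //.
have hp : pos (ginv * ginv) by have := pos_adjM ginv; rewrite ginv_adj.
apply: (le_trans (covering_variance p1 F I0 hp)).
rewrite ler_pM2l ?invr_gt0 ?ltr0n //.
rewrite -[leRHS]mul1r -p1 mulr_suml; apply: ler_sum => x _.
by rewrite ler_wpM2l.
Qed.

(* Markov's inequality leaves few keys with a bad decoder; their codebooks are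
   replaced by a good one, which changes the average state very little. *)
Lemma random_code :
  2 * (eta^-1 * (M%:R - 1) * (\sum_x \sum_y p x * p y * f x y) + eta) +
  2 * (\sum_x p x * miss x) +
  (2 * (\sum_x p x * (2 * e1 x + eta^-1 * e2 x + eta)) +
   (eta + eta^-1 * ((M * K)%:R^-1 * B))) <= zeta ^+ 2 ->
  exists cw : 'I_M -> 'I_K -> X,
    (forall k, decoding_cost (fun m => cw m k) <= zeta) /\
    forall h : A, contraction h ->
      tr (h * (sc A (M * K)%:R^-1 * (\sum_m \sum_k rho (cw m k)) - mean_state))
      <= 3 * zeta.
Proof.
move=> hz.
have KR : 0 < K%:R :> R by rewrite ltr0n.
have MR : 0 < M%:R :> R by rewrite ltr0n.
have cI : #|{: I}| = (M * K)%N by rewrite card_prod !card_ord.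
pose dec (c : codebook) k := decoding_cost (fun m => c (m, k)).
have [c hc] : exists c : codebook,
    K%:R^-1 * (\sum_k dec c k) + covering_cost c <= zeta ^+ 2.
  apply: (iidE_exists p1 p0); rewrite iidED; apply: le_trans hz; rewrite lerD //.
    rewrite iidEZ iidE_sum; under eq_bigr do rewrite mean_decoding_cost.
    by rewrite sumr_const card_ord -[X in _ * X]mulr_natl mulrA mulVf ?mul1r // gt_eqF.
  by have := mean_covering_cost; rewrite cI.
have dec0 k : 0 <= dec c k by exact: decoding_cost_ge0.
(* Testing with the zero contraction shows that the cost is nonnegative, so the bound on the sum of
   both costs holds for each of them. *)
have cov0 : 0 <= covering_cost c.
  have h0 : contraction (0 : A).
    by split; [exact: adj0 | rewrite mulr0 subr0; exact: pos1].
  by have := covering_costP c h0; rewrite mul0r tr0 mulr0.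
have sdec : K%:R^-1 * (\sum_k dec c k) <= zeta ^+ 2 by lra.
have scov : covering_cost c <= zeta ^+ 2.
  by have : 0 <= K%:R^-1 * (\sum_k dec c k); [rewrite mulr_ge0 ?invr_ge0 ?sumr_ge0 | lra].
pose bad (k : 'I_K) := (zeta < dec c k)%R.
have nbad : \sum_k (bad k)%:R <= zeta * K%:R :> R.
  rewrite -(ler_pM2l zeta0) mulrA -expr2.
  apply: (@le_trans _ _ (\sum_k dec c k)); last by rewrite -ler_pdivrMr // mulrC.
  rewrite mulr_sumr; apply: ler_sum => k _; rewrite /bad.
  by case: (ltP zeta) => [/ltW|_]; rewrite ?mulr1 ?mulr0.
have [k0 gk0] : exists k0, ~~ bad k0.
  apply: contrapT => /forallNP hb.
  have hb' k : bad k by apply: negbNE; apply/negP; exact: hb.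
  move: nbad; rewrite (eq_bigr (fun=> 1)); last by move=> k _; rewrite hb'.
  rewrite sumr_const card_ord leNgt => /negP; apply.
  by rewrite gtr_pMl.
pose fix_key k := if bad k then k0 else k.
exists (fun m k => c (m, fix_key k)); split.
  move=> k; rewrite /fix_key; case: ifPn => hb.
    by rewrite leNgt.
  by rewrite leNgt.
move=> h hh.
have hcov := covering_costP c hh; rewrite cI in hcov.
set L := sc A (M * K)%:R^-1 in hcov *.
have -> : L * (\sum_m \sum_k rho (c (m, fix_key k))) - mean_state =
    (L * (\sum_i rho (c i)) - mean_state) +
    L * (\sum_m \sum_k (rho (c (m, fix_key k)) - rho (c (m, k)))).
  under [X in _ = _ + L * X]eq_bigr do rewrite sumrB.
  rewrite sumrB (pair_bigA _ (fun m k => rho (c (m, k)))) /= mulrBr.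
  have -> : \sum_i rho (c (i.1, i.2)) = \sum_i rho (c i).
    by apply: eq_bigr => -[].
  by rewrite [RHS]addrC addrA subrK.
rewrite mulrDr trD.
have : tr (h * (L * (\sum_m \sum_k (rho (c (m, fix_key k)) - rho (c (m, k)))))) <=
    2 * zeta.
  rewrite tr_scr natrM invfM.
  have hk m k : tr (h * (rho (c (m, fix_key k)) - rho (c (m, k)))) <= 2 * (bad k)%:R.
    rewrite /fix_key; case: ifP => _; last by rewrite subrr mulr0 tr0 mulr0.
    have h1 := contraction_tr hh (rho_pos (c (m, k0))).
    have h2 := contraction_tr (contractionN hh) (rho_pos (c (m, k))).
    rewrite mulNr trN in h2; rewrite mulrBr trB mulr1.
    by move: h1 h2; rewrite !rho_tr; lra.
  have hs : tr (h * (\sum_m \sum_k (rho (c (m, fix_key k)) - rho (c (m, k))))) <=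
      M%:R * (2 * (zeta * K%:R)).
    rewrite mulr_sumr tr_sum.
    apply: (@le_trans _ _ (\sum_(m < M) 2 * (zeta * K%:R))); last first.
      by rewrite sumr_const card_ord -[leLHS]mulr_natl.
    apply: ler_sum => m _; rewrite mulr_sumr tr_sum.
    apply: (@le_trans _ _ (\sum_k 2 * (bad k)%:R)); first by apply: ler_sum.
    by rewrite -mulr_sumr ler_pM2l.
  have MK0 : 0 < M%:R^-1 * K%:R^-1 :> R by rewrite mulr_gt0 ?invr_gt0.
  apply: (@le_trans _ _ (M%:R^-1 * K%:R^-1 * (M%:R * (2 * (zeta * K%:R))))).
    by rewrite ler_pM2l.
  suff -> : M%:R^-1 * K%:R^-1 * (M%:R * (2 * (zeta * K%:R))) = 2 * zeta by [].
  by field; rewrite !gt_eqF.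
(* The sampled code contributes at most zeta^2 / 2 and the replacement of a fraction zeta of the
   keys at most 2 zeta. *)
have : zeta ^+ 2 <= zeta by rewrite expr2 ger_pMr // ltW.
lra.
Qed.

End RandomCode.

(** * Random codes for the channel *)

Section FiniteCode.
Context {R : realType} {N : nat} (pt : 'I_N.+1 -> R) (Hpt : distr_nz pt).
Local Notation C := (R[i]).
Local Notation X := 'I_N.+1.

Definition word_law n (alpha : R) (x : {ffun 'I_n -> X}) : R :=
  \prod_t letter_law pt alpha (x t).

Lemma word_law1 n alpha : \sum_(x : {ffun 'I_n -> X}) word_law alpha x = 1.
Proof.
have := @iidE_cst R 'I_n X (letter_law pt alpha) (letter_law1 Hpt alpha) 1.
by rewrite /iidE; under eq_bigr do rewrite mulr1.
Qed.

Lemma word_law_ge0 n (alpha : R) (x : {ffun 'I_n -> X}) : 0 <= alpha <= 1 ->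
  0 <= word_law alpha x.
Proof. by move=> a01; apply: prodr_ge0 => t _; exact: letter_law_ge0. Qed.

Lemma mean_state_tensor n d (sigma : X -> 'M[C]_d) alpha :
  @mean_state R (mxAlg (tdim n d)) _ (word_law alpha) (@channel_word _ _ _ sigma n) =
  tensor (fun _ : 'I_n => channel_mean pt sigma alpha).
Proof.
rewrite -tensor_mean; apply: eq_bigr => x _.
exact: mul_scalar_mx.
Qed.

Lemma mean_false_alarm n d (sigma : X -> 'M[C]_d) (alpha : R)
    (T : {ffun 'I_n -> X} -> 'M[C]_(tdim n d)) :
  \sum_x \sum_y word_law alpha x * word_law alpha y *
     trR (T x *m channel_word sigma y) =
  iidE (letter_law pt alpha)
    (fun x => trR (T x *m tensor (fun _ : 'I_n => channel_mean pt sigma alpha))).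
Proof.
apply: eq_bigr => x _; rewrite -tensor_mean mulmx_sumr trR_sum mulr_sumr.
by apply: eq_bigr => y _; rewrite -scalemxAr trRZ mulrA.
Qed.

Lemma finite_code n dB dW (sigma : X -> 'M[C]_dB) (rho : X -> 'M[C]_dW)
    (alpha : R) (M K : nat)
    (T : {ffun 'I_n -> X} -> 'M[C]_(tdim n dB))
    (F : {ffun 'I_n -> X} -> 'M[C]_(tdim n dW)) (g ginv : 'M[C]_(tdim n dW))
    (e1 e2 : {ffun 'I_n -> X} -> R) (eta zeta B : R) :
  (forall x, density (sigma x)) -> (forall x, density (rho x)) ->
  0 <= alpha <= 1 -> (0 < M)%N -> (0 < K)%N -> 0 < eta -> 0 < zeta -> zeta < 1 ->
  (forall x, test (T x : mxAlg _)) ->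
  [/\ g^† = g, ginv^† = ginv, trR (g *m g) = 1 & forall x, g *m ginv *m F x = F x] ->
  (forall x (h : mxAlg (tdim n dW)) (eta : R), contraction h -> 0 < eta ->
     2 * trR (h *m (channel_word rho x - F x)) <= 2 * e1 x + eta^-1 * e2 x + eta) ->
  (forall x, form ((ginv : mxAlg _) * ginv) 1 (F x : mxAlg _) (F x) <= B) ->
  2 * (eta^-1 * (M%:R - 1) * iidE (letter_law pt alpha)
     (fun x => trR (T x *m tensor (fun _ : 'I_n => channel_mean pt sigma alpha))) + eta) +
  2 * iidE (letter_law pt alpha) (fun x => trR ((1%:M - T x) *m channel_word sigma x)) +
  (2 * (2 * iidE (letter_law pt alpha) e1 + eta^-1 * iidE (letter_law pt alpha) e2 + eta) +
   (eta + eta^-1 * ((M * K)%:R^-1 * B))) <= zeta ^+ 2 ->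
  exists (cw : 'I_M -> 'I_K -> 'I_n -> X) (L : 'I_K -> 'I_M -> 'M[C]_(tdim n dB)),
  [/\ forall k, povm (L k), forall k, err_B sigma cw L k <= zeta &
      trace_close (willie_avg rho cw)
        (tensor (fun _ : 'I_n => rho_alpha pt rho alpha)) (3 * zeta)].
Proof.
move=> dS dR a01 M0 K0 eta0 zeta0 zeta1 hT [hg hgi hgt hgs] hcut hB hz.
have dSw (x : {ffun 'I_n -> X}) : density (channel_word sigma x).
  by apply: tensor_density => t.
have dRw (x : {ffun 'I_n -> X}) : density (channel_word rho x).
  by apply: tensor_density => t.
pose miss (x : {ffun 'I_n -> X}) := trR ((1%:M - T x) *m channel_word sigma x).
pose f (x y : {ffun 'I_n -> X}) := trR (T x *m channel_word sigma y).
have miss0 x : 0 <= miss x.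
  by apply: trR_psdM; [case: (hT x) | case: (dSw x)].
have f0 x y : 0 <= f x y by apply: trR_psdM; [case: (hT x) | case: (dSw y)].
have rho_pos (x : {ffun 'I_n -> X}) : pos (channel_word rho x : mxAlg _) by case: (dRw x).
have rho_tr (x : {ffun 'I_n -> X}) : tr (channel_word rho x : mxAlg _) = 1.
  by rewrite [LHS]/= /trR (proj2 (dRw x)).
have hz' : 2 * (eta^-1 * (M%:R - 1) *
     (\sum_x \sum_y word_law alpha x * word_law alpha y * f x y) + eta) +
  2 * (\sum_x word_law alpha x * miss x) +
  (2 * (\sum_x word_law alpha x * (2 * e1 x + eta^-1 * e2 x + eta)) +
   (eta + eta^-1 * ((M * K)%:R^-1 * B))) <= zeta ^+ 2.
  rewrite mean_false_alarm.
  have -> : \sum_x word_law alpha x * (2 * e1 x + eta^-1 * e2 x + eta) =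
     2 * iidE (letter_law pt alpha) e1 + eta^-1 * iidE (letter_law pt alpha) e2 + eta.
    rewrite -[X in _ = _ + X](iidE_cst (I := 'I_n) (letter_law1 Hpt alpha) eta).
    by rewrite -!iidEZ -!iidED.
  exact: hz.
have [cw [hdec hcov]] := @random_code R (mxAlg (tdim n dW)) _ (word_law alpha) M K
  (fun x => word_law_ge0 x a01) (word_law1 n alpha) M0 K0 (@channel_word _ _ _ rho n) F
  e1 e2 miss f g ginv eta zeta B rho_pos rho_tr miss0 f0 hg hgi hgt hgs eta0 zeta0 zeta1
  (fun x h hh => hcut x h eta hh eta0) hB hz'.
have hL k : exists L : 'I_M -> 'M[C]_(tdim n dB), povm L /\
    forall m rho0 (e : R), psd rho0 -> trR rho0 = 1 -> 0 < e ->
    1 - trR (L m *m rho0) <=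
    2 * (e^-1 * \sum_(j < M | j != m) trR (T (cw j k) *m rho0) + e)
    + 2 * trR ((1%:M - T (cw m k)) *m rho0).
  have [L [L1 L2 L3]] := @seq_decoder R (mxAlg (tdim n dB)) M (fun m => T (cw m k)) M0
    (fun m => hT (cw m k)).
  by exists L; split.
have [L hL'] := choice hL.
exists (fun m k t => cw m k t), L; split.
- by move=> k; case: (hL' k).
- move=> k; apply: le_trans (hdec k).
  rewrite /err_B /decoding_cost ler_pM2l ?invr_gt0 ?ltr0n //.
  apply: ler_sum => m _.
  have [_ h] := hL' k; have [hp ht] := dSw (cw m k).
  by apply: (h m (channel_word sigma (cw m k)) eta hp _ eta0); rewrite /trR ht.
move=> h hh; have := hcov h hh.
rewrite mean_state_tensor channel_mean_rho_alpha.
have -> : willie_avg rho (fun m k t => cw m k t) =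
    (sc (mxAlg (tdim n dW)) (M * K)%:R^-1 *
    (\sum_m \sum_k channel_word rho (cw m k)) : 'M[C]_(tdim n dW)).
  by symmetry; exact: mul_scalar_mx.
by [].
Qed.

End FiniteCode.

(** * Covertness *)

Section Willie.
Context {R : realType} {N d : nat} (pt : 'I_N.+1 -> R) (Hpt : distr_nz pt).
Local Notation C := (R[i]).
Local Notation X := 'I_N.+1.

Lemma willie_avg_density n M K (rho : X -> 'M[C]_d) (cw : 'I_M -> 'I_K -> 'I_n -> X) :
  (forall x, density (rho x)) -> (0 < M)%N -> (0 < K)%N -> density (willie_avg rho cw).
Proof.
move=> hr M0 K0.
have hw m k : density (tensor (fun t => rho (cw m k t))) by exact: tensor_density.
split.
  apply: psdZ; first by rewrite invr_ge0.
  by apply: psd_sum => m _; apply: psd_sum => k _; case: (hw m k).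
rewrite /willie_avg mxtraceZ raddf_sum /=.
rewrite (eq_bigr (fun=> K%:R)); last first.
  move=> m _; rewrite raddf_sum /= (eq_bigr (fun=> 1)); last by move=> k _; case: (hw m k).
  by rewrite sumr_const card_ord.
rewrite sumr_const card_ord -[X in _ * X]mulr_natl -natrM.
rewrite fmorphV rmorph_nat mulVf // pnatr_eq0 -lt0n muln_gt0 M0 //.
Qed.

(** The dimension is d^n and each nonzero innocent eigenvalue is a product of n factors, so both
    logarithms in [relent_close] grow linearly in n. *)
Lemma relent_word_close n (A B : 'M[C]_(tdim n d)) (V : 'M[C]_d) g (eps : R) :
  unitary V -> prob g -> (0 < n)%N -> density A -> density B -> 0 < eps <= 1 ->
  trace_close A B eps ->
  `|relent A (tensor (fun _ : 'I_n => dg V g)) -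
    relent B (tensor (fun _ : 'I_n => dg V g))| <=
  eps * (1 + (1 + n%:R * ln d%:R - ln eps) + n%:R * (1 + \sum_a `|ln (g a)|)).
Proof.
move=> hV [g0 g1] n0 dA dB he hAB; have /andP[e0 e1] := he.
pose Lam := 1 + \sum_a `|ln (g a)|.
have Lam0 : 0 < Lam by apply: ltr_pwDl => //; exact: sumr_ge0.
have nR : 0 < n%:R :> R by rewrite ltr0n.
have dR : 0 < d%:R :> R.
  rewrite ltr0n lt0n; apply/eqP => d0; move: g1; rewrite big1 => [/esym/eqP|a _].
    by rewrite oner_eq0.
  by have := ltn_ord a; rewrite {2}d0.
have hLam (i : 'I_(tdim n d)) : `|ln (\prod_t g (word i t))| <= n%:R * Lam.
  have [/eqP h|h] := eqVneq (\prod_t g (word i t)) 0.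
    by rewrite (eqP h) ln0 // normr0 mulr_ge0 // ltW.
  have hg t : 0 < g (word i t).
    rewrite lt_neqAle g0 andbT eq_sym; apply: contra h => /eqP h.
    by rewrite (bigD1 t) //= h mul0r.
  rewrite ln_prod //; apply: le_trans (ler_norm_sum _ _ _) _.
  rewrite -[n in n%:R]card_ord mulr_natl -sumr_const; apply: ler_sum => t _.
  by rewrite /Lam (bigD1 (word i t)) //= addrCA lerDl addr_ge0 // sumr_ge0.
have hVn : unitary (tensor (fun _ : 'I_n => V)) by exact: unitary_tensor.
have nL : 0 < n%:R * Lam by rewrite mulr_gt0.
have := relent_close dA dB hVn nL hLam he hAB.
have -> : tensor (fun _ : 'I_n => dg V g) =
    dg (tensor (fun _ : 'I_n => V)) (fun i => \prod_t g (word i t)) by exact: tensor_dg.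
move=> /le_trans; apply.
rewrite ler_pM2l // lerD2r lerD2l /tdim card_ffun !card_ord natrX.
rewrite ln_div ?posrE ?mulr_gt0 ?exprn_gt0 // lnM ?posrE ?exprn_gt0 // lnXn //.
rewrite -[_ *+ n]mulr_natl lerD2r lerD2r.
by have := @ln_le_subr1 R 2 (ltr0Sn R 1); lra.
Qed.

Lemma sub_shuffle (V : zmodType) (r a b : V) : r - a + b - r = b - a.
Proof. by rewrite addrAC (addrAC r) subrr sub0r addrC. Qed.

Lemma rho_alpha_density (rho : X -> 'M[C]_d) (alpha : R) :
  (forall x, density (rho x)) -> 0 <= alpha <= 1 -> density (rho_alpha pt rho alpha).
Proof.
move=> hr a01; have [U [lam [hU hlam hsigma]]] := density_family_spectral hr.
by rewrite -channel_mean_rho_alpha; exact: (channel_mean_density Hpt hU hlam hsigma).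
Qed.

Lemma relent_rho_alpha (rho : X -> 'M[C]_d) :
  (forall x, density (rho x)) -> (forall x, supp_sub (rho x) (rho ord0)) ->
  exists2 c : R, 0 < c & forall n (alpha : R), 0 <= alpha <= 1 ->
  relent (tensor (fun _ : 'I_n => rho_alpha pt rho alpha))
         (tensor (fun _ : 'I_n => rho ord0)) <= c * (n%:R * alpha ^+ 2).
Proof.
move=> hr hs.
have [W eW] := choice (fun x => supp_subP (hs x)).
have [V [g [hV hg eV]]] := density_spectral (hr ord0).
(* A positive lower bound for all nonzero eigenvalues; zero ones add nothing to the sum because
   [0^-1 = 0]. *)
pose mu : R := (1 + \sum_a (g a)^-1)^-1.
have s0 : 0 <= \sum_a (g a)^-1.
  by apply: sumr_ge0 => a _; rewrite invr_ge0; case: hg.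
have mu0 : 0 < mu by rewrite invr_gt0; lra.
have hmu a : g a != 0 -> mu <= g a.
  move=> ga; have ga0 : 0 < g a by rewrite lt_neqAle eq_sym ga /= (proj1 hg).
  rewrite -[leRHS]invrK lef_pV2 ?posrE ?invr_gt0 //; last by lra.
  rewrite (bigD1 a) //= addrCA lerDl addr_ge0 // sumr_ge0 // => b _.
  by rewrite invr_ge0; case: hg.
pose D := mixture pt rho - rho ord0.
pose q := trR (D *m D).
have q0 : 0 <= q.
  rewrite /q; have hD : D^† = D.
    rewrite /D adjmxB /mixture adjmx_sum.
    congr (_ - _); last by apply: psd_herm; case: (hr ord0).
    apply: eq_bigr => x _; rewrite adjmxZr; congr (_ *: _).
    by apply: psd_herm; case: (hr x).
  by have := psd_trR (psd_adjM D); rewrite hD.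
(* The added 1 keeps the constant positive even if the mixture equals the innocent state. *)
exists (mu^-1 * q + 1).
  by have : 0 <= mu^-1 * q by [rewrite mulr_ge0 // invr_ge0 ltW]; lra.
move=> n alpha a01.
pose S := rho_alpha pt rho alpha.
have dS : density S by exact: rho_alpha_density.
have [U [f [hU hf eS]]] := density_spectral dS.
have [Z eZ] : exists Z, S = dg V g *m Z.
  exists ((1 - alpha)%:C *: 1%:M + alpha%:C *: \sum_x (pt x)%:C *: W x).
  rewrite -eV mulmxDr -!scalemxAr mulmx1 mulmx_sumr /S /rho_alpha /mixture.
  congr (_ + _ *: _); apply: eq_bigr => x _.
  by rewrite -scalemxAr -eW.
rewrite -/S eV (relent_tensor n hV dS (proj1 hg) eZ).
have hov i j : g j = 0 -> f i != 0 -> ov U V i j = 0.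
  by apply: (supp_ov hU hV (proj1 hf)); rewrite -eS; exact: eZ.
have := relent_le hU hV hf hg mu0 hmu hov; rewrite -eS -eV.
have -> : trR ((S - rho ord0) *m (S - rho ord0)) = alpha ^+ 2 * q.
  have -> : S - rho ord0 = alpha%:C *: D.
    rewrite /S /rho_alpha /D rmorphB rmorph1 scalerBl scale1r scalerBr.
    exact: sub_shuffle.
  by rewrite -scalemxAl -scalemxAr !trRZ -/q; ring.
move=> h; have nR : 0 <= n%:R :> R by [].
apply: le_trans (ler_wpM2l nR h) _.
have : 0 <= n%:R * alpha ^+ 2 by rewrite mulr_ge0 // sqr_ge0.
have -> : n%:R * (mu^-1 * (alpha ^+ 2 * q)) = mu^-1 * q * (n%:R * alpha ^+ 2) by ring.
by rewrite mulrDl mul1r lerDl.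
Qed.

End Willie.

(** * Growth of gamma_n sqrt n *)

Section Asymptotics.
Context {R : realType} (gamma : R^nat).
Hypothesis Hg0 : gamma @ \oo --> (0 : R).
Hypothesis Hg1 : (fun n : nat => Num.sqrt n%:R * gamma n / ln n%:R) @ \oo --> +oo.

Definition load n : R := gamma n * Num.sqrt n%:R.

Lemma near_ln_le_load (a : R) : \forall n \near \oo, a * ln n%:R <= load n.
Proof.
move/cvgryPge : Hg1 => /(_ a) h.
near=> n.
have ln0 : 0 < ln n%:R :> R.
  apply: ln_gt0; rewrite ltr1n; near: n; exact: nbhs_infty_gt.
rewrite -ler_pdivlMr // /load [gamma n * _]mulrC; near: n; exact: h.
Unshelve. all: by end_near.
Qed.

Lemma near_load_ge (b : R) : \forall n \near \oo, b <= load n.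
Proof.
have l2 : 0 < ln 2 :> R by apply: ln_gt0; rewrite ltr1n.
near=> n.
have h : `|b| / ln 2 * ln n%:R <= load n.
  by near: n; exact: near_ln_le_load.
apply: le_trans h; apply: (le_trans (ler_norm b)).
rewrite -mulrA ler_peMr // mulrC ler_pdivlMr // mul1r ler_ln ?posrE ?ltr0n //.
  by rewrite ler_nat; near: n; exact: nbhs_infty_ge.
near: n; exact: nbhs_infty_gt.
Unshelve. all: by end_near.
Qed.

Lemma near_const_le_exp (c b : R) : 0 < c -> \forall n \near \oo, b <= expR (c * load n).
Proof.
move=> c0; near=> n; have [b0|b0] := leP b 0; first by apply: le_trans b0 (expR_ge0 _).
rewrite -[leLHS]lnK ?posrE // ler_expR mulrC -ler_pdivrMr //.
by near: n; exact: near_load_ge.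
Unshelve. all: by end_near.
Qed.

(** The growth of the load beyond every multiple of ln n enters here: it lets an arbitrarily small
    part of the exponent absorb a factor n. *)
Lemma near_nat_le_exp (c : R) : 0 < c -> \forall n \near \oo, n%:R <= expR (c * load n).
Proof.
move=> c0; near=> n.
have n0 : 0 < n%:R :> R by rewrite ltr0n; near: n; exact: nbhs_infty_gt.
rewrite -[leLHS]lnK ?posrE // ler_expR mulrC -ler_pdivrMr // mulrC.
by near: n; exact: near_ln_le_load.
Unshelve. all: by end_near.
Qed.

Lemma near_load_facts : \forall n \near \oo,
  [/\ (0 < n)%N, 0 <= gamma n / Num.sqrt n%:R <= 1,
      n%:R * (gamma n / Num.sqrt n%:R) = load n,
      0 < load n <= n%:R &
      n%:R * (gamma n / Num.sqrt n%:R) ^+ 2 = gamma n ^+ 2 /\ gamma n ^+ 2 <= 1].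
Proof.
near=> n.
have n0 : (0 < n)%N by near: n; exact: nbhs_infty_gt.
have nR : 1 <= n%:R :> R by rewrite ler1n.
have n0R : 0 < n%:R :> R by rewrite ltr0n.
have g1 : `|gamma n| <= 1.
  by near: n; apply: (cvgr0_norm_le _ Hg0).
have l0 : 0 < load n.
  by apply: (@lt_le_trans _ _ 1) => //; near: n; exact: near_load_ge.
set s := Num.sqrt n%:R.
have s0 : 0 < s by rewrite sqrtr_gt0.
have ss : s * s = n%:R by rewrite -expr2 sqr_sqrtr // ltW.
have g0 : 0 < gamma n by move: l0; rewrite /load pmulr_lgt0.
rewrite gtr0_norm // in g1.
have s1 : 1 <= s by rewrite -sqrtr1 ler_wsqrtr.
have sn : s <= n%:R by rewrite -ss ler_peMl // ltW.
split=> //.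
- rewrite divr_ge0 ?(ltW g0) ?(ltW s0) //= ler_pdivrMr // mul1r.
  exact: le_trans g1 s1.
- by rewrite /load -/s -ss; field; rewrite gt_eqF.
- rewrite l0 /= /load -/s; apply: le_trans sn.
  by rewrite ler_piMl // ltW.
split; last by rewrite expr_le1 // ltW.
by rewrite -ss; field; rewrite gt_eqF.
Unshelve. all: by end_near.
Qed.

End Asymptotics.

(** * Strict positivity of relative entropy *)

Section RelentPositive.
Context {R : realType}.
Local Notation C := (R[i]).

Lemma trR_adjM_eq0 n (D : 'M[C]_n) : trR (D^† *m D) = 0 -> D = 0.
Proof.
pose s i j := complex.Re (D j i) ^+ 2 + complex.Im (D j i) ^+ 2.
have s0 i j : 0 <= s i j by rewrite addr_ge0 ?sqr_ge0.
move=> h; have /eqP : \sum_i \sum_j s i j = 0.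
  rewrite -[RHS]h /trR /mxtrace Re_sum; apply: eq_bigr => i _; rewrite mxE Re_sum.
  by apply: eq_bigr => j _; rewrite adjmxE /s; case: (D j i) => a b /=; ring.
rewrite psumr_eq0 => [/allP h1|i _]; last exact: sumr_ge0.
apply/matrixP => i j; rewrite [RHS]mxE.
have := h1 j (mem_index_enum j); rewrite /= psumr_eq0 //.
move=> /allP/(_ i (mem_index_enum i)) /=; rewrite /s paddr_eq0 ?sqr_ge0 // !sqrf_eq0.
by case: (D i j) => a b /= /andP[/eqP -> /eqP ->].
Qed.

Lemma relent_ge_sqr n (A B : 'M[C]_n) : density A -> density B -> supp_sub A B ->
  4^-1 * trR ((A - B) *m (A - B)) <= relent A B.
Proof.
move=> dA dB /supp_subP[W].
have [U [f [hU hf ->]]] := density_spectral dA.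
have [V [g [hV hg ->]]] := density_spectral dB.
move=> eW; apply: relent_ge => // i j.
exact: (supp_ov hU hV (proj1 hf) eW).
Qed.

Lemma density_sub_herm n (A B : 'M[C]_n) : density A -> density B ->
  (A - B)^† = A - B.
Proof. by move=> [hA _] [hB _]; rewrite adjmxB (psd_herm hA) (psd_herm hB). Qed.

Lemma relent_ge0 n (A B : 'M[C]_n) : density A -> density B -> supp_sub A B ->
  0 <= relent A B.
Proof.
move=> dA dB hs; apply: le_trans (relent_ge_sqr dA dB hs).
have := psd_trR (psd_adjM (A - B)); rewrite (density_sub_herm dA dB) => h.
by rewrite mulr_ge0 // invr_ge0.
Qed.

Lemma relent_eq0 n (A B : 'M[C]_n) : density A -> density B -> supp_sub A B ->
  relent A B = 0 -> A = B.
Proof.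
move=> dA dB hs h0; have := relent_ge_sqr dA dB hs; rewrite h0.
have := psd_trR (psd_adjM (A - B)); have := @trR_adjM_eq0 n (A - B).
rewrite (density_sub_herm dA dB) => h h1 h2; apply/eqP; rewrite -subr_eq0; apply/eqP.
by apply: h; apply/eqP; rewrite eq_le h1 andbT -(@pmulr_rle0 _ 4^-1) ?invr_gt0.
Qed.

End RelentPositive.

(** * Error exponents for Bob and for Willie *)

Section Divergence.
Context {R : realType} {N d : nat} (pt : 'I_N.+1 -> R) (Hpt : distr_nz pt).
Local Notation C := (R[i]).
Context (sigma : 'I_N.+1 -> 'M[C]_d).
Hypotheses (Hsig : forall x, density (sigma x)).
Hypothesis (Hsupp : forall x, supp_sub (sigma x) (sigma ord0)).

Lemma divergence_ge0 : 0 <= divergence pt sigma.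
Proof.
by apply: sumr_ge0 => x _; rewrite mulr_ge0 ?relent_ge0 //; case: Hpt => _ [].
Qed.

(** A vanishing divergence forces every letter charged by [pt] to have the innocent state, and then
    [pt] itself exhibits that state as a mixture. *)
Lemma divergence_gt0 : not_mixture sigma -> 0 < divergence pt sigma.
Proof.
move=> hmix; have [pt0 [ptge0 pt1]] := Hpt.
rewrite lt_neqAle divergence_ge0 andbT eq_sym; apply/eqP => /eqP.
rewrite psumr_eq0 => [/allP h|x _]; last by rewrite mulr_ge0 ?relent_ge0.
case: hmix; exists pt; split => //.
have -> : mixture pt sigma = \sum_x (pt x)%:C *: sigma ord0.
  apply: eq_bigr => x _; have := h x (mem_index_enum x); rewrite /= mulf_eq0.
  case/orP => /eqP; first by move=> ->; rewrite !scale0r.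
  by move=> /(relent_eq0 (Hsig x) (Hsig ord0) (Hsupp x)) ->.
by rewrite -scaler_suml -rmorph_sum pt1 scale1r.
Qed.

Lemma bob_error (vs : R) : 0 < vs < 1 ->
  exists c C0 : R, [/\ 0 < c, 0 <= C0 & forall n (alpha : R) (M : nat),
  0 <= alpha <= 1 -> n%:R * alpha ^+ 2 <= 1 ->
  1 <= (M%:R : R) <= expR ((1 - vs) * (n%:R * alpha) * divergence pt sigma) ->
  exists T : {ffun 'I_n -> 'I_N.+1} -> 'M[C]_(tdim n d),
  [/\ forall x, test (T x : mxAlg _),
      iidE (letter_law pt alpha) (fun x => trR ((1%:M - T x) *m channel_word sigma x)) <=
        C0 * expR (- (c * (n%:R * alpha))) &
      (M%:R - 1) * iidE (letter_law pt alpha)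
        (fun x => trR (T x *m tensor (fun _ : 'I_n => channel_mean pt sigma alpha))) <=
        C0 * expR (- (c * (n%:R * alpha)))]].
Proof.
move=> /andP[vs0 vs1]; have := divergence_ge0; rewrite le_eqVlt => /orP[/eqP D0|D0].
  (* With zero divergence the size constraint forces M = 1, and the test that always accepts is
     error free. *)
  exists 1, 0; split => // n alpha M a01 _.
  rewrite -D0 mulr0 expR0 => /le_anti <-.
  exists (fun=> 1%:M); split; first by move=> x; exact: (@test1 R (mxAlg (tdim n d))).
    rewrite mul0r -[leRHS](iidE_cst (I := 'I_n) (letter_law1 Hpt alpha) 0) le_eqVlt.
    by apply/orP; left; apply/eqP/eq_iidE => x; rewrite subrr mul0mx /trR mxtrace0.
  by rewrite subrr !mul0r.
have [U [lam [hU hlam hsigma]]] := density_family_spectral Hsig.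
pose D := divergence pt sigma.
(* The margin costs vs D / 2 of the false-alarm exponent D; the rate (1 - vs) D of the messages
   leaves vs D / 2. The factor [expR c0] in the constant pays for n alpha^2 <= 1. *)
have [|c [c0 [c_gt0 c0_ge0 h]]] := @bob_tests _ _ _ _ Hpt _ _ _ hU hlam hsigma Hsupp (vs * D / 4).
  by rewrite divr_gt0 // mulr_gt0.
exists (Num.min c (vs * D / 2)), (5 + expR c0); split.
- by rewrite lt_min c_gt0 divr_gt0 // mulr_gt0.
- by rewrite addr_ge0 ?expR_ge0.
move=> n alpha M a01 na /andP[M1 M2].
have [T [hT h1 h2]] := h n alpha a01.
have u0 : 0 <= n%:R * alpha by rewrite mulr_ge0 //; case/andP: a01.
set u := n%:R * alpha in u0 h1 h2 M2 *.
exists T; split => //.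
  apply: le_trans h1 _; apply: ler_pM; rewrite ?expR_ge0 ?lerDl ?expR_ge0 //.
  by rewrite ler_expR lerN2 ler_wpM2r // ge_min lexx.
apply: (@le_trans _ _ ((M%:R - 1) *
    expR (- (u * (D - 2 * (vs * D / 4))) + c0 * (n%:R * alpha ^+ 2)))).
  by rewrite ler_wpM2l // subr_ge0.
apply: (@le_trans _ _ (expR ((1 - vs) * u * D) *
    (expR (- (u * (D - 2 * (vs * D / 4)))) * expR c0))).
  rewrite ler_pM ?subr_ge0 ?expR_ge0 //; first by apply: le_trans M2; rewrite lerBlDr lerDl.
  by rewrite -expRD ler_expR lerD2l -[leRHS]mulr1 ler_wpM2l.
rewrite mulrA -expRD mulrC ler_pM ?expR_ge0 ?lerDr // ler_expR.
apply: (@le_trans _ _ (- (vs * D / 2 * u))); last by rewrite lerN2 ler_wpM2r // ge_min lexx orbT.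
by rewrite le_eqVlt; apply/orP; left; apply/eqP; field.
Qed.

(** With margin vs D / 4 the second moment has exponent (1 + vs / 2) D, so a sample of rate (1 + vs)
    D leaves vs D / 2, positive because D is. *)
Lemma willie_resolvability (vs : R) : 0 < vs -> 0 < divergence pt sigma ->
  exists2 c : R, 0 < c & forall n (alpha : R), 0 <= alpha <= 1 ->
  exists (F : {ffun 'I_n -> 'I_N.+1} -> 'M[C]_(tdim n d)) (g ginv : 'M[C]_(tdim n d))
         (e1 e2 : {ffun 'I_n -> 'I_N.+1} -> R) (B : R),
  [/\ [/\ g^† = g, ginv^† = ginv, trR (g *m g) = 1 & forall x, g *m ginv *m F x = F x],
      iidE (letter_law pt alpha) e1 <= expR (- (c * (n%:R * alpha))) /\
      iidE (letter_law pt alpha) e2 <= expR (- (c * (n%:R * alpha))),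
      forall x (h : mxAlg (tdim n d)) (eta : R), contraction h -> 0 < eta ->
        2 * trR (h *m (channel_word sigma x - F x)) <= 2 * e1 x + eta^-1 * e2 x + eta,
      forall x, form ((ginv : mxAlg _) * ginv) 1 (F x : mxAlg _) (F x) <= B &
      forall L : R, 0 < L ->
        expR ((1 + vs) * (n%:R * alpha) * divergence pt sigma) <= 2 * L ->
        L^-1 * B <= 2 * expR (- (c * (n%:R * alpha)))].
Proof.
move=> vs0 D0.
have [U [lam [hU hlam hsigma]]] := density_family_spectral Hsig.
set D := divergence pt sigma in D0 *.
have [|c c_gt0 h] := @willie_truncation _ _ _ _ Hpt _ _ _ hU hlam hsigma Hsupp (vs * D / 4).
  by rewrite divr_gt0 // mulr_gt0.
exists (Num.min c (vs * D / 2)); first by rewrite lt_min c_gt0 divr_gt0 // mulr_gt0.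
move=> n alpha a01; have [F [g [ginv [e1 [e2 [hg [he1 he2] hcut hB]]]]]] := h n alpha a01.
have u0 : 0 <= n%:R * alpha by rewrite mulr_ge0 //; case/andP: a01.
set u := n%:R * alpha in u0 he1 he2 hB *.
have hc : expR (- (c * u)) <= expR (- (Num.min c (vs * D / 2) * u)).
  by rewrite ler_expR lerN2 ler_wpM2r // ge_min lexx.
exists F, g, ginv, e1, e2, (expR (u * (D + 2 * (vs * D / 4)))); split => //.
  by split; apply: le_trans hc.
move=> L L0 hL; rewrite mulrC ler_pdivrMr //.
apply: (@le_trans _ _ (expR ((1 + vs) * u * D) * expR (- (vs * D / 2 * u)))).
  by rewrite -expRD ler_expR le_eqVlt; apply/orP; left; apply/eqP; field.
rewrite [leRHS]mulrAC ler_pM ?expR_ge0 //.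
by rewrite ler_expR lerN2 ler_wpM2r // ge_min lexx orbT.
Qed.

End Divergence.

(** The AM-GM parameter is set to q while all probabilities are of order q^2, so terms in q and in
    q^-1 balance. *)
Lemma error_budget (R : realFieldType) (q a f m e1 e2 b : R) : 0 < q <= 1 -> 0 <= a ->
  f <= a * q ^+ 2 -> m <= a * q ^+ 2 -> e1 <= q ^+ 2 -> e2 <= q ^+ 2 -> b <= 2 * q ^+ 2 ->
  2 * (q^-1 * f + q) + 2 * m + (2 * (2 * e1 + q^-1 * e2 + q) + (q + q^-1 * b)) <=
  (4 * a + 13) * q.
Proof.
move=> /andP[q0 q1] a0 hf hm he1 he2 hb.
have qV (x k : R) : x <= k * q ^+ 2 -> q^-1 * x <= k * q.
  by move=> h; rewrite ler_pdivrMl // mulrCA -expr2.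
have hq : q ^+ 2 <= q by rewrite expr2 ler_piMl // ltW.
have := qV _ _ hf; have := qV _ _ hb; have := @qV e2 1; rewrite !mul1r => /(_ he2).
have : a * q ^+ 2 <= a * q by rewrite ler_wpM2l.
lra.
Qed.

Lemma continuity_budget (R : realFieldType) (n l k u t : R) : 1 <= n -> u <= n -> 0 <= k ->
  1 + (1 + n * l - - (k * u)) + n * t <= n * (2 + `|l| + k + t).
Proof.
move=> n1 un k0; have n0 : 0 <= n by lra.
have : n * l <= n * `|l| by rewrite ler_wpM2l // ler_norm.
have : k * u <= k * n by rewrite ler_wpM2l.
lra.
Qed.

(** Since a >= 0 keeps the truncation at least 1, rounding [M] down loses at most a factor 2;
    rounding [K] up loses nothing in the product. *)
Lemma code_sizes (R : realType) (a b : R) : 0 <= a -> exists M K : nat,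
  [/\ M = Num.truncn (expR a), K%:Z = Num.ceil (expR b),
      1 <= (M%:R : R) <= expR a, (0 < K)%N & expR (a + b) <= 2 * (M * K)%:R].
Proof.
move=> a0; exists (Num.truncn (expR a)), `|Num.ceil (expR b)|%N.
have ea : 1 <= expR a by rewrite -expR0 ler_expR.
have /andP[M1 M2] := truncn_itv (ltW (expR_gt0 a)).
have M0 : 1 <= (Num.truncn (expR a))%:R :> R.
  by rewrite ler1n truncn_gt0.
have cb : 0 < Num.ceil (expR b) by rewrite ceil_gt0 expR_gt0.
have eK : `|Num.ceil (expR b)|%N%:Z = Num.ceil (expR b) by rewrite gez0_abs // ltW.
split => //; first by rewrite M0.
  by rewrite -ltz_nat eK.
have K1 : expR b <= (`|Num.ceil (expR b)|%N)%:R.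
  by apply: le_trans (ceil_ge _) _; rewrite -eK.
rewrite expRD natrM mulrA ler_pM ?expR_ge0 //.
move: M2; rewrite -natr1; lra.
Qed.

(** * Existence of the code at a fixed blocklength *)

Section CovertCode.
Context {R : realType} {N dB dW : nat} (pt : 'I_N.+1 -> R) (Hpt : distr_nz pt).
Local Notation C := (R[i]).
Context (sigma : 'I_N.+1 -> 'M[C]_dB) (rho : 'I_N.+1 -> 'M[C]_dW).
Hypotheses (Hsig : forall x, density (sigma x)) (Hrho : forall x, density (rho x)).
Hypothesis (Hsupp_sig : forall x, supp_sub (sigma x) (sigma ord0)).
Hypothesis (Hsupp_rho : forall x, supp_sub (rho x) (rho ord0)).
Hypothesis Hnotmix : not_mixture rho.

Lemma covert_code (vs : R) : 0 < vs < 1 ->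
  exists c C0 : R, [/\ 0 < c, 0 <= C0 & forall n (alpha zeta : R) (M K : nat),
  0 <= alpha <= 1 -> n%:R * alpha ^+ 2 <= 1 ->
  1 <= (M%:R : R) <= expR ((1 - vs) * (n%:R * alpha) * divergence pt sigma) ->
  (0 < K)%N ->
  expR ((1 + vs) * (n%:R * alpha) * divergence pt rho) <= 2 * (M * K)%:R ->
  0 < zeta -> zeta < 1 -> C0 * expR (- (c * (n%:R * alpha))) <= zeta ^+ 2 ->
  exists (cw : 'I_M -> 'I_K -> 'I_n -> 'I_N.+1) (L : 'I_K -> 'I_M -> 'M[C]_(tdim n dB)),
  [/\ forall k, povm (L k), forall k, err_B sigma cw L k <= zeta &
      trace_close (willie_avg rho cw)
        (tensor (fun _ : 'I_n => rho_alpha pt rho alpha)) (3 * zeta)]].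
Proof.
move=> hvs; have /andP[vs0 vs1] := hvs.
have [cB [C0 [cB0 C00 hB]]] := bob_error Hpt Hsig Hsupp_sig hvs.
have Drho := divergence_gt0 Hpt Hrho Hsupp_rho Hnotmix.
have [cW cW0 hW] := willie_resolvability Hpt Hrho Hsupp_rho vs0 Drho.
exists (Num.min cB cW / 2), (4 * C0 + 13); split.
- by rewrite divr_gt0 // lt_min cB0.
- lra.
move=> n alpha zeta M K a01 na hM K0 hMK z0 z1 hz.
have u0 : 0 <= n%:R * alpha by rewrite mulr_ge0 //; case/andP: a01.
have [T [hT hmiss hfa]] := hB n alpha M a01 na hM.
have [F [g [ginv [e1 [e2 [B [hg [he1 he2] hcut hF hL]]]]]]] := hW n alpha a01.
have M0 : (0 < M)%N by move: hM; rewrite ler1n => /andP[].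
have L0 : 0 < (M * K)%:R :> R by rewrite ltr0n muln_gt0 M0.
have hBL := hL _ L0 hMK.
pose q := expR (- (Num.min cB cW / 2 * (n%:R * alpha))).
have q0 : 0 < q by exact: expR_gt0.
have q01 : 0 < q <= 1.
  rewrite q0 /= -expR0 ler_expR oppr_le0 mulr_ge0 // divr_ge0 //.
  by rewrite le_min (ltW cB0) ltW.
have qE : q ^+ 2 = expR (- (Num.min cB cW * (n%:R * alpha))).
  by rewrite expr2 -expRD; congr expR; field.
have qB : expR (- (cB * (n%:R * alpha))) <= q ^+ 2.
  by rewrite qE ler_expR lerN2 ler_wpM2r // ge_min lexx.
have qW : expR (- (cW * (n%:R * alpha))) <= q ^+ 2.
  by rewrite qE ler_expR lerN2 ler_wpM2r // ge_min lexx orbT.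
apply: (@finite_code _ _ _ Hpt n dB dW sigma rho alpha M K T F g ginv e1 e2 q zeta B) => //.
apply: le_trans hz; rewrite -mulrA; apply: error_budget => //.
- by apply: le_trans hfa _; rewrite ler_wpM2l.
- by apply: le_trans hmiss _; rewrite ler_wpM2l.
- exact: le_trans he1 qW.
- exact: le_trans he2 qW.
by apply: le_trans hBL _; rewrite ler_wpM2l.
Qed.

End CovertCode.

Lemma trace_close_le (R : realType) n (A B : 'M[R[i]]_n) (e e' : R) :
  e <= e' -> trace_close A B e -> trace_close A B e'.
Proof. by move=> he h k /h/le_trans; apply. Qed.

Theorem theorem4 (R : realType) (N dB dW : nat)
  (sigma : 'I_N.+1 -> 'M[R[i]]_dB) (rho : 'I_N.+1 -> 'M[R[i]]_dW)
  (Hsig : forall x, density (sigma x)) (Hrho : forall x, density (rho x))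
  (Hsupp_sig : forall x, supp_sub (sigma x) (sigma ord0))
  (Hsupp_rho : forall x, supp_sub (rho x) (rho ord0))
  (Hnotmix : not_mixture rho)
  (pt : 'I_N.+1 -> R) (Hpt : distr_nz pt)
  (gamma : R^nat)
  (Hg0 : gamma @ \oo --> (0 : R))
  (Hg1 : (fun n : nat => Num.sqrt n%:R * gamma n / ln n%:R) @ \oo --> +oo) :
  let alpha := fun n : nat => gamma n / Num.sqrt n%:R in
  forall vs : R, 0 < vs < 1 ->
  exists vs1 vs2 vs3 : R, 0 < vs1 /\ 0 < vs2 /\ 0 < vs3 /\
  \forall n \near \oo,
    let lnM := (1 - vs) * gamma n * Num.sqrt n%:R *
               \sum_(x < N.+1) pt x * relent (sigma x) (sigma ord0) in
    let lnK := gamma n * Num.sqrt n%:R *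
               Num.max 0 (\sum_(x < N.+1) pt x *
                 ((1 + vs) * relent (rho x) (rho ord0)
                  - (1 - vs) * relent (sigma x) (sigma ord0))) in
    exists (M K : nat) (cw : 'I_M -> 'I_K -> 'I_n -> 'I_N.+1)
           (L : 'I_K -> 'I_M -> 'M[R[i]]_(tdim n dB)),
      M = Num.truncn (expR lnM) /\
      (K%:Z = Num.ceil (expR lnK))%R /\
      (forall k, povm (L k)) /\
      (forall k, err_B sigma cw L k <= expR (- (vs1 * gamma n * Num.sqrt n%:R))) /\
      `| relent (willie_avg rho cw) (tensor (fun _ : 'I_n => rho ord0))
         - relent (tensor (fun _ : 'I_n => rho_alpha pt rho (alpha n)))
                  (tensor (fun _ : 'I_n => rho ord0)) |
        <= expR (- (vs2 * gamma n * Num.sqrt n%:R)) /\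
      relent (tensor (fun _ : 'I_n => rho_alpha pt rho (alpha n)))
             (tensor (fun _ : 'I_n => rho ord0)) <= vs3 * gamma n ^+ 2.
Proof.
move=> alpha vs hvs; have /andP[vs0 vs1] := hvs.
have [c [C0 [c0 C00 hcode]]] :=
  covert_code Hpt Hsig Hrho Hsupp_sig Hsupp_rho Hnotmix hvs.
have [c3 c30 hc3] := relent_rho_alpha Hpt Hrho Hsupp_rho.
have [V [g [hV hg eV]]] := density_spectral (Hrho ord0).
pose Lam := 1 + \sum_a `|ln (g a)|.
have Lam0 : 0 <= Lam by rewrite addr_ge0 // sumr_ge0.
(* The summand c / 8 accounts for - ln eps = (c / 8) u with u <= n, where [eps] is the trace
   distance fixed below. *)
pose C2 := 2 + `|ln dW%:R| + c / 8 + Lam.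
have C20 : 0 <= C2
  by apply: addr_ge0 => //; apply: addr_ge0; [exact: addr_ge0 | rewrite ltW // divr_gt0].
(* The exponent c of [covert_code] is spent in stages: c / 2 absorbs [C0] and the square root of the
   rest gives zeta with c / 4; the factor 3 takes c / 8, leaving c / 8 for [eps]; the factors n and
   [C2] take c / 32 each, leaving c / 16. *)
exists (c / 4), (c / 16), c3; split; first by rewrite divr_gt0.
split; first by rewrite divr_gt0.
split => //.
have [c2 c8 c32] : [/\ 0 < c / 2, 0 < c / 8 & 0 < c / 32] by split; rewrite divr_gt0.
pose a n : R := (1 - vs) * gamma n * Num.sqrt n%:R *
  \sum_(x < N.+1) pt x * relent (sigma x) (sigma ord0).
pose b n : R := gamma n * Num.sqrt n%:R * Num.max 0 (\sum_(x < N.+1) pt x *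
  ((1 + vs) * relent (rho x) (rho ord0) - (1 - vs) * relent (sigma x) (sigma ord0))).
near=> n; rewrite -/(a n) -/(b n).
have [n0 a01 una /andP[u0 un] [na2 g2]] : [/\ (0 < n)%N, 0 <= alpha n <= 1,
    n%:R * alpha n = load gamma n, 0 < load gamma n <= n%:R &
    n%:R * alpha n ^+ 2 = gamma n ^+ 2 /\ gamma n ^+ 2 <= 1].
  by near: n; exact: near_load_facts Hg0 Hg1.
have hC0 : C0 <= expR (c / 2 * load gamma n) by near: n; exact: near_const_le_exp.
have h3 : 3 <= expR (c / 8 * load gamma n) by near: n; exact: near_const_le_exp.
have hC2 : C2 <= expR (c / 32 * load gamma n) by near: n; exact: near_const_le_exp.
have hn : n%:R <= expR (c / 32 * load gamma n) by near: n; exact: near_nat_le_exp.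
have lE (k : R) : k * gamma n * Num.sqrt n%:R = k * load gamma n by rewrite mulrA.
set u := load gamma n in lE una u0 un hC0 h3 hC2 hn.
have Ds0 := divergence_ge0 Hpt Hsig Hsupp_sig.
have ea : a n = (1 - vs) * u * divergence pt sigma.
  by rewrite /a /u /load mulrA.
have eb : b n = u * Num.max 0 ((1 + vs) * divergence pt rho -
    (1 - vs) * divergence pt sigma).
  rewrite /b /u /load; congr (_ * Num.max _ _).
  rewrite /divergence !mulr_sumr -sumrB; apply: eq_bigr => x _.
  by rewrite mulrBr !(mulrCA (pt x)).
have a0 : 0 <= a n.
  by rewrite ea mulr_ge0 // mulr_ge0 ?ltW // subr_gt0.
have [M [K [eM eK hM K0 hMK]]] := code_sizes (b n) a0.
pose zeta := expR (- (c / 4 * u)).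
have z0 : 0 < zeta by exact: expR_gt0.
have z1 : zeta < 1.
  by rewrite -expR0 ltr_expR oppr_lt0 mulr_gt0 // divr_gt0.
have [|||||||cw [L [hL herr htc]]] := hcode n (alpha n) zeta M K a01.
- by rewrite na2.
- by rewrite una -ea.
- exact: K0.
(* Whatever the sign of the bracket in the key rate, the two rates add up to at least the
   resolvability rate; if it is negative, the messages alone supply enough randomness. *)
- apply: le_trans hMK; rewrite una ler_expR ea eb.
  rewrite -lerBlDl; apply: (@le_trans _ _ (u * ((1 + vs) * divergence pt rho -
    (1 - vs) * divergence pt sigma))); last by rewrite ler_wpM2l ?le_max ?lexx ?orbT // ltW.
  by rewrite le_eqVlt; apply/orP; left; apply/eqP; ring.
- exact: z0.
- exact: z1.
- rewrite una; apply: le_trans (ler_wpM2r (expR_ge0 _) hC0) _.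
  by rewrite -expRD expr2 -expRD ler_expR le_eqVlt; apply/orP; left; apply/eqP; field.
exists M, K, cw, L; do 3 (split => //); split.
  move=> k; apply: le_trans (herr k) _.
  by rewrite lE.
have M0 : (0 < M)%N by move: hM; rewrite ler1n => /andP[].
split; last first.
  by apply: le_trans (hc3 n (alpha n) a01) _; rewrite na2.
pose eps := expR (- (c / 8 * u)).
have e01 : 0 < eps <= 1.
  by rewrite expR_gt0 -expR0 ler_expR oppr_le0 mulr_ge0 // ltW.
have hze : 3 * zeta <= eps.
  apply: le_trans (ler_wpM2r (ltW z0) h3) _.
  by rewrite -expRD ler_expR le_eqVlt; apply/orP; left; apply/eqP; field.
rewrite eV.
have dA := willie_avg_density cw Hrho M0 K0.
have dB' : density (tensor (fun _ : 'I_n => rho_alpha pt rho (alpha n))).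
  by apply: tensor_density => _; exact: rho_alpha_density.
apply: le_trans (relent_word_close hV hg n0 dA dB' e01 (trace_close_le hze htc)) _.
apply: (@le_trans _ _ (eps * (n%:R * C2))).
  rewrite ler_wpM2l ?expR_ge0 // /eps expRK.
  by apply: continuity_budget; rewrite ?ler1n // ltW.
rewrite mulrCA; apply: (@le_trans _ _ (expR (c / 32 * u) * (eps * expR (c / 32 * u)))).
  apply: ler_pM => //; first by rewrite mulr_ge0 ?expR_ge0.
  by rewrite ler_wpM2l ?expR_ge0.
by rewrite -!expRD lE ler_expR le_eqVlt; apply/orP; left; apply/eqP; field.
Unshelve. all: by end_near.
Qed.
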